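(* Let $X\in\mathcal C$. Then the following are equivalent: 1) $X$ is of type $2$ or $3$; 2) $X=aX_f+bX_g$ with $f$ and $g$ in involution and $a,b\in C^\infty(J^1(\tau))$; 3) $X=a\,\partial_p+b\,\partial_q$ in an appropriate contact chart $(x,y,z,p,q)$, with $a,b\in C^\infty(J^1(\tau))$; 4) $X$ admits two independent first integrals in involution; 5) $X$ belongs to at least one 2-dimensional integrable subdistribution of $\mathcal C$.
   Context: Everything is $C^\infty$ and local. $J^1(\tau)$ is the 5-dimensional manifold of 1-jets of functions $z=z(x,y)$, with coordinates $(x,y,z,p,q)$; $U=dz-p\,dx-q\,dy$ and $\mathcal C=\{U=0\}$ is the contact distribution. A contact chart is a local coordinate system $(x,y,z,p,q)$ on $J^1(\tau)$ in which $\mathcal C=\{dz-p\,dx-q\,dy=0\}$. ''$X\in\mathcal P$'' means that the vector field $X$ is a local section of the distribution $\mathcal P$. $X(T)$ is the Lie derivative of $T$ along $X$. Integrable means involutive. The type of a (nowhere zero) field $X\in\mathcal C$ is the rank, assumed constant, of the system of 1-forms $U,X(U),X^2(U),X^3(U)$ (iterated Lie derivatives); it is $2$, $3$ or $4$. For $f\in C^\infty(J^1(\tau))$, $X_f$ is the unique field in $\mathcal C$ with $X_f\lrcorner dU=df+\lambda U$ for some function $\lambda$. In a contact chart, $X_f=\partial_p(f)\widehat\partial_x+\partial_q(f)\widehat\partial_y-\widehat\partial_x(f)\partial_p-\widehat\partial_y(f)\partial_q$ with $\widehat\partial_x=\partial_x+p\partial_z$, $\widehat\partial_y=\partial_y+q\partial_z$.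 Two functions $f,g$ are in involution if $X_f(g)=0$ (equivalently $X_g(f)=0$, equivalently $dU(X_f,X_g)=0$). Functions $f,g$ used here are regular in the sense that $X_f,X_g$ do not vanish; independence of $f,g$ as first integrals means that $df,dg,U$ are linearly independent at each point. A first integral of $X$ is a function $f$ with $X(f)=0$. *)

(* Defs.v *)
From HB Require Import structures.
From mathcomp Require Import all_boot all_order all_algebra.
From mathcomp Require Import all_classical all_reals all_analysis ring.

Set Implicit Arguments.
Unset Strict Implicit.
Unset Printing Implicit Defensive.

Import Order.TTheory GRing.Theory Num.Theory.
Import numFieldNormedType.Exports.

Local Open Scope classical_set_scope.
Local Open Scope ring_scope.

(* A local model of J^1(tau): open subsets of R^5, with coordinates           *)
(* (x, y, z, p, q) = (m 0 ix, m 0 iy, m 0 iz, m 0 ip, m 0 iq).                *)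
(* A vector field is given by its components, and so is a 1-form (by its      *)
(* coefficients in the basis dx, dy, dz, dp, dq); smoothness is a separate    *)
(* requirement, relative to an open set.                                      *)
Definition ix : 'I_5 := @Ordinal 5 0 isT.
Definition iy : 'I_5 := @Ordinal 5 1 isT.
Definition iz : 'I_5 := @Ordinal 5 2 isT.
Definition ip : 'I_5 := @Ordinal 5 3 isT.
Definition iq : 'I_5 := @Ordinal 5 4 isT.

Section JetSpace.
Variable R : realType.

Definition jet := 'rV[R]_5.
Definition func := jet -> R^o.
Definition vfield := jet -> 'rV[R]_5.
Definition oneform := jet -> 'rV[R]_5.

Definition unitv (i : 'I_5) : 'rV[R]_5 := delta_mx 0 i.

Section Smooth.
Variable V : normedModType R.

Definition partials (s : seq 'I_5) (f : jet -> V) : jet -> V :=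
  foldr (fun i g m => 'D_(unitv i) g m) f s.

(* C^oo on W: the iterated partial derivatives of all orders exist and are    *)
(* (Frechet) differentiable at each point of W.                               *)
Definition smooth (W : set jet) (f : jet -> V) :=
  forall (s : seq 'I_5) (m : jet), W m -> differentiable (partials s f) m.
End Smooth.

Definition pairing (w v : 'rV[R]_5) : R := (v *m w^T) 0 0.

Definition differential (f : func) : oneform :=
  fun m => \row_j 'D_(unitv j) f m.

(* (d w)_m(u, v) = (D_u w)_m(v) - (D_v w)_m(u) *)
Definition extd (w : oneform) (m : jet) (u v : 'rV[R]_5) : R :=
  pairing ('D_u w m) v - pairing ('D_v w m) u.

(* v _| (d w)_m *)
Definition contract_extd (v : 'rV[R]_5) (w : oneform) (m : jet) : 'rV[R]_5 :=
  \row_j extd w m v (unitv j).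

(* (L_X w)_j = X(w_j) + sum_i w_i (d X^i / d x^j) *)
Definition lie (X : vfield) (w : oneform) : oneform := fun m =>
  'D_(X m) w m + \row_j pairing (w m) ('D_(unitv j) X m).

Definition bracket (X Y : vfield) : vfield :=
  fun m => 'D_(X m) Y m - 'D_(Y m) X m.

(* U = dz - p dx - q dy *)
Definition U : oneform := fun m =>
  unitv iz - m 0 ip *: unitv ix - m 0 iq *: unitv iy.

(* A distribution assigns to m the row space of a matrix. *)
Definition plane_field := jet -> 'M[R]_5.

Definition annihilator (w : 'rV[R]_5) : 'M[R]_5 := kermx w^T.

Definition contact : plane_field := fun m => annihilator (U m).

Definition smooth_distribution (k : nat) (W : set jet) (D : plane_field) :=
  forall m, W m -> exists (V : set jet) (Y : 'I_k -> vfield),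
    [/\ open V, V m, V `<=` W, (forall i, smooth V (Y i)) &
        forall m', V m' ->
          (D m' == \matrix_i Y i m')%MS /\ \rank (D m') = k].

Definition is_section (W : set jet) (D : plane_field) (X : vfield) :=
  smooth W X /\ forall m, W m -> (X m <= D m)%MS.

Definition involutive_field (W : set jet) (D : plane_field) :=
  forall (V : set jet) (Y Z : vfield), open V -> V `<=` W ->
    is_section V D Y -> is_section V D Z -> is_section V D (bracket Y Z).

Definition has_type (W : set jet) (X : vfield) (k : nat) :=
  forall m, W m -> \rank (\matrix_(i < 4) iter i (lie X) U m) = k.

(* X_f, by its defining property; see charFieldP and charFieldE. *)
Definition charField (f : func) : vfield := fun m =>
  xget 0 [set v | (v <= contact m)%MS /\
    exists lambda : R,
      contract_extd v U m = differential f m + lambda *: U m].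

Definition first_integral (W : set jet) (X : vfield) (f : func) :=
  forall m, W m -> 'D_(X m) f m = 0.

Definition in_involution (W : set jet) (f g : func) :=
  first_integral W (charField f) g.

Definition regular_function (W : set jet) (f : func) :=
  forall m, W m -> charField f m != 0.

Definition independent_functions (W : set jet) (f g : func) :=
  forall m, W m ->
    row_free (col_mx (col_mx (differential f m) (differential g m)) (U m)).

(* phi : W -> phi(W) is a local coordinate system, with inverse psi. *)
Definition is_chart (W : set jet) (phi psi : jet -> jet) :=
  [/\ open W, open (phi @` W), smooth W phi, smooth (phi @` W) psi &
      forall m, W m -> psi (phi m) = m].

(* d/d(phi_i) *)
Definition coord_field (phi psi : jet -> jet) (i : 'I_5) : vfield :=
  fun m => 'D_(unitv i) psi (phi m).

Definition coord (phi : jet -> jet) (i : 'I_5) : func := fun m => phi m 0 i.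

(* dz - p dx - q dy for the coordinates (x, y, z, p, q) = phi *)
Definition chart_form (phi : jet -> jet) : oneform := fun m =>
  differential (coord phi iz) m
    - coord phi ip m *: differential (coord phi ix) m
    - coord phi iq m *: differential (coord phi iy) m.

Definition contact_chart (W : set jet) (phi psi : jet -> jet) :=
  is_chart W phi psi /\
  forall m, W m -> (contact m == annihilator (chart_form phi m))%MS.

Local Lemma is_derive_coord (i : 'I_5) (u : 'rV[R]_5) (m v : jet) :
  is_derive m v (fun m : jet => m 0 i *: u) (v 0 i *: u).
Proof.
have cv : (fun h : R =>
    h^-1 *: (((h *: v + m) 0 i *: u) - m 0 i *: u)) @ 0^' --> v 0 i *: u.
  apply: cvg_near_cst; near=> h.
  rewrite -scalerBl !mxE addrK scalerA mulKf //.
  by near: h; exact: nbhs_dnbhs_neq.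
by split; [apply/cvg_ex; exists (v 0 i *: u) | exact: cvg_lim cv].
Unshelve. all: by end_near. Qed.

Lemma derive_U (m v : jet) :
  'D_v U m = - (v 0 ip *: unitv ix) - v 0 iq *: unitv iy.
Proof.
have D := is_deriveB (is_deriveB (is_derive_cst (unitv iz) m v)
  (is_derive_coord ip (unitv ix) m v)) (is_derive_coord iq (unitv iy) m v).
by rewrite (@derive_val _ _ _ _ _ _ _ D) sub0r.
Qed.

Lemma extd_U (m u v : jet) : extd U m u v =
  u 0 ix * v 0 ip - u 0 ip * v 0 ix + (u 0 iy * v 0 iq - u 0 iq * v 0 iy).
Proof.
rewrite /extd !derive_U /pairing !mxE !big_ord_recl !big_ord0 /= !mxE /=.
have -> : lift ord0 ord0 = iy :> 'I_5 by exact/val_inj.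
have -> : ord0 = ix :> 'I_5 by exact/val_inj.
by ring.
Qed.

(* The expression of X_f in coordinates. *)
Definition charField_expr (f : func) : vfield := fun m =>
  let d i := 'D_(unitv i) f m in
  let dhx := d ix + m 0 ip * d iz in
  let dhy := d iy + m 0 iq * d iz in
  d ip *: (unitv ix + m 0 ip *: unitv iz)
  + d iq *: (unitv iy + m 0 iq *: unitv iz)
  - dhx *: unitv ip - dhy *: unitv iq.

Local Lemma ord5P (P : 'I_5 -> Prop) :
  P ix -> P iy -> P iz -> P ip -> P iq -> forall j, P j.
Proof.
move=> Px Py Pz Pp Pq [[|[|[|[|[|//]]]]] h].
- by rewrite (_ : Ordinal h = ix) //; exact/val_inj.
- by rewrite (_ : Ordinal h = iy) //; exact/val_inj.
- by rewrite (_ : Ordinal h = iz) //; exact/val_inj.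
- by rewrite (_ : Ordinal h = ip) //; exact/val_inj.
- by rewrite (_ : Ordinal h = iq) //; exact/val_inj.
Qed.

Local Lemma contactE (m : jet) (v : 'rV[R]_5) :
  (v <= contact m)%MS <-> v 0 iz = m 0 ip * v 0 ix + m 0 iq * v 0 iy.
Proof.
have E : (v *m (U m)^T) 0 0 = v 0 iz - (m 0 ip * v 0 ix + m 0 iq * v 0 iy).
  rewrite !mxE !big_ord_recl !big_ord0 /= !mxE /=.
  have -> : lift ord0 (lift ord0 ord0) = iz :> 'I_5 by exact/val_inj.
  have -> : lift ord0 ord0 = iy :> 'I_5 by exact/val_inj.
  have -> : ord0 = ix :> 'I_5 by exact/val_inj.
  by ring.
rewrite /contact /annihilator sub_kermx; split.
  by move=> /eqP/matrixP/(_ 0 0); rewrite E mxE => /eqP; rewrite subr_eq0 => /eqP.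
move=> H; apply/eqP/matrixP => i j.
by rewrite !ord1 E H subrr mxE.
Qed.

Local Lemma charField_aux (d : 'I_5 -> R) (m : jet) (v : 'rV[R]_5) :
  (v <= contact m)%MS /\ (exists lambda : R,
     contract_extd v U m = \row_j d j + lambda *: U m) <->
  v = d ip *: (unitv ix + m 0 ip *: unitv iz)
      + d iq *: (unitv iy + m 0 iq *: unitv iz)
      - (d ix + m 0 ip * d iz) *: unitv ip
      - (d iy + m 0 iq * d iz) *: unitv iq.
Proof.
pose simp := (mulr0, mulr1, oppr0, subr0, addr0, add0r, sub0r).
rewrite contactE; split.
  case=> vz [l /rowP E]; apply/rowP.
  have := (E ix, E iy, E iz, E ip, E iq); rewrite !mxE !extd_U !mxE /= !simp.
  move=> [[[[Ex Ey] Ez] Ep] Eq].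
  have El : l = - d iz by apply/eqP; rewrite -addr_eq0 addrC -Ez.
  have vp : v 0 ip = - (d ix + m 0 ip * d iz).
    by rewrite -[LHS]opprK Ex El mulrNN mulrC.
  have vq : v 0 iq = - (d iy + m 0 iq * d iz).
    by rewrite -[LHS]opprK Ey El mulrNN mulrC.
  apply: ord5P; rewrite !mxE /= !simp //.
  by rewrite vz Ep Eq mulrC [X in _ + X]mulrC.
move=> ->; split.
  by rewrite !mxE /= !simp mulrC [X in _ + X]mulrC.
exists (- d iz); apply/rowP.
apply: ord5P; rewrite !mxE !extd_U !mxE /= !simp ?subrr //.
- by rewrite opprK mulrNN mulrC.
- by rewrite opprK mulrNN mulrC.
Qed.

Lemma charFieldP (f : func) (m : jet) (v : 'rV[R]_5) :
  (v <= contact m)%MS /\ (exists lambda : R,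
     contract_extd v U m = differential f m + lambda *: U m) <->
  v = charField_expr f m.
Proof. exact: (charField_aux (fun i => 'D_(unitv i) f m)). Qed.

Lemma charFieldE (f : func) : charField f = charField_expr f.
Proof.
apply/funext => m; rewrite /charField.
by case: xgetP => [v _ /charFieldP // | /(_ (charField_expr f m))[]];
  apply/charFieldP.
Qed.

End JetSpace.

(* Main.v *)
From HB Require Import structures.
Require Import Defs.
From mathcomp Require Import all_boot all_order all_algebra.
From mathcomp Require Import all_classical all_reals all_analysis ring lra.

Import Order.TTheory GRing.Theory Num.Theory.
Import numFieldNormedType.Exports.

Set Implicit Arguments.
Unset Strict Implicit.
Unset Printing Implicit Defensive.

Local Open Scope classical_set_scope.
Local Open Scope ring_scope.

(** Write U_k for the iterated Lie derivative X^k(U). Since U(X) = 0, the form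
U_1 is the contraction of dU with X, so that U_0 and U_1 are independent
and the type of X is at least 2; being constant, it is at most 3 as soon as
U_0, ..., U_3 are dependent at the single point m0.

Conditions 2, 4 and 5 each make these forms dependent. If X lies in an
involutive plane field D contained in the contact distribution, Cartan's
formula X(w(Y)) = (X w)(Y) + w([X, Y]) shows by induction that every U_k
annihilates D, so the U_k span at most three dimensions
([distribution_rank]). If X = a X_f + b X_g with f and g in involution, then
U_1 is a combination of U, df and dg, while X(df) = X(dg) = 0; hence every
U_k is in the span of U, df and dg ([span_rank]). Condition 4 reduces to
condition 2, because the common kernel of df, dg and U is a plane that
contains X, X_f and X_g ([first_integrals_decomposition]).

The substance is that type at most 3 yields a contact chart in which X is
vertical ([type_contact_chart]). The rank bound gives a field Y that is
independent of X and killed by U_0, ..., U_3. The type being constant, U_4 is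
a combination of U_0, ..., U_3 ([fourth_derivative_span]), so the condition
of being killed by U_0, ..., U_3 is preserved by the flow of X. Now follow
the flow of Y for a time x_1, then the flow of X for a time x_0, from a
transversal 3-plane with coordinates x_2, x_3, x_4. In the coordinates
obtained in this way the first coordinate field is X, and U vanishes on the
first two ([adapted_parametrization]). Hence x_2, x_3, x_4 are first
integrals of X, and U is a combination of their differentials
([three_integrals]). Dividing by a nonzero coefficient,
U = c (dz - p dx - q dy), where x, y, z are these integrals in some order;
nondegeneracy of dU on the contact planes makes (x, y, z, p, q) a coordinate
system ([contact_chart_of_integrals]). As X kills x, y and z, it is a
combination of d/dp and d/dq.

In any contact chart with U = c (dz - p dx - q dy), the fields d/dp and d/dq
are -c X_x and -c X_y, and x, y are independent and in involution. So a
vertical X satisfies conditions 2, 4 and 5, the plane field of the last one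
being spanned by d/dp and d/dq.

Two tools from analysis carry this. Smooth flows are built by Euler's method
with dyadic steps ([flow_exists]): the derivative of a flow is the flow of
the tangent lift of the field, which gives smoothness by induction. The
inverse function theorem ([inverse_function]) is then obtained by flowing
along a right inverse of the derivative. *)

(** * Derivatives and smooth maps between normed spaces *)

Section DiffEstimates.
Context {R : realType} {V W : normedModType R}.
Implicit Types (f g : V -> W) (x : V).

Lemma diff_estimate f x : differentiable f x -> forall e : R, 0 < e ->
  exists2 d : R, 0 < d & forall h, `|h| < d ->
    `|f (x + h) - f x - 'd f x h| <= e * `|h|.
Proof.
move=> df e e0.
have /eqaddoP /(_ e e0) /nbhs_ballP [d d0 H] := diff_locally df.
exists d => // h hd; have := H h.
rewrite -ball_normE /= sub0r normrN => /(_ hd).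
by rewrite !fctE opprD addrA [h + x]addrC.
Qed.

(** The bound on L stands for its continuity, so that a derivative can be
    recognized from inequalities alone. *)
Lemma is_diff_estimate f x (L : V -> W) (C : R) :
  linear L -> (forall h, `|L h| <= C * `|h|) ->
  (forall e : R, 0 < e -> exists2 d : R, 0 < d & forall h, `|h| < d ->
    `|f (x + h) - f x - L h| <= e * `|h|) ->
  is_diff x f L.
Proof.
move=> linL bL H.
pose LM := GRing.isLinear.Build _ _ _ _ _ linL.
pose LL : {linear V -> W} := HB.pack L LM.
have cL : continuous LL.
  apply: bounded_linear_continuous.
  rewrite /bounded_near; near=> M; rewrite /=; apply/nbhs_ballP; exists 1 => //= y.
  rewrite -ball_normE /= sub0r normrN => y1.
  apply: (le_trans (bL y)).
  apply: (@le_trans _ _ `|C|); first by rewrite (le_trans (ler_norm _))// normrM normr_id ler_piMr// ltW.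
  by near: M; exact: nbhs_pinfty_ge.
have E : f \o shift x = cst (f x) + LL +o_ 0 id.
  apply/eqaddoP => e e0; have [d d0 hd] := H e e0.
  apply/nbhs_ballP; exists d => // h; rewrite -ball_normE /= sub0r normrN => hhd.
  by have := hd h hhd; rewrite !fctE opprD addrA [x + h]addrC.
apply: DiffDef.
  apply/diff_locallyP; rewrite (diff_unique cL E) -/(LL : V -> W).
  by split.
exact: (diff_unique cL E).
Unshelve. all: by end_near. Qed.

End DiffEstimates.

Section DiffBasics.
Context {R : realType}.
Implicit Types (V W : normedModType R).

Lemma is_diffE V W (f df : V -> W) x : is_diff x f df -> 'd f x = df :> (V -> W).
Proof. by move=> ?; exact: diff_val. Qed.

Lemma is_diffE1 V W (f df : V -> W) x : is_diff x f df -> forall h, 'd f x h = df h.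
Proof. by move=> /is_diffE ->. Qed.

Lemma is_diff_differentiable V W (f df : V -> W) x : is_diff x f df -> differentiable f x.
Proof. by []. Qed.

(** Differentiability depends only on the germ; the identities differentiated
    below hold on an open set only. *)
Lemma near_eq_is_diff V W (f g df : V -> W) x :
  (\near x, f x = g x) -> is_diff x f df -> is_diff x g df.
Proof.
move=> fg fdf; have dfx : differentiable f x by [].
have [C C0 HC] := linear_lipschitz (diff_continuous dfx).
rewrite -(is_diffE fdf).
have fgx := nbhs_singleton fg.
have /nbhs_ballP [r /= r0 Hr] := fg.
apply: (is_diff_estimate (C := C)) => [a u v||e e0]; first exact: linearP.
  exact: HC.
have [d d0 Hd] := diff_estimate dfx e0.
exists (Num.min d r) => [|h]; first by rewrite lt_min d0.
rewrite lt_min => /andP[hd hr].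
rewrite -fgx -(Hr (x + h)); first exact: Hd.
by rewrite -ball_normE /ball_ /= opprD addNKr normrN.
Qed.

Lemma is_diff_add V W (f df g dg : V -> W) x :
  is_diff x f df -> is_diff x g dg ->
  is_diff x (fun y => f y + g y) (fun h => df h + dg h).
Proof. by move=> ? ?; exact: is_diffD. Qed.

Lemma scale_bilinear V :
  bilinear_for (GRing.Scale.Law.clone _ _ *:%R _) (GRing.Scale.Law.clone _ _ *:%R _)
    (fun (a : R^o) (v : V) => a *: v).
Proof.
split=> [u'|u] a x y /=; first by rewrite scalerDl scalerA.
by rewrite scalerDr !scalerA mulrC.
Qed.

Lemma is_diff_scale V W (f df : V -> R^o) (g dg : V -> W) x :
  is_diff x f df -> is_diff x g dg ->
  is_diff x (fun y => f y *: g y) (fun h => f x *: dg h + df h *: g x).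
Proof.
move=> fdf gdg.
pose BM := bilinear_isBilinear.Build R R^o W W _ _ _ (@scale_bilinear W).
pose BB : {bilinear R^o -> W -> W} := HB.pack (fun (a : R^o) (v : W) => a *: v) BM.
have cB : continuous (fun p : R^o * W => BB p.1 p.2) by move=> p; exact: scale_continuous.
have Bd p : is_diff p (fun q : R^o * W => q.1 *: q.2) (fun q => p.1 *: q.2 + q.1 *: p.2).
  by apply: DiffDef; [exact: (differentiable_bilin (f := BB))|exact: (diff_bilin (f := BB) p cB)].
exact: (@is_diff_comp _ _ _ _ _ _ _ _ x (is_diff_pair fdf gdg) (Bd _)).
Qed.

Lemma open_fst V W (A : set V) : open A -> open [set p : V * W | A p.1].
Proof. by move=> oA; apply: (@open_comp _ _ fst) => // p _; exact: cvg_fst. Qed.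

Lemma is_diff_lin V W (f : {linear V -> W}) x :
  continuous f -> is_diff x f f.
Proof.
by move=> cf; apply: DiffDef; [exact: linear_differentiable|exact: diff_lin].
Qed.

Lemma fst_linear V W : linear (@fst V W).
Proof. by []. Qed.
HB.instance Definition _ V W := GRing.isLinear.Build R (V * W)%type V _ (@fst V W) (@fst_linear V W).
Lemma snd_linear V W : linear (@snd V W).
Proof. by []. Qed.
HB.instance Definition _ V W := GRing.isLinear.Build R (V * W)%type W _ (@snd V W) (@snd_linear V W).

Lemma fst_continuous V W : continuous (@fst V W).
Proof. by move=> p; exact: cvg_fst. Qed.
Lemma snd_continuous V W : continuous (@snd V W).
Proof. by move=> p; exact: cvg_snd. Qed.

End DiffBasics.

Section Ck.
Context {R : realType}.

(** C^k maps by iteration of the tangent functor: the derivative enters as the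
    map (x, h) |-> df_x(h) between products of the given spaces. All orders are
    thus statements about maps between normed spaces, with no space of
    operators, and the chain rule is functoriality. *)
Fixpoint Ck (k : nat) (V W : normedModType R) (A : set V) (f : V -> W) : Prop :=
  match k with
  | 0 => forall x, A x -> {for x, continuous f}
  | k.+1 => (forall x, A x -> differentiable f x) /\
      @Ck k (V * V)%type W [set p | A p.1] (fun p => 'd f (p.1) (p.2))
  end.

Definition Cinf (V W : normedModType R) (A : set V) (f : V -> W) :=
  forall k, Ck k A f.

Implicit Types (V W Z : normedModType R).

Lemma Ck_ext k V W (A : set V) (f g : V -> W) : open A ->
  (forall x, A x -> f x = g x) -> Ck k A f -> Ck k A g.
Proof.
elim: k V W A f g => [|k IH] V W A f g oA fg.
  move=> Cf x Ax; have nfg : \near x, f x = g x.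
    by move: (open_nbhs_nbhs (conj oA Ax)); apply: filterS.
  move: (Cf x Ax) => Cfx; rewrite /prop_for /continuous_at in Cfx *.
  rewrite -(fg _ Ax).
  by apply: cvg_trans Cfx; apply: near_eq_cvg.
move=> [Df Cf].
have dg x : A x -> is_diff x g ('d f x).
  move=> Ax; apply: near_eq_is_diff (differentiableP (Df x Ax)).
  by move: (open_nbhs_nbhs (conj oA Ax)); apply: filterS.
split=> [x /dg/is_diff_differentiable//|].
apply: IH Cf; first exact: open_fst.
by move=> [x h] Ax; exact: esym (is_diffE1 (dg x Ax) h).
Qed.

Lemma Ck_sub k V W (A B : set V) (f : V -> W) : A `<=` B -> Ck k B f -> Ck k A f.
Proof.
elim: k V W A B f => [|k IH] V W A B f AB /=; first by move=> Cf x /AB/Cf.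
move=> [Df Cf]; split=> [x /AB/Df//|]; apply: IH Cf => p; exact: AB.
Qed.

Lemma Ck_diff k V W (A : set V) (f : V -> W) x : Ck k.+1 A f -> A x -> differentiable f x.
Proof. by move=> [+ _]; apply. Qed.

Lemma CkS k V W (A : set V) (f : V -> W) : Ck k.+1 A f -> Ck k A f.
Proof.
elim: k V W A f => [|k IH] V W A f [Df Cf].
  by move=> x /Df/differentiable_continuous.
by split => //; exact: IH.
Qed.

(** A linear map is its own derivative at every point, so its tangent map is
    again linear. *)
Lemma Ck_lin k V W (A : set V) (f : {linear V -> W}) : continuous f -> Ck k A f.
Proof.
elim: k V W A f => [|k IH] V W A f cf; first by move=> x _; exact: cf.
split=> [x _|]; first exact: linear_differentiable.
rewrite (_ : (fun p => _) = f \o @snd V V).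
  by apply: IH => p; apply: continuous_comp; [exact: snd_continuous|exact: cf].
by apply/funext => p /=; rewrite diff_lin.
Qed.

Lemma Ck_pair k V W Z (A : set V) (f : V -> W) (g : V -> Z) : open A ->
  Ck k A f -> Ck k A g -> Ck k A (fun x => (f x, g x)).
Proof.
elim: k V W Z A f g => [|k IH] V W Z A f g oA.
  by move=> Cf Cg x Ax; apply: cvg_pair; [exact: Cf|exact: Cg].
move=> [Df Cf] [Dg Cg]; split=> [x Ax|].
  by apply: differentiable_pair; [exact: Df|exact: Dg].
have oA' := @open_fst R V V _ oA.
apply: (Ck_ext oA' _ (IH _ _ _ _ _ _ oA' Cf Cg)) => p /= Ap.
by rewrite diff_pair //; [exact: Df|exact: Dg].
Qed.

(** The tangent map of the composite is the composite of the tangent maps,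
    which reduces each order to the previous one. *)
Lemma Ck_comp k V W Z (A : set V) (B : set W) (f : V -> W) (g : W -> Z) :
  open A -> open B -> (forall x, A x -> B (f x)) ->
  Ck k A f -> Ck k B g -> Ck k A (g \o f).
Proof.
elim: k V W Z A B f g => [|k IH] V W Z A B f g oA oB AB.
  move=> Cf Cg x Ax; apply: continuous_comp; first exact: Cf.
  exact/Cg/AB.
move=> Cf Cg; have [Df Cf'] := Cf; have [Dg Cg'] := Cg; split=> [x Ax|].
  by apply: differentiable_comp; [exact: Df|exact/Dg/AB].
have oA' := @open_fst R V V _ oA; have oB' := @open_fst R W W _ oB.
pose Tf (p : V * V) : W * W := (f p.1, 'd f (p.1) p.2).
have CTf : Ck k [set p | A p.1] Tf.
  apply: Ck_pair => //; apply: (IH _ _ _ _ A fst f) => //; last exact: CkS.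
  by apply: Ck_lin; exact: fst_continuous.
apply: (Ck_ext oA' _ (IH _ _ _ _ _ Tf _ oA' oB' _ CTf Cg')) => [p Ap /=|p Ap] /=; last exact: AB.
by rewrite (diff_comp (Df _ Ap) (Dg _ (AB _ Ap))).
Qed.

Lemma Ck_fst k V V' W (A : set V) (f : V -> W) : open A ->
  Ck k A f -> Ck k [set p : V * V' | A p.1] (fun p => f p.1).
Proof.
move=> oA Cf; apply: (@Ck_comp _ _ _ _ _ A fst f) => //; first exact: open_fst.
by apply: Ck_lin; exact: fst_continuous.
Qed.

Lemma CkD k V W (A : set V) (f g : V -> W) : open A ->
  Ck k A f -> Ck k A g -> Ck k A (fun x => f x + g x).
Proof.
elim: k V W A f g => [|k IH] V W A f g oA.
  by move=> Cf Cg x Ax; apply: cvgD; [exact: Cf|exact: Cg].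
move=> [Df Cf] [Dg Cg]; split=> [x Ax|].
  exact: is_diff_differentiable (is_diff_add (differentiableP (Df _ Ax)) (differentiableP (Dg _ Ax))).
have oA' := @open_fst R V V _ oA.
apply: (Ck_ext oA' _ (IH _ _ _ _ _ oA' Cf Cg)) => p /= Ap.
exact: esym (is_diffE1 (is_diff_add (differentiableP (Df _ Ap)) (differentiableP (Dg _ Ap))) _).
Qed.

Lemma Ck_cst k V W (A : set V) (w : W) : open A -> Ck k A (fun _ => w).
Proof.
elim: k V W A w => [|k IH] V W A w oA; first by move=> x _; exact: cvg_cst.
split=> [x Ax|]; first exact: differentiable_cst.
have oA' := @open_fst R V V _ oA.
apply: (Ck_ext oA' _ (IH _ _ _ 0 oA')) => p /= Ap.
by rewrite diff_cst.
Qed.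

Lemma CkZ k V W (A : set V) (f : V -> R^o) (g : V -> W) : open A ->
  Ck k A f -> Ck k A g -> Ck k A (fun x => f x *: g x).
Proof.
elim: k V W A f g => [|k IH] V W A f g oA.
  by move=> Cf Cg x Ax; apply: cvgZ; [exact: Cf|exact: Cg].
move=> Cf Cg; have [Df Cf'] := Cf; have [Dg Cg'] := Cg.
have fg x : A x -> is_diff x (fun y => f y *: g y) (fun h => f x *: 'd g x h + 'd f x h *: g x).
  by move=> Ax; apply: is_diff_scale; apply: differentiableP; [exact: Df|exact: Dg].
split=> [x /fg/is_diff_differentiable//|].
have oA' := @open_fst R V V _ oA.
have C1 := Ck_fst V oA (CkS Cf); have C2 := Ck_fst V oA (CkS Cg).
apply: (Ck_ext oA' _ (CkD oA' (IH _ _ _ _ _ oA' C1 Cg') (IH _ _ _ _ _ oA' Cf' C2))).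
by move=> p Ap; exact: esym (is_diffE1 (fg _ Ap) _).
Qed.

Lemma Ck_inv k V (A : set V) (f : V -> R^o) : open A -> (forall x, A x -> f x != 0) ->
  Ck k A f -> Ck k A (fun x => (f x)^-1 : R^o).
Proof.
elim: k V A f => [|k IH] V A f oA f0.
  by move=> Cf x Ax; apply: cvgV; [exact: f0|exact: Cf].
move=> Cf; have [Df Cf'] := Cf; split=> [x Ax|].
  by apply: differentiableV; [exact: Df|exact: f0].
have oA' := @open_fst R V V _ oA.
have C1 : Ck k [set p : V * V | A p.1] (fun p => (f p.1)^-1 : R^o).
  by apply: IH => // [p|]; [exact: f0|exact: Ck_fst (CkS Cf)].
have C2 := CkZ oA' (CkZ oA' C1 C1) Cf'.
have C3 := CkZ oA' (@Ck_cst k _ R^o _ (-1) oA') C2.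
apply: (Ck_ext oA' _ C3) => p /= Ap.
have E := congr1 (fun h => h p.2) (diffV (Df _ Ap) (f0 _ Ap)).
apply: etrans (esym E); rewrite /GRing.scale /=.
rewrite mulN1r /= expr2 invfM.
exact: esym (mulNr _ _).
Qed.

End Ck.

Section CkMatrix.
Context {R : realType}.
Implicit Types (V W : normedModType R).

Lemma Ck_sum k V W (A : set V) (I : Type) (r : seq I) (P : pred I) (f : I -> V -> W) : open A ->
  (forall i, P i -> Ck k A (f i)) -> Ck k A (fun x => \sum_(i <- r | P i) f i x).
Proof.
move=> oA Cf; elim: r => [|i r IH].
  apply: (Ck_ext oA _ (Ck_cst k (0 : W) oA)) => x _.
  by rewrite big_nil.
case: (boolP (P i)) => Pi.
  apply: (Ck_ext oA _ (CkD oA (Cf i Pi) IH)) => x _.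
  by rewrite big_cons Pi.
by apply: (Ck_ext oA _ IH) => x _; rewrite big_cons (negbTE Pi).
Qed.

(** A named function, to carry the structure of a linear map. *)
Definition mxcoord m n (i : 'I_m) (j : 'I_n) (M : 'M[R]_(m, n)) : R^o := M i j.

Lemma mxcoord_linear m n (i : 'I_m) (j : 'I_n) : linear (mxcoord i j).
Proof. by move=> a M N; rewrite /mxcoord !mxE. Qed.
HB.instance Definition _ m n (i : 'I_m) (j : 'I_n) :=
  GRing.isLinear.Build R 'M[R]_(m, n) R^o _ (mxcoord i j) (mxcoord_linear i j).

Lemma mxcoord_continuous m n (i : 'I_m) (j : 'I_n) : continuous (mxcoord i j).
Proof. exact: coord_continuous. Qed.

Lemma Ck_coord k V m n (A : set V) (f : V -> 'M[R]_(m, n)) i j : open A ->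
  Ck k A f -> Ck k A (fun x => f x i j : R^o).
Proof.
move=> oA Cf; apply: (@Ck_comp _ k _ _ _ A setT f (mxcoord i j)) => //; first exact: openT.
by apply: Ck_lin; exact: mxcoord_continuous.
Qed.

Lemma Ck_mx k V m n (A : set V) (f : V -> 'M[R]_(m, n)) : open A ->
  (forall i j, Ck k A (fun x => f x i j : R^o)) -> Ck k A f.
Proof.
move=> oA Cf.
have : Ck k A (fun x => \sum_i \sum_j (f x i j : R^o) *: (delta_mx i j : 'M[R]_(m, n))).
  do 2 (apply: Ck_sum => // ? _).
  by apply: CkZ => //; exact: Ck_cst.
by apply: Ck_ext => // x _; rewrite -matrix_sum_delta.
Qed.

Lemma Ck_trmx k V p q (A : set V) (M : V -> 'M[R]_(p, q)) : open A ->
  Ck k A M -> Ck k A (fun x => (M x)^T).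
Proof.
move=> oA CM; apply: Ck_mx => // i j.
by apply: (Ck_ext oA _ (Ck_coord j i oA CM)) => m _; rewrite [RHS]mxE.
Qed.

Lemma CinfP V W (A : set V) (f : V -> W) : Cinf A f <->
  (forall x, A x -> differentiable f x) /\
  Cinf [set p : V * V | A p.1] (fun p => 'd f (p.1) p.2).
Proof.
split=> [Cf|[Df Cf]]; last by case=> [|k]; [move=> x /Df/differentiable_continuous|].
by split=> [x Ax|k]; [exact: Ck_diff (Cf 1) Ax|case: (Cf k.+1)].
Qed.

Lemma Cinf_diff V W (A : set V) (f : V -> W) x : Cinf A f -> A x -> differentiable f x.
Proof. by move=> /CinfP[+ _]; apply. Qed.

Lemma Cinf_dir V W (A : set V) (f : V -> W) (v : V) : open A -> Cinf A f ->
  Cinf A (fun x => 'd f x v).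
Proof.
move=> oA /CinfP[Df Cf] k.
apply: (@Ck_comp _ k _ _ _ A [set p : V * V | A p.1] (fun x => (x, v)) (fun p => 'd f (p.1) p.2)) => //.
  exact: open_fst.
by apply: Ck_pair => //; [apply: (@Ck_lin _ k _ _ A idfun) => x; exact: cvg_id|exact: Ck_cst].
Qed.

Lemma diff_coord_sum W n (f : 'rV[R]_n -> W) x v :
  'd f x v = \sum_i v 0 i *: 'd f x (delta_mx 0 i).
Proof.
rewrite [v in LHS]row_sum_delta linear_sum; apply: eq_bigr => i _.
by rewrite linearZ.
Qed.

Lemma partials_cat W (s t : seq 'I_5) (f : jet R -> W) :
  partials (s ++ t) f = partials s (partials t f).
Proof. by rewrite /partials foldr_cat. Qed.

(** The tangent map of f at (x, v) is the sum of the v_i D_i f(x), and the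
    partial derivatives D_i f satisfy the same hypothesis as f. *)
Lemma smooth_Cinf W (A : set (jet R)) (f : jet R -> W) : open A ->
  smooth A f -> Cinf A f.
Proof.
move=> oA sf k; elim: k f sf => [|k IH] f sf.
  by move=> x Ax; exact: differentiable_continuous (sf [::] x Ax).
have Df x : A x -> differentiable f x by move=> Ax; exact: (sf [::] x Ax).
split => //.
have oA' := @open_fst R _ (jet R) _ oA.
have : Ck k [set p : jet R * jet R | A p.1] (fun p => \sum_i (p.2 0 i : R^o) *: 'D_(unitv R i) f p.1).
  apply: Ck_sum => // i _; apply: CkZ => //.
    apply: (@Ck_coord k (jet R * jet R)%type 1 5 _ snd 0 i) => //.
    by apply: Ck_lin; exact: snd_continuous.
  apply: (@Ck_fst _ k (jet R) (jet R) W A ('D_(unitv R i) f) oA); apply: IH => s x Ax.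
  by have := sf (rcons s i) x Ax; rewrite -cats1 partials_cat.
apply: Ck_ext => // -[x v] /= Ax.
rewrite (diff_coord_sum f x v); apply: eq_bigr => i _.
by rewrite deriveE //; exact: Df.
Qed.

Lemma Cinf_ext V W (A : set V) (f g : V -> W) : open A ->
  (forall x, A x -> f x = g x) -> Cinf A f -> Cinf A g.
Proof. by move=> oA fg Cf k; exact: (Ck_ext oA fg (Cf k)). Qed.

Lemma Cinf_smooth W (A : set (jet R)) (f : jet R -> W) : open A ->
  Cinf A f -> smooth A f.
Proof.
move=> oA Cf s m Am; suff /Cinf_diff : Cinf A (partials s f) by apply.
elim: s {m Am} => [//|i s IH] /=.
apply: Cinf_ext (Cinf_dir (unitv R i) oA IH) => // x Ax.
by rewrite deriveE //; exact: Cinf_diff IH Ax.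
Qed.

End CkMatrix.

(** * The mean value inequality and uniform differentiability *)

Section MeanValue.
Context {R : realType} {V W : normedModType R}.
Implicit Types (f : V -> W).

(** Let s be the supremum of the t in [0, 1] for which
    |f(x + t h) - f(x)| <= (M + e) t. Differentiability at s shows both that s
    satisfies the inequality and that it cannot be smaller than 1. The argument
    takes place in any normed target, where the scalar theorem would need
    linear forms. *)
Lemma mean_value_inequality f x h (M : R) :
  (forall t : R, 0 <= t <= 1 -> differentiable f (x + t *: h)) ->
  (forall t : R, 0 <= t <= 1 -> `|'d f (x + t *: h) h| <= M) ->
  `|f (x + h) - f x| <= M.
Proof.
move=> Df bf; apply/ler_addgt0Pr => e e0.
(* Differentiability at s, with constant M + e on both sides of s. *)
have step s : 0 <= s <= 1 -> exists2 d : R, 0 < d & forall t, `|t - s| < d ->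
    `|f (x + t *: h) - f (x + s *: h)| <= (M + e) * `|t - s|.
  move=> s01; have h1 : 0 < `|h| + 1 by rewrite ltr_wpDl.
  have [d d0 Hd] := diff_estimate (Df s s01) (divr_gt0 e0 h1).
  exists (d / (`|h| + 1)) => [|t td]; first exact: divr_gt0.
  have := Hd ((t - s) *: h); rewrite normrZ => H.
  have hl : `|h| <= `|h| + 1 by rewrite lerDl.
  have /H : `|t - s| * `|h| < d.
    apply: le_lt_trans (_ : `|t - s| * (`|h| + 1) < d); first by rewrite ler_wpM2l.
    by rewrite -ltr_pdivlMr.
  have -> : x + s *: h + (t - s) *: h = x + t *: h.
    by rewrite -addrA -scalerDl (addrC s) subrK.
  rewrite linearZ /= => Hle.
  rewrite mulrDl; apply: le_trans (_ : `|t - s| * `|'d f (x + s *: h) h| + e * `|t - s| <= _).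
    rewrite -normrZ.
    rewrite -[f _ - _ in leLHS](subrK ((t - s) *: 'd f (x + s *: h) h)) addrC.
    apply: le_trans (ler_normD _ _) _; rewrite lerD2l.
    apply: le_trans Hle _.
    rewrite mulrCA [leRHS]mulrC ler_wpM2l // -mulrA ger_pMr //.
    by rewrite mulrC ler_pdivrMr // mul1r.
  by rewrite lerD2r mulrC ler_wpM2r // bf.
pose S := [set t : R | 0 <= t <= 1 /\ `|f (x + t *: h) - f x| <= (M + e) * t].
have S0 : S 0 by split; rewrite ?lexx ?ler01 // scale0r addr0 subrr normr0 mulr0.
have ubS : ubound S 1 by move=> t [/andP[]].
have hS : has_sup S by split; [exists 0|exists 1].
pose s := sup S.
have s01 : 0 <= s <= 1.
  by rewrite (ub_le_sup _ S0) ?(ge_sup _ ubS) //; [exists 0|exists 1].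
have [d d0 Hd] := step s s01.
have [t [t01 St] ts] := sup_adherent d0 hS.
have tles : t <= s by apply: ub_le_sup => //; exists 1.
have Ps : `|f (x + s *: h) - f x| <= (M + e) * s.
  have := Hd t; rewrite -/s in ts; rewrite distrC ger0_norm ?subr_ge0 // distrC => H.
  have {}H := H ltac:(lra).
  rewrite -(subrKA (f (x + t *: h))).
  apply: le_trans (ler_normD _ _) _.
  apply: le_trans (lerD H St) _.
  by rewrite -mulrDr subrK.
have s1 : s = 1.
  apply/eqP; rewrite eq_le (andP s01).2 /= leNgt; apply/negP => slt1.
  pose r := Num.min (d / 2) (1 - s).
  have r0 : 0 < r by rewrite lt_min divr_gt0 //= subr_gt0.
  have rd : r < d by apply: le_lt_trans (_ : d / 2 < d); [rewrite ge_min lexx|lra].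
  have r1 : r <= 1 - s by rewrite ge_min lexx orbT.
  have : S (s + r).
    split; first by move: s01 => /andP[? ?]; apply/andP; split; lra.
    have := Hd (s + r); rewrite (addrC s) addrK gtr0_norm // => /(_ rd) H.
    rewrite -(subrKA (f (x + s *: h))).
    apply: le_trans (ler_normD _ _) _.
    apply: le_trans (lerD H Ps) _.
    by rewrite -mulrDr.
  by move=> /(ub_le_sup (ex_intro _ _ ubS)); rewrite -/s; lra.
by move: Ps; rewrite s1 scale1r mulr1.
Qed.

End MeanValue.

Section UniformC1.
Context {R : realType}.
Implicit Types (V W : normedModType R).

(** Finite dimension, in a form that passes to products and hence to tangent
    spaces. *)
Definition proper_space V := compact [set h : V | `|h| <= 1].

Definition convex_set V (K : set V) :=
  forall x y (t : R), K x -> K y -> 0 <= t <= 1 -> K (x + t *: (y - x)).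

(** A local bound that survives enlarging the constant is uniform on a compact
    set. A radius is encoded by its inverse, so that small radii are large
    constants. *)
Lemma compact_uniform V (K : set V) (P : R -> V -> Prop) : compact K ->
  (forall x, K x -> exists r M : R, 0 < r /\
     forall y, `|x - y| < r -> forall M', M <= M' -> P M' y) ->
  exists2 M : R, 0 < M & forall x, K x -> P M x.
Proof.
move=> /compact_near_coveringP/(_ R +oo P) cK H.
have [|M [Mr HM]] := cK _.
  move=> x /H [r [M [r0 HM]]]; near=> y N => /=.
  apply: (HM y); first by near: y; apply/nbhs_ballP; exists r => // z; rewrite -ball_normE.
  by near: N; apply: nbhs_pinfty_ge; exact: num_real.
have M1 : M < Num.max M 0 + 1.
  by rewrite (@le_lt_trans _ _ (Num.max M 0)) ?le_max ?lexx // ltrDl.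
exists (Num.max M 0 + 1); first by rewrite ltr_wpDl // le_max lexx orbT.
exact: HM M1.
Unshelve. all: by end_near. Qed.

(** The tangent map is continuous at (x, 0), where it vanishes: this bounds
    df_y(h) for y near x and h small, and homogeneity removes the smallness of
    h. *)
Lemma C1_bounded V W (O K : set V) (f : V -> W) :
  Ck 1 O f -> compact K -> K `<=` O ->
  exists2 L : R, 0 < L & forall x, K x -> forall h, `|'d f x h| <= L * `|h|.
Proof.
move=> [Df Cf] cK KO.
apply: (compact_uniform cK) => x Kx.
have /= /cvgrPdist_lt /(_ 1 ltr01) := Cf (x, 0) (KO x Kx).
rewrite linear0 => /nbhs_ballP [r /= r0 H].
exists r, (2 / r); split=> // y xy M rM h.
have [->|h0] := eqVneq h 0; first by rewrite linear0 !normr0 mulr0.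
have nh : 0 < `|h| by rewrite normr_gt0.
(* The factor brings h to norm r / 2, inside the ball of continuity. *)
pose c := r / 2 / `|h|.
have c0 : 0 < c by rewrite !divr_gt0.
have := H (y, c *: h); rewrite /= linearZ /= sub0r normrN normrZ gtr0_norm // => Hc.
have {Hc} : c * `|'d f y h| < 1.
  apply: Hc; split => /=; rewrite -ball_normE //= sub0r normrN normrZ gtr0_norm // /c divfK ?gt_eqF //.
  by rewrite ltr_pdivrMr // ltr_pMr // ltr1n.
rewrite mulrC -ltr_pdivlMr // div1r /c !invf_div => /ltW /le_trans; apply.
by rewrite mulrC ler_wpM2r // ltW.
Qed.

(** Continuity of the tangent map is pointwise in the direction h; compactness
    of the unit ball makes it uniform in h. *)
Lemma diff_near V W (O : set V) (f : V -> W) (x : V) (e : R) : proper_space V ->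
  Ck 1 O f -> O x -> 0 < e ->
  exists2 r : R, 0 < r & forall y, `|x - y| < r ->
    forall h, `|'d f y h - 'd f x h| <= e * `|h|.
Proof.
move=> pV [Df Cf] Ox e0.
have [|M M0 HM] := @compact_uniform V _ (fun M h => forall y, `|x - y| < M^-1 -> `|'d f y h - 'd f x h| <= e) pV.
  move=> h _; have /= /cvgrPdist_lt /(_ (e / 2) ltac:(by rewrite divr_gt0)) := Cf (x, h) Ox.
  move=> /nbhs_ballP [r /= r0 H].
  have cd : {for h, continuous ('d f x)} by exact: (diff_continuous (Df x Ox)).
  have /cvgrPdist_lt /(_ (e / 2) ltac:(by rewrite divr_gt0)) := cd.
  move=> /nbhs_ballP [s /= s0 H2].
  exists (Num.min r s), r^-1; split; first by rewrite lt_min r0.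
  move=> k; rewrite lt_min => /andP[kr ks] M' rM' y xy.
  have M'0 : 0 < M' by apply: lt_le_trans rM'; rewrite invr_gt0.
  have /H/= H1 : ball (x, h) r (y, k).
    split => /=; rewrite -ball_normE //=.
    by apply: (lt_le_trans xy); rewrite -[leRHS]invrK lef_pV2 // posrE ?invr_gt0.
  have /H2/= {}H2 : ball h s k by rewrite -ball_normE.
  rewrite -(subrKA ('d f x h)) [e]splitr.
  apply: le_trans (ler_normD _ _) _; rewrite lerD // ltW //.
  by rewrite distrC.
exists M^-1; first by rewrite invr_gt0.
move=> y xy h.
have [->|h0] := eqVneq h 0; first by rewrite (linear0 ('d f y)) (linear0 ('d f x)) subrr !normr0 mulr0.
have nh : 0 < `|h| by rewrite normr_gt0.
have := HM (`|h|^-1 *: h) _ y xy.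
rewrite /= normrZ gtr0_norm ?invr_gt0 // mulVf ?gt_eqF // => /(_ (lexx _)).
have E z (a : R) : 'd f z (a *: h) = a *: 'd f z h by rewrite linearZ.
rewrite !E -scalerBr normrZ gtr0_norm ?invr_gt0 //.
by rewrite ler_pdivrMl // mulrC.
Qed.

(** The remainder z |-> f(z) - df_y(z) has derivative df_z - df_y, which is
    uniformly small near y; the mean value inequality bounds its increments. *)
Lemma C1_uniform_diff V W (O K : set V) (f : V -> W) : proper_space V -> open O ->
  Ck 1 O f -> compact K -> K `<=` O -> forall e : R, 0 < e ->
  exists2 d : R, 0 < d & forall x, K x -> forall h, `|h| < d ->
    `|f (x + h) - f x - 'd f x h| <= e * `|h|.
Proof.
move=> pV oO C1 cK KO e e0; have [Df Cf] := C1.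
have [|M M0 HM] := @compact_uniform V K (fun M x => forall h, `|h| < M^-1 ->
    `|f (x + h) - f x - 'd f x h| <= e * `|h|) cK.
  move=> x /KO Kx.
  have e2 : 0 < e / 2 by rewrite divr_gt0.
  have [r r0 Hr] := diff_near pV C1 Kx e2.
  have /nbhs_ballP [s /= s0 Hs] := open_nbhs_nbhs (conj oO Kx).
  have m0 : 0 < Num.min r s by rewrite lt_min r0.
  exists (Num.min r s / 2), (Num.min r s / 2)^-1; split; first by rewrite divr_gt0.
  move=> y xy M HM h hM.
  have yh (t : R) : 0 <= t <= 1 -> `|x - (y + t *: h)| < Num.min r s.
    move=> /andP[t0 t1].
    have hm : `|h| < Num.min r s / 2.
      apply: (lt_le_trans hM); rewrite -[leRHS]invrK lef_pV2 // posrE ?invr_gt0 ?divr_gt0 //.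
      by apply: lt_le_trans HM; rewrite invr_gt0 divr_gt0.
    rewrite opprD addrA (splitr (Num.min r s)).
    apply: le_lt_trans (ler_normB _ _) _; rewrite ltr_leD // normrZ ger0_norm //.
    by apply: le_trans (ltW hm); rewrite ler_piMl.
  have yO z : `|x - z| < Num.min r s -> O z.
    by rewrite lt_min => /andP[_ zs]; apply: Hs; rewrite -ball_normE.
  pose g z := f z - 'd f y z.
  have Oy : O y by apply: yO; rewrite -[y]addr0 -[0](scale0r h); apply: yh; rewrite lexx ler01.
  have gd z : O z -> is_diff z g (fun k => 'd f z k - 'd f y k).
    move=> Oz; have dz := differentiableP (Df z Oz).
    have dy : is_diff z ('d f y) ('d f y) by apply: is_diff_lin; exact: (diff_continuous (Df y Oy)).
    exact: is_diffB.
  have -> : f (y + h) - f y - 'd f y h = g (y + h) - g y.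
    rewrite /g linearD opprB opprD !addrA.
    by rewrite (addrAC _ (- 'd f y h)) subrK addrAC.
  apply: mean_value_inequality => t t01; first exact: is_diff_differentiable (gd _ (yO _ (yh t t01))).
  rewrite (is_diffE1 (gd _ (yO _ (yh t t01)))).
  rewrite -(subrKA ('d f x h)) [e]splitr mulrDl.
  apply: le_trans (ler_normD _ _) _; rewrite lerD //.
    by apply: Hr; apply: lt_le_trans (yh t t01) _; rewrite ge_min lexx.
  rewrite distrC; apply: Hr.
  have mr : Num.min r s <= r by rewrite ge_min lexx.
  by apply: (lt_le_trans xy); lra.
by exists M^-1 => //; rewrite invr_gt0.
Qed.
End UniformC1.

(** * Symmetry of second derivatives *)

Section Schwarz.
Context {R : realType} {V W : normedModType R}.

Lemma is_diff_affine (p w : V) (t : R^o) : is_diff t (fun r : R^o => p + r *: w) (fun r : R^o => r *: w).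
Proof.
have H := is_diff_add (is_diff_cst p t) (is_diff_scalel t w).
by have -> : (fun r : R^o => r *: w) = (fun h : R^o => (0 : V) + h *: w) by apply/funext => h; rewrite add0r.
Qed.

Lemma is_diff_line (f : V -> W) (p w : V) (t : R^o) : differentiable f (p + t *: w) ->
  is_diff t (fun r : R^o => f (p + r *: w)) (fun r : R^o => r *: 'd f (p + t *: w) w).
Proof.
move=> /differentiableP df.
have H := @is_diff_comp _ _ _ _ _ _ _ _ t (is_diff_affine p w t) df.
have -> : (fun r : R^o => r *: 'd f (p + t *: w) w) = 'd f (p + t *: w) \o (fun r : R^o => r *: w).
  by apply/funext => r /=; rewrite linearZ.
exact: H.
Qed.

Definition second_difference (f : V -> W) (x u v : V) (s : R) :=
  f (x + s *: u + s *: v) - f (x + s *: u) - f (x + s *: v) + f x.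

(** Along the segment from x to x + s u, the difference of f on two parallel
    lines at distance s v has derivative s (a(. + s v) - a(.)), where a is the
    derivative of f in the direction u. The expansion of a at x makes this
    s^2 da_x(v) up to o(s^2). *)
Lemma second_difference_estimate (A : set V) (f : V -> W) (x u v : V) (e : R) : open A ->
  (forall y, A y -> differentiable f y) -> A x ->
  differentiable (fun y => 'd f y u) x -> 0 < e ->
  exists2 d : R, 0 < d & forall s, 0 < s < d ->
    `|second_difference f x u v s - s ^+ 2 *: 'd (fun y => 'd f y u) x v| <= e * s ^+ 2.
Proof.
move=> oA Df Ax Da e0; set a := fun y => 'd f y u.
have /nbhs_ballP [r /= r0 Hr] := open_nbhs_nbhs (conj oA Ax).
set m := `|u| + `|v|.
have m0 : 0 <= m by rewrite addr_ge0.
have e'0 : 0 < e / (2 * (m + 1)) by rewrite divr_gt0 // mulr_gt0 // ltr_wpDl.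
have [d d0 Hd] := diff_estimate Da e'0.
have D0 : 0 < Num.min r d / (m + 1) by rewrite divr_gt0 ?lt_min ?r0 // ltr_wpDl.
exists (Num.min r d / (m + 1)) => // s /andP[s0].
rewrite ltr_pdivlMr ?ltr_wpDl // => sm.
(* The parallelogram with sides s u and s v stays in the ball of radius s m. *)
have small (t c : R) : 0 <= t <= 1 -> 0 <= c <= 1 -> `|(t * s) *: u + (c * s) *: v| <= s * m.
  move=> /andP[t0 t1] /andP[c0 c1]; rewrite mulrDr.
  apply: le_trans (ler_normD _ _) _; rewrite !normrZ !ger0_norm ?mulr_ge0 ?(ltW s0) //.
  by rewrite lerD // ler_wpM2r // ler_piMl // ltW.
have smm : s * m < Num.min r d.
  by apply: le_lt_trans sm; rewrite ler_wpM2l ?lerDl // ltW.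
have inA t c : 0 <= t <= 1 -> 0 <= c <= 1 -> A (x + ((t * s) *: u + (c * s) *: v)).
  move=> t01 c01; apply: Hr; rewrite -ball_normE /ball_ /= opprD addNKr normrN.
  apply: le_lt_trans (small _ _ t01 c01) _.
  by apply: lt_le_trans smm _; rewrite ge_min lexx.
have est t c : 0 <= t <= 1 -> 0 <= c <= 1 ->
   `|a (x + ((t * s) *: u + (c * s) *: v)) - a x - 'd a x ((t * s) *: u + (c * s) *: v)| <= e / 2 * s.
  move=> t01 c01; apply: le_trans (Hd _ _) _.
    apply: le_lt_trans (small _ _ t01 c01) _.
    by apply: lt_le_trans smm _; rewrite ge_min lexx orbT.
  apply: le_trans (ler_wpM2l (ltW e'0) (small _ _ t01 c01)) _.
  have m1 : m + 1 != 0 by rewrite gt_eqF // ltr_wpDl.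
  have -> : e / (2 * (m + 1)) * (s * m) = (e / 2 * s) * (m / (m + 1)) by move: m1; clearbody m => m1; field.
  rewrite ler_piMr ?mulr_ge0 ?divr_ge0 ?(ltW e0) ?(ltW s0) //.
  by rewrite ler_pdivrMr ?ltr_wpDl // mul1r lerDl.
(* The increment of g over [0, 1] is the quantity to estimate. *)
pose g (t : R^o) : W := f (x + s *: v + t *: (s *: u)) - f (x + t *: (s *: u)) - t *: (s ^+ 2 *: 'd a x v).
have eq1 (t : R^o) : x + s *: v + t *: (s *: u) = x + ((t * s) *: u + (1 * s) *: v).
  by rewrite scalerA mul1r -addrA [s *: v + _]addrC.
have eq2 (t : R^o) : x + t *: (s *: u) = x + ((t * s) *: u + (0 * s) *: v).
  by rewrite scalerA mul0r scale0r addr0.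
have c1 : 0 <= (1 : R) <= 1 by rewrite ler01 lexx.
have c0 : 0 <= (0 : R) <= 1 by rewrite ler01 lexx.
have gd (t : R^o) : 0 <= t <= 1 -> is_diff t g (fun k : R^o => k *: 'd f (x + s *: v + t *: (s *: u)) (s *: u) -
     k *: 'd f (x + t *: (s *: u)) (s *: u) - k *: (s ^+ 2 *: 'd a x v)).
  move=> t01.
  have H1 : is_diff t (fun t : R^o => f (x + s *: v + t *: (s *: u))) (fun k : R^o => k *: 'd f (x + s *: v + t *: (s *: u)) (s *: u)).
    by apply: is_diff_line; apply: Df; rewrite eq1; exact: inA.
  have H2 : is_diff t (fun t : R^o => f (x + t *: (s *: u))) (fun k : R^o => k *: 'd f (x + t *: (s *: u)) (s *: u)).
    by apply: is_diff_line; apply: Df; rewrite eq2; exact: inA.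
  have H3 := is_diff_scalel t (s ^+ 2 *: 'd a x v : W).
  exact: is_diffB (is_diffB H1 H2) H3.
have -> : second_difference f x u v s - s ^+ 2 *: 'd a x v = g (0 + 1) - g 0.
  rewrite /second_difference /g add0r !scale1r !scale0r !addr0 subr0 opprB.
  rewrite [x + s *: v + s *: u]addrAC !addrA.
  by rewrite [LHS]addrAC (addrAC _ (- f (x + s *: v))) [LHS]addrAC.
have t1 (t : R^o) : 0 + t *: (1 : R^o) = t by rewrite add0r; exact: mulr1.
apply: (@mean_value_inequality R _ W g 0 1) => t t01; rewrite t1; first exact: is_diff_differentiable (gd _ t01).
rewrite (is_diffE1 (gd _ t01)) !scale1r.
have E1 := est t 1 t01 c1; have E2 := est t 0 t01 c0.
rewrite -eq1 -eq2 in E1 E2.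
set a1 := a _ in E1; set a2 := a _ in E2.
have L z : 'd f z (s *: u) = s *: a z by rewrite /a linearZ.
rewrite !L -/a1 -/a2.
set D1 := 'd a x _ in E1; set D2 := 'd a x _ in E2.
have D12 : D1 - D2 = s *: 'd a x v.
  rewrite /D1 /D2 -linearB mul1r mul0r scale0r addr0 addrC addKr linearZ //.
have -> : s *: a1 - s *: a2 - s ^+ 2 *: 'd a x v = s *: ((a1 - a x - D1) - (a2 - a x - D2)).
  rewrite expr2 -scalerA -D12 -!scalerBr; congr (_ *: _).
  rewrite !opprB [X in _ = _ + X]addrC [RHS]addrACA; congr (_ + _); last by rewrite addrC.
  by rewrite addrA subrK.
rewrite normrZ gtr0_norm // expr2 mulrCA ler_wpM2l ?(ltW s0) //.
apply: le_trans (ler_normB _ _) _.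
by rewrite (splitr e) mulrDl lerD.
Qed.

(** Both mixed derivatives are the limit of the second difference divided by
    s^2, and the second difference is symmetric in u and v. *)
Lemma symmetric_derivatives (A : set V) (f : V -> W) (x u v : V) : open A ->
  (forall y, A y -> differentiable f y) -> A x ->
  differentiable (fun y => 'd f y u) x -> differentiable (fun y => 'd f y v) x ->
  'd (fun y => 'd f y u) x v = 'd (fun y => 'd f y v) x u.
Proof.
move=> oA Df Ax Du Dv; apply/eqP; rewrite -subr_eq0 -normr_le0.
apply/ler_addgt0Pr => e e0; rewrite add0r.
have e2 : 0 < e / 2 by rewrite divr_gt0.
have [d1 d10 H1] := second_difference_estimate v oA Df Ax Du e2.
have [d2 d20 H2] := second_difference_estimate u oA Df Ax Dv e2.
pose s := Num.min d1 d2 / 2.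
have m0 : 0 < Num.min d1 d2 by rewrite lt_min d10.
have s0 : 0 < s by rewrite divr_gt0.
have sm : s < Num.min d1 d2 by rewrite /s; lra.
have := H1 s; rewrite s0 (lt_le_trans sm) ?ge_min ?lexx // => /(_ isT) E1.
have := H2 s; rewrite s0 (lt_le_trans sm) ?ge_min ?lexx ?orbT // => /(_ isT) E2.
have sym : second_difference f x v u s = second_difference f x u v s.
  by rewrite /second_difference (addrAC x) (addrAC (f (x + s *: u + s *: v))).
rewrite sym in E2.
have s2 : 0 < s ^+ 2 by rewrite exprn_gt0.
rewrite -(ler_pM2l s2) -[X in X * _]gtr0_norm // -normrZ scalerBr.
set F := second_difference f x u v s in E1 E2.
rewrite -(subrKA F).
apply: le_trans (ler_normD _ _) _; rewrite distrC mulrC (splitr e) mulrDl.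
exact: lerD.
Qed.

End Schwarz.

(** * Time-one maps by Euler's method *)

Section Euler.
Context {R : realType}.
Implicit Types (V W : normedModType R).

(** The steps are halved each time, so that every polygon is compared with one
    of half the step and the errors are summed as a geometric series. *)
Definition mesh (k : nat) : R := (2 ^+ k)^-1.

Lemma mesh_gt0 k : 0 < mesh k.
Proof. by rewrite invr_gt0 exprn_gt0. Qed.

Lemma meshS k : mesh k = mesh k.+1 + mesh k.+1.
Proof. by rewrite /mesh exprS invfM; set t := (2 ^+ k)^-1; lra. Qed.

Lemma mesh_steps k : (2 ^ k)%:R * mesh k = 1.
Proof. by rewrite natrX divff // gt_eqF // exprn_gt0. Qed.

Lemma mesh_step_le k j : (j <= 2 ^ k)%N -> j%:R * mesh k <= 1.
Proof. by move=> jk; rewrite -[leRHS](mesh_steps k) ler_pM2r ?mesh_gt0 // ler_nat. Qed.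

Lemma mesh_cvg0 : mesh @ \oo --> (0 : R).
Proof.
have -> : mesh = (fun k => (2^-1) ^+ k) by apply/funext => k; rewrite exprVn.
by apply: cvg_expr; rewrite gtr0_norm ?invf_lt1 // ltr1n.
Qed.

(** It rests on (1 + h M)^n <= exp(n h M) and n h <= 1. *)
Lemma discrete_gronwall (a : nat -> R) (k n : nat) (M al ep : R) :
  0 <= M -> 0 <= al -> 0 <= ep -> a 0%N <= al -> (n <= 2 ^ k)%N ->
  (forall j, (j < n)%N -> a j.+1 <= (1 + mesh k * M) * a j + mesh k * ep) ->
  a n <= expR M * (al + ep).
Proof.
move=> M0 al0 ep0 a0 nk H.
have h0 := mesh_gt0 k.
have q1 : 1 <= 1 + mesh k * M by rewrite lerDl mulr_ge0 // ltW.
have q0 : 0 <= 1 + mesh k * M by apply: le_trans q1.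
have E j : (j <= n)%N -> a j <= (1 + mesh k * M) ^+ j * (al + j%:R * mesh k * ep).
  elim: j => [|j IH] jn; first by rewrite expr0 mul1r !mul0r addr0.
  apply: le_trans (H _ jn) _.
  apply: le_trans (lerD (ler_wpM2l q0 (IH (ltnW jn))) (lexx _)) _.
  rewrite mulrA -exprS.
  have -> : al + j.+1%:R * mesh k * ep = (al + j%:R * mesh k * ep) + mesh k * ep by rewrite -natr1; ring.
  rewrite [leRHS]mulrDr lerD2l.
  by rewrite ler_peMl ?mulr_ge0 ?(ltW h0) // exprn_ege1.
apply: le_trans (E n (leqnn n)) _.
apply: ler_pM; rewrite ?exprn_ge0 ?addr_ge0 ?mulr_ge0 ?(ltW h0) //.
  apply: le_trans (lerXn2r n q0 (expR_ge0 (mesh k * M)) (expR_ge1Dx _)) _.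
  by rewrite -expRM_natl ler_expR mulrA ler_piMl // mesh_step_le.
by rewrite lerD2l ler_piMl // mesh_step_le.
Qed.

Definition euler_step V (v : V -> V) (h : R) (x : V) : V := x + h *: v x.

Definition euler V (v : V -> V) k j x := iter j (euler_step v (mesh k)) x.

Definition euler_end V (v : V -> V) (x : V) (k : nat) := euler v k (2 ^ k) x.

(** Time one is enough: the flow at time s of v is the time-one map of s v. *)
Definition flow1 V (v : V -> V) (x : V) : V := lim (euler_end v x @ \oo).

(** An a priori bound: estimates on K apply to all polygons issued from N. *)
Definition confined V (v : V -> V) (N K : set V) :=
  forall k j x, (j <= 2 ^ k)%N -> N x -> K (euler v k j x).

Lemma eulerS V (v : V -> V) k j x : euler v k j.+1 x = euler v k j x + mesh k *: v (euler v k j x).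
Proof. by []. Qed.

(** Two half steps differ from a full one by O(mesh^2), because v is bounded
    and Lipschitz on K; the discrete Gronwall inequality sums these errors. *)
Lemma euler_refine V (v : V -> V) (N K : set V) (L C : R) x k :
  0 <= L -> 0 <= C -> confined v N K ->
  (forall y z, K y -> K z -> `|v y - v z| <= L * `|y - z|) ->
  (forall y, K y -> `|v y| <= C) -> N x ->
  `|euler_end v x k.+1 - euler_end v x k| <= expR L * (L * C) * mesh k.
Proof.
move=> L0 C0 cK lipv bv Nx.
(* The two polygons are compared at the vertices of the coarser one. *)
pose a j := `|euler v k.+1 (j * 2) x - euler v k j x|.
have h0 := mesh_gt0 k; have h10 := mesh_gt0 k.+1.
have : a (2 ^ k)%N <= expR L * (0 + mesh k * (L * C)).
  apply: (@discrete_gronwall a k) => //; rewrite ?mulr_ge0 ?(ltW h0) //.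
    by rewrite /a mul0n subrr normr0.
  move=> j jk; rewrite /a mulSn !add2n !eulerS.
  set y := euler v k.+1 (j * 2) x; set z := euler v k j x.
  have j2 : (j * 2 < 2 ^ k.+1)%N by rewrite expnSr ltn_pmul2r.
  have j2' : ((j * 2).+1 <= 2 ^ k.+1)%N by [].
  have Ky : K y by apply: cK => //; exact: ltnW.
  have Kz : K z by apply: cK => //; exact: ltnW.
  have Ky' : K (y + mesh k.+1 *: v y) by exact: (cK k.+1 (j * 2).+1).
  rewrite [in X in _ - (z + X)]meshS scalerDl.
  set y' := y + _ in Ky' *.
  have -> : y' + mesh k.+1 *: v y' - (z + (mesh k.+1 *: v z + mesh k.+1 *: v z)) =
     (y - z) + (mesh k.+1 *: (v y - v z) + mesh k.+1 *: (v y' - v z)).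
    by rewrite /y' !scalerBr [X in _ = _ + X]addrACA -opprD [RHS]addrACA -opprD [y + (_ + _)]addrA.
  have Lyz := lipv _ _ Ky Kz; have Lyz' := lipv _ _ Ky' Kz.
  have yy' : `|y' - z| <= `|y - z| + mesh k.+1 * C.
    rewrite /y' addrAC; apply: le_trans (ler_normD _ _) _; rewrite lerD2l normrZ gtr0_norm //.
    by rewrite ler_wpM2l ?(ltW h10) // bv.
  apply: le_trans (ler_normD _ _) _.
  apply: le_trans (lerD (lexx _) (ler_normD _ _)) _.
  rewrite !normrZ gtr0_norm //.
  have A1 := ler_wpM2l (ltW h10) Lyz.
  have A2 := ler_wpM2l (ltW h10) (le_trans Lyz' (ler_wpM2l L0 yy')).
  apply: le_trans (lerD (lexx _) (lerD A1 A2)) _.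
  have LC : 0 <= mesh k.+1 * mesh k.+1 * (L * C) by rewrite !mulr_ge0 // ltW.
  have -> : mesh k = mesh k.+1 + mesh k.+1 by exact: meshS.
  set A := `|y - z|.
  nra.
by rewrite add0r /a -expnSr => /le_trans; apply; rewrite mulrA [leRHS]mulrAC.
Qed.

End Euler.

Section TimeOneMap.
Context {R : realType}.
Implicit Types (V W : normedModType R).

Lemma cvg_norm_le V (u : nat -> V) (l : V) (b : nat -> R) (c : R) :
  u @ \oo --> l -> b @ \oo --> c -> (forall k, `|u k| <= b k) -> `|l| <= c.
Proof.
move=> /cvg_norm ul bc H.
have := ler_lim (cvgP _ ul) (cvgP _ bc); rewrite (cvg_lim _ ul) // (cvg_lim _ bc) //; apply.
by near=> k; exact: H.
Unshelve. all: by end_near. Qed.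

(** Compactness of K provides the constants of the estimates, and convexity
    turns bounds on the derivative of v into a Lipschitz constant. *)
Definition tame V (v : V -> V) (O N K : set V) :=
  [/\ proper_space V, open N /\ confined v N K, compact K /\ convex_set K &
      [/\ open O, K `<=` O & Cinf O v]].

Section Tame.
Context {V : normedModType R} (v : V -> V) (O N K : set V) (tv : tame v O N K).

Lemma tame_diff x : K x -> differentiable v x.
Proof. by case: tv => _ _ _ [_ KO Cv] /KO; exact: Cinf_diff. Qed.

Lemma tame_bounds : exists L : R, [/\ 0 < L,
  forall x, K x -> forall h, `|'d v x h| <= L * `|h|,
  forall y z, K y -> K z -> `|v y - v z| <= L * `|y - z| &
  forall x, K x -> `|v x| <= L].
Proof.
case: tv => pV [oN cf] [cK cvK] [oO KO Cv].
have [L L0 HL] := C1_bounded (Cv 1) cK KO.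
have [M M0 HM] : exists2 M : R, 0 < M & forall x, K x -> `|v x| <= M.
  apply: (compact_uniform cK (P := fun M x => `|v x| <= M)) => x /KO Ox.
  have /cvgrPdist_lt /(_ 1 ltr01) /nbhs_ballP [r /= r0 Hr] := differentiable_continuous (Cinf_diff Cv Ox).
  exists r, (`|v x| + 1); split => // y xy M; apply: le_trans.
  rewrite -[v y](subrK (v x)) addrC; apply: le_trans (ler_normD _ _) _.
  by rewrite lerD2l distrC ltW // Hr // -ball_normE.
exists (L + M); split; first exact: addr_gt0.
- by move=> x /HL H h; apply: le_trans (H h) _; rewrite ler_wpM2r // lerDl ltW.
- move=> y z Ky Kz; have E : v z + (v y - v z) = v y by rewrite addrC subrK.
  have yz : z + (y - z) = y by rewrite addrC subrK.
  apply: le_trans (_ : L * `|y - z| <= _); last by rewrite ler_wpM2r // lerDl ltW.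
  rewrite -{1}yz; apply: mean_value_inequality => t t01; first by apply: tame_diff; exact: cvK.
  by apply: HL; exact: cvK.
- by move=> x /HM H; apply: le_trans H _; rewrite lerDr ltW.
Qed.

Lemma euler_end_cauchy : exists2 B : R, 0 < B & forall x, N x -> forall k n,
  `|euler_end v x (n + k) - euler_end v x k| <= B * mesh k.
Proof.
have [L [L0 _ lv bv]] := tame_bounds; case: tv => _ [_ cf] _ _.
pose B := expR L * (L * L).
have B0 : 0 < B by rewrite !mulr_gt0 // expR_gt0.
exists (B * 2); first by rewrite mulr_gt0.
move=> x Nx k n; apply: le_trans (_ : B * 2 * (mesh k - mesh (n + k)) <= _); last first.
  by apply: ler_wpM2l; [rewrite mulr_ge0 // ltW|rewrite gerBl ltW // mesh_gt0].
elim: n => [|n IH]; first by rewrite add0n !subrr normr0 mulr0.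
rewrite addSn -(subrKA (euler_end v x (n + k))).
apply: le_trans (ler_normD _ _) _.
apply: le_trans (lerD (euler_refine _ (ltW L0) (ltW L0) cf lv bv Nx) IH) _.
rewrite -/B; move: (@meshS R (n + k)); move: (@mesh R (n + k)) (@mesh R (n + k).+1) => a b ->.
by rewrite le_eqVlt; apply/orP; left; apply/eqP; ring.
Qed.

Lemma euler_end_cvg x : N x -> euler_end v x @ \oo --> flow1 v x.
Proof.
move=> Nx; have [B B0 HB] := euler_end_cauchy.
case: tv => _ [_ cf] [cK _] _.
apply: (@compact_cauchy_cvg _ K) => //; last by exists 0%N => // k _; exact: (cf k (2 ^ k)%N x (leqnn _)).
apply: cauchy_exP => e e0.
have /cvgrPdist_lt /(_ (e / B) ltac:(by rewrite divr_gt0)) [k _ Hk] := @mesh_cvg0 R.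
have hk : B * mesh k < e.
  have := Hk k (leqnn k); rewrite /= sub0r normrN gtr0_norm ?mesh_gt0 //.
  by rewrite ltr_pdivlMr // mulrC.
exists (euler_end v x k); exists k => // m /= km.
rewrite -ball_normE /= distrC -(subnK km); exact: le_lt_trans (HB x Nx k _) hk.
Qed.

Lemma flow1_in x : N x -> K (flow1 v x).
Proof.
move=> Nx; case: tv => _ [_ cf] [cK _] _.
have clK := compact_closed (@norm_hausdorff _ V) cK.
apply: (@closed_cvg _ _ \oo _ (euler_end v x) K clK _ _ (euler_end_cvg Nx)).
by exists 0%N => // k _; exact: (cf k (2 ^ k)%N x (leqnn _)).
Qed.

Lemma euler_lip : exists2 B : R, 0 < B & forall x y, N x -> N y -> forall k j,
  (j <= 2 ^ k)%N -> `|euler v k j x - euler v k j y| <= B * `|x - y|.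
Proof.
have [L [L0 _ lv bv]] := tame_bounds; case: tv => _ [_ cf] _ _.
exists (expR L) => [|x y Nx Ny k j jk]; first exact: expR_gt0.
have := @discrete_gronwall R (fun j => `|euler v k j x - euler v k j y|) k j L `|x - y| 0.
rewrite addr0; apply => //; first exact: ltW.
move=> i ij; rewrite mulr0 addr0 !eulerS.
have ik := leq_trans ij jk.
set a := euler v k i x; set b := euler v k i y.
have lab : `|v a - v b| <= L * `|a - b| by apply: lv; apply: cf => //; exact: ltnW.
have -> : a + mesh k *: v a - (b + mesh k *: v b) = (a - b) + mesh k *: (v a - v b).
  by rewrite scalerBr opprD addrACA.
apply: le_trans (ler_normD _ _) _; rewrite normrZ gtr0_norm ?mesh_gt0 // mulrDl mul1r lerD2l.
by rewrite -mulrA ler_wpM2l // ltW // mesh_gt0.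
Qed.

Lemma flow1_cont x : N x -> {for x, continuous (flow1 v)}.
Proof.
move=> Nx; have [B B0 HB] := euler_lip; case: tv => _ [oN _] _ _.
apply/cvgrPdist_le => e e0.
have nN := open_nbhs_nbhs (conj oN Nx).
near=> y.
have Ny : N y by near: y.
have H : `|flow1 v x - flow1 v y| <= B * `|x - y|.
  apply: (cvg_norm_le (cvgB (euler_end_cvg Nx) (euler_end_cvg Ny)) (cvg_cst _)) => k.
  exact: HB.
apply: le_trans H _; rewrite -ler_pdivlMl // mulrC.
near: y; apply/nbhs_ballP; exists (e / B); first by rewrite /= divr_gt0.
by move=> z; rewrite -ball_normE => /ltW.
Unshelve. all: by end_near. Qed.

End Tame.

Lemma flow1_fixed V (v : V -> V) x : v x = 0 -> flow1 v x = x.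
Proof.
move=> vx; have E k j : euler v k j x = x.
  by elim: j => // j IH; rewrite eulerS IH vx scaler0 addr0.
rewrite /flow1 (_ : euler_end v x = fun _ => x); first exact: lim_cst.
by apply/funext => k; exact: E.
Qed.

End TimeOneMap.

(** * Differentiability of time-one maps *)

Section TangentLift.
Context {R : realType}.
Implicit Types (V W : normedModType R).

(** The linearization of v along itself, as a field on the tangent space: its
    flow is the derivative of the flow of v. *)
Definition tlift V (v : V -> V) (p : V * V) : V * V := (v p.1, 'd v (p.1) p.2).

Lemma Cinf_tlift V (v : V -> V) (O : set V) : open O -> Cinf O v ->
  Cinf [set p : V * V | O p.1] (tlift v).
Proof.
move=> oO Cv k; apply: Ck_pair; first exact: open_fst.
  exact: Ck_fst (Cv k).
by case: (Cv k.+1).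
Qed.

Lemma proper_prod V W : proper_space V -> proper_space W -> proper_space (V * W)%type.
Proof.
move=> pV pW; rewrite /proper_space.
rewrite (_ : [set h : V * W | `|h| <= 1] = [set h | `|h| <= 1] `*` [set h | `|h| <= 1]).
  exact: compact_setX.
by apply/seteqP; split => -[a b] /=; rewrite prod_normE /= ge_max => /andP.
Qed.

Lemma compact_ball V (r : R) : proper_space V -> compact [set h : V | `|h| <= r].
Proof.
move=> pV; have [r0|r0] := ltP r 0.
  rewrite (_ : [set h | _] = set0); first exact: compact0.
  by apply/seteqP; split => h //=; move=> /le_lt_trans/(_ r0); rewrite normr_lt0.
have := @continuous_compact _ _ (fun h : V => r *: h) _ _ pV.
case: (ltgtP r 0) r0 => // [r0 _|-> _].
  rewrite (_ : _ @` _ = [set h | `|h| <= r]).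
    by apply; apply: continuous_subspaceT => x; exact: scaler_continuous.
  apply/seteqP; split => [_ /= [h h1 <-]|h /= hr].
    by rewrite normrZ gtr0_norm // ler_piMr // ltW.
  exists (r^-1 *: h); last by rewrite scalerA divff ?gt_eqF // scale1r.
  by rewrite /= normrZ gtr0_norm ?invr_gt0 // ler_pdivrMl // mulr1.
move=> _; rewrite (_ : [set h | _] = [set 0]); first exact: compact_set1.
by apply/seteqP; split => h /=; [rewrite normr_le0 => /eqP|move=> ->; rewrite normr0].
Qed.

Lemma euler_tlift_fst V (v : V -> V) k j p : (euler (tlift v) k j p).1 = euler v k j p.1.
Proof. by elim: j => // j IH; rewrite !eulerS /= IH. Qed.

Lemma euler_tliftS V (v : V -> V) k j p : (euler (tlift v) k j.+1 p).2 =
  (euler (tlift v) k j p).2 + mesh k *: 'd v (euler v k j p.1) (euler (tlift v) k j p).2.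
Proof. by rewrite -euler_tlift_fst eulerS. Qed.

Lemma euler_tlift_linear V (v : V -> V) k j x a (h h' : V) :
  (euler (tlift v) k j (x, a *: h + h')).2 =
  a *: (euler (tlift v) k j (x, h)).2 + (euler (tlift v) k j (x, h')).2.
Proof.
elim: j => // j IH; rewrite !euler_tliftS IH /= linearP !scalerDr !scalerA addrACA.
by rewrite [mesh k * a]mulrC.
Qed.

Section Tame.
Context {V : normedModType R} (v : V -> V) (O N K : set V) (tv : tame v O N K).

Lemma euler_tlift_bound : exists2 B : R, 0 < B & forall x h, N x -> forall k j,
  (j <= 2 ^ k)%N -> `|(euler (tlift v) k j (x, h)).2| <= B * `|h|.
Proof.
have [L [L0 dv _ _]] := tame_bounds tv; case: tv => _ [_ cf] _ _.
exists (expR L) => [|x h Nx k j jk]; first exact: expR_gt0.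
have := @discrete_gronwall R (fun j => `|(euler (tlift v) k j (x, h)).2|) k j L `|h| 0.
rewrite addr0; apply => //; first exact: ltW.
move=> i ij; rewrite mulr0 addr0 euler_tliftS.
have ik := leq_trans ij jk.
apply: le_trans (ler_normD _ _) _; rewrite normrZ gtr0_norm ?mesh_gt0 // mulrDl mul1r lerD2l.
rewrite -mulrA ler_wpM2l // ?(ltW (mesh_gt0 _)) //; apply: dv.
by apply: cf => //; exact: ltnW.
Qed.

(** The direction component of a lifted polygon grows at most by a factor B
    along the way, so that polygons whose direction is bounded by r stay over K
    with direction bounded by B r. *)
Lemma tame_tlift (r : R) : exists2 rho : R, 0 <= rho &
  tame (tlift v) [set p | O p.1] [set p | N p.1 /\ `|p.2| < r]
    [set p | K p.1 /\ `|p.2| <= rho].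
Proof.
have [B B0 HB] := euler_tlift_bound; case: tv => pV [oN cf] [cK cvK] [oO KO Cv].
exists (B * Num.max r 0); first by rewrite mulr_ge0 ?(ltW B0) // le_max lexx orbT.
split; first exact: proper_prod.
- split.
    apply: openI; first exact: open_fst.
    apply: (@open_comp _ _ (fun p : V * V => `|p.2|) [set t | t < r]); last exact: open_lt.
    by move=> p _; exact: (continuous_comp (@snd_continuous R V V p) (@norm_continuous _ V _)).
  move=> k j [x h] jk /= [Nx hr]; split; first by rewrite euler_tlift_fst; exact: cf.
  apply: le_trans (HB x h Nx k j jk) _; rewrite ler_wpM2l ?(ltW B0) //.
  by rewrite le_max ltW.
- split.
    have H := compact_setX cK (compact_ball (r := B * Num.max r 0) pV).
    exact H.
  move=> [x h] [y h'] t /= [Kx hr] [Ky hr'] /[dup] t01 /andP[t0 t1].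
  split; first exact: cvK.
  have -> : h + t *: (h' - h) = (1 - t) *: h + t *: h'.
    by rewrite scalerBr scalerBl scale1r addrA addrAC.
  apply: le_trans (ler_normD _ _) _; rewrite !normrZ !ger0_norm ?subr_ge0 //.
  set rho := B * _ in hr hr' *.
  have -> : rho = (1 - t) * rho + t * rho by ring.
  by rewrite lerD // ler_wpM2l // subr_ge0.
- split; [exact: open_fst|by move=> p [/KO]|exact: Cinf_tlift].
Qed.

(** For each k the lifted polygon is the derivative of the polygon, up to an
    error e |h| that does not depend on k: one step multiplies the discrepancy
    by 1 + mesh L and adds mesh times the Taylor remainder of v, which is
    uniformly o(|h|) on K. The estimate passes to the limit in k. *)
Lemma flow1_is_diff x : N x ->
  is_diff x (flow1 v) (fun h => (flow1 (tlift v) (x, h)).2).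
Proof.
move=> Nx.
have [L [L0 dv lv bv]] := tame_bounds tv.
have [B B0 HB] := euler_tlift_bound.
have [B' B'0 HB'] := euler_lip tv.
have cvT h : (fun k => (euler_end (tlift v) (x, h) k).2) @ \oo --> (flow1 (tlift v) (x, h)).2.
  have [rho _ tT] := tame_tlift (`|h| + 1).
  have Nh : [set p : V * V | N p.1 /\ `|p.2| < `|h| + 1] (x, h) by split => //=; rewrite ltrDl.
  apply: (@cvg_comp _ _ _ (euler_end (tlift v) (x, h)) snd _ _ _ (euler_end_cvg tT Nh)).
  exact: cvg_snd.
case: (tv) => pV [oN cf] [cK cvK] [oO KO Cv].
apply: (is_diff_estimate (C := B)).
- move=> a h h'.
  have H1 := cvgD (cvgZ (cvg_cst (a : R^o)) (cvT h)) (cvT h').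
  have H2 : (fun k => (euler_end (tlift v) (x, a *: h + h') k).2) @ \oo -->
      a *: (flow1 (tlift v) (x, h)).2 + (flow1 (tlift v) (x, h')).2.
    suff -> : (fun k => (euler_end (tlift v) (x, a *: h + h') k).2) =
      (fun k => a *: (euler_end (tlift v) (x, h) k).2 + (euler_end (tlift v) (x, h') k).2) by exact: H1.
    by apply/funext => k; exact: euler_tlift_linear.
  exact: (cvg_unique (@norm_hausdorff _ V) (cvT _) H2).
- move=> h; apply: (cvg_norm_le (cvT h) (cvg_cst _)) => k; exact: HB.
move=> e e0.
have e'0 : 0 < e / (expR L * B') by rewrite divr_gt0 // mulr_gt0 // expR_gt0.
have [d d0 Hd] := C1_uniform_diff pV oO (Cv 1) cK KO e'0.
have /nbhs_ballP [r /= r0 Hr] := open_nbhs_nbhs (conj oN Nx).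
exists (Num.min r (d / B')); first by rewrite lt_min r0 divr_gt0.
move=> h; rewrite lt_min => /andP[hr hd].
have Nxh : N (x + h) by apply: Hr; rewrite -ball_normE /ball_ /= opprD addNKr normrN.
have cvd := cvgB (cvgB (euler_end_cvg tv Nxh) (euler_end_cvg tv Nx)) (cvT h).
have cvc : (fun _ : nat => e * `|h|) @ \oo --> e * `|h| by exact: cvg_cst.
apply: (cvg_norm_le (cvd _ _) cvc) => k; rewrite /= /euler_end.
set e1 := e / _ in e'0 Hd.
have -> : e * `|h| = expR L * (0 + e1 * (B' * `|h|)).
  have n1 : expR L != 0 by rewrite gt_eqF // expR_gt0.
  have n2 : B' != 0 by rewrite gt_eqF.
  by rewrite add0r /e1; field; rewrite n1 n2.
apply: (@discrete_gronwall R (fun j => `|euler v k j (x + h) - euler v k j x - (euler (tlift v) k j (x, h)).2|) k) => //.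
- exact: ltW.
- exact: mulr_ge0 (ltW e'0) (mulr_ge0 (ltW B'0) (normr_ge0 _)).
- by rewrite /= (addrC x) addrK subrr normr0.
move=> j jk; rewrite !eulerS euler_tliftS /=.
have Kx := cf k j _ (ltnW jk) Nx.
have lh := HB' _ _ Nxh Nx k j (ltnW jk).
set y := euler v k j (x + h) in lh *; set z := euler v k j x in Kx lh *.
set w := (euler _ _ _ _).2.
rewrite [x + h]addrC addrK in lh.
have yz : `|y - z| < d by apply: le_lt_trans lh _; rewrite mulrC -ltr_pdivlMr.
have := Hd z Kx (y - z) yz; rewrite [z + _]addrC subrK => H.
have -> : y + mesh k *: v y - (z + mesh k *: v z) - (w + mesh k *: 'd v z w) =
   (y - z - w) + mesh k *: ('d v z (y - z - w) + (v y - v z - 'd v z (y - z))).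
  have -> : 'd v z (y - z - w) = 'd v z (y - z) - 'd v z w by rewrite linearB.
  set D := 'd v z (y - z); set E := 'd v z w.
  have -> : D - E + (v y - v z - D) = v y - v z - E by rewrite addrC addrA subrK.
  by rewrite !scalerBr [RHS]addrACA [y - z + _]addrACA -!opprD.
apply: le_trans (ler_normD _ _) _; rewrite normrZ gtr0_norm ?mesh_gt0 //.
set A := `|y - z - w|; set C := e1 * _.
have -> : (1 + mesh k * L) * A + mesh k * C = A + mesh k * (L * A + C) by ring.
rewrite lerD2l ler_wpM2l ?(ltW (mesh_gt0 _)) //.
apply: le_trans (ler_normD _ _) _; rewrite lerD //; first exact: dv.
by apply: le_trans H _; rewrite ler_wpM2l // ltW.
Qed.

End Tame.
End TangentLift.

Section FlowSmooth.
Context {R : realType}.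
Implicit Types (V W : normedModType R).

(** Tameness made local: for the tangent lift, the confining set depends on the
    size of the direction, so only the local form passes from N to the whole of
    N x V. *)
Definition flowable V (v : V -> V) (O N : set V) :=
  [/\ open O, Cinf O v, open N &
   forall x, N x -> exists N' K : set V, N' x /\ tame v O N' K].

Lemma tame_flowable V (v : V -> V) (O N K : set V) : tame v O N K -> flowable v O N.
Proof.
by move=> tv; case: (tv) => _ [oN _] _ [oO _ Cv]; split=> // x Nx; exists N, K.
Qed.

Lemma flowable_tlift V (v : V -> V) (O N : set V) : flowable v O N ->
  flowable (tlift v) [set p | O p.1] [set p | N p.1].
Proof.
move=> [oO Cv oN H]; split; [exact: open_fst|exact: Cinf_tlift|exact: open_fst|].
move=> [x h] /= /H [N' [K [N'x tv]]].
have [rho _ tT] := tame_tlift tv (`|h| + 1).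
by do 2 eexists; split; [|exact: tT]; split => //=; rewrite ltrDl.
Qed.

(** The derivative of the time-one map is read off the time-one map of the
    tangent lift, which is again flowable; hence the induction on k runs over
    all fields at once. *)
Lemma flow1_Ck k V (v : V -> V) (O N : set V) : flowable v O N -> Ck k N (flow1 v).
Proof.
elim: k V v O N => [|k IH] V v O N fv.
  by case: fv => _ _ _ H x /H [N' [K [N'x tv]]]; have H1 := flow1_cont tv N'x; exact: H1.
have D x : N x -> is_diff x (flow1 v) (fun h => (flow1 (tlift v) (x, h)).2).
  by case: fv => _ _ _ H /H [N' [K [N'x tv]]]; have H1 := flow1_is_diff tv N'x; exact: H1.
case: (fv) => oO Cv oN _.
split=> [x /D/is_diff_differentiable//|].
have oN' := @open_fst R V V _ oN.
have CT := IH _ _ _ _ (flowable_tlift fv).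
have C2 : Ck k [set p : V * V | N p.1] (snd \o flow1 (tlift v)).
  apply: (@Ck_comp _ k _ _ _ _ setT (flow1 (tlift v)) snd) => //; first exact: openT.
  by apply: Ck_lin; exact: snd_continuous.
by apply: (Ck_ext oN' _ C2) => -[x h] Nx; exact: esym (is_diffE1 (D x Nx) h).
Qed.

Lemma compact_ball_at V (c : V) (r : R) : proper_space V -> compact [set x : V | `|x - c| <= r].
Proof.
move=> pV; rewrite (_ : [set x | _] = (fun h => h + c) @` [set h | `|h| <= r]).
  apply: continuous_compact; last exact: compact_ball.
  by apply: continuous_subspaceT => x; apply: cvgD; [exact: cvg_id|exact: cvg_cst].
apply/seteqP; split=> [x /= xr|_ /= [h hr <-]]; last by rewrite addrK.
by exists (x - c) => //; rewrite subrK.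
Qed.

(** Near a zero c of v one has |v(x)| <= (L + 1) |x - c|, so that a polygon
    moves away from c by a factor at most exp(L + 1). All flows below are
    reduced to this case by adding constant coordinates, at a value of them
    where the field vanishes. *)
Lemma equilibrium_tame V (v : V -> V) (O : set V) (c : V) : proper_space V ->
  open O -> Cinf O v -> O c -> v c = 0 -> exists N K, N c /\ tame v O N K.
Proof.
move=> pV oO Cv Oc vc.
have dc := Cinf_diff Cv Oc.
have [L L0 HL] := linear_lipschitz (diff_continuous dc).
have [d d0 Hd] := diff_estimate dc ltr01.
have /nbhs_ballP [s /= s0 Hs] := open_nbhs_nbhs (conj oO Oc).
pose r := Num.min d s / 2.
have m0 : 0 < Num.min d s by rewrite lt_min d0.
have r0 : 0 < r by rewrite divr_gt0.
have rm : r < Num.min d s by rewrite /r; lra.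
have rd : r < d by apply: lt_le_trans rm _; rewrite ge_min lexx.
have rs : r < s by apply: lt_le_trans rm _; rewrite ge_min lexx orbT.
pose K := [set x : V | `|x - c| <= r].
(* Starting in N, the factor exp(L + 1) keeps polygons in the ball K. *)
pose N := [set x : V | `|x - c| < r / expR (L + 1)].
have vK x : K x -> `|v x| <= (L + 1) * `|x - c|.
  move=> Kx; have := Hd (x - c) (le_lt_trans Kx rd).
  rewrite [c + _]addrC subrK vc subr0 mul1r => H.
  rewrite -[v x](subrK ('d v c (x - c))).
  apply: le_trans (ler_normD _ _) _; rewrite mulrDl mul1r [leRHS]addrC lerD //.
have e1 : 0 < expR (L + 1) by exact: expR_gt0.
exists N, K; split; first by rewrite /N /= subrr normr0 divr_gt0.
split=> //.
- split.
    rewrite (_ : N = ball c (r / expR (L + 1))); first exact: ball_open.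
    by apply/seteqP; split => x; rewrite /N -ball_normE /= distrC.
  move=> k j x jk Nx; have : (j <= 2 ^ k)%N := jk.
  elim/ltn_ind: j {jk} => j IH jk; rewrite /K /=.
  have := @discrete_gronwall R (fun i => `|euler v k i x - c|) k j (L + 1) `|x - c| 0.
  rewrite addr0 => H; apply: le_trans (H _ _ _ _ _ _) _ => //.
  + by rewrite addr_ge0 // ltW.
  + move=> i ij; rewrite mulr0 addr0 eulerS addrAC.
    have Ki := IH i ij (leq_trans (ltnW ij) jk).
    apply: le_trans (ler_normD _ _) _; rewrite normrZ gtr0_norm ?mesh_gt0 // mulrDl mul1r lerD2l.
    by rewrite -mulrA ler_wpM2l ?(ltW (mesh_gt0 _)) // vK.
  + by rewrite mulrC -ler_pdivlMr // ltW.
- split; first exact: compact_ball_at.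
  move=> x y t; rewrite /K /= => Kx Ky /andP[t0 t1].
  have -> : x + t *: (y - x) - c = (1 - t) *: (x - c) + t *: (y - c).
    have E : y - c - (x - c) = y - x by rewrite opprB addrA subrK.
    by rewrite scalerBl scale1r -[RHS]addrA [- _ + t *: _]addrC -scalerBr E addrAC.
  apply: le_trans (ler_normD _ _) _; rewrite !normrZ !ger0_norm ?subr_ge0 //.
  have -> : r = (1 - t) * r + t * r by ring.
  by rewrite lerD // ler_wpM2l // subr_ge0.
- split=> // x Kx; apply: Hs; rewrite -ball_normE /= distrC; exact: le_lt_trans Kx rs.
Qed.

Lemma proper_real : proper_space R^o.
Proof.
rewrite /proper_space (_ : [set h : R^o | _] = `[-1, 1]%classic); first exact: segment_compact.
by apply/seteqP; split=> x /=; rewrite in_itv /= ler_norml.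
Qed.

(** A map h along the trajectories, which may depend on time through the clock
    in its second argument, vanishes if it does so at time 0 and its derivative
    is bounded by its size. On polygons the derivative is replaced by a
    difference whose Taylor error is uniformly o(mesh). *)
Lemma gronwall_flow V W (v : V -> V) (O N K : set V) (Q : set (V * R^o)) (h : V * R^o -> W) (M : R) x :
  tame v O N K -> open Q -> (forall y (s : R), K y -> 0 <= s <= 1 -> Q (y, s)) ->
  Ck 1 Q h -> 0 <= M ->
  (forall y (s : R), K y -> 0 <= s <= 1 -> `|'d h (y, s : R^o) (v y, 1 : R^o)| <= M * `|h (y, s)|) ->
  N x -> h (x, 0) = 0 -> h (flow1 v x, 1) = 0.
Proof.
move=> tv oQ KQ Ch M0 dh Nx h0.
have [L [L0 _ _ bv]] := tame_bounds tv; case: (tv) => pV [oN cf] [cK _] _.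
have cK1 : compact (K `*` `[0, 1]%classic : set (V * R^o)).
  by apply: compact_setX => //; exact: segment_compact.
have K1Q : K `*` `[0, 1]%classic `<=` Q.
  by move=> [y s] [/= Ky]; rewrite in_itv /= => s01; exact: KQ.
have p1 : proper_space (V * R^o)%type by apply: proper_prod => //; exact: proper_real.
apply/eqP; rewrite -normr_le0; apply/ler_addgt0Pr => e e0; rewrite add0r.
have C0 : 0 < L + 1 by rewrite addr_gt0.
have e1 : 0 < e / (expR M * (L + 1)) by rewrite divr_gt0 // mulr_gt0 // expR_gt0.
(* The field of polygons with clock is (v, 1), of norm at most L + 1. *)
have [d d0 Hd] := C1_uniform_diff p1 oQ Ch cK1 K1Q e1.
have hc : {for (flow1 v x, 1 : R^o), continuous h}.
  have Kf := flow1_in tv Nx.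
  by apply: differentiable_continuous; apply: (Ck_diff Ch); apply: KQ => //; rewrite ler01 lexx.
have ec : (fun k => h (euler_end v x k, 1 : R^o)) @ \oo --> h (flow1 v x, 1 : R^o).
  have H1 := euler_end_cvg tv Nx.
  have H2 : (fun _ : nat => (1 : R^o)) @ \oo --> (1 : R^o) by exact: cvg_cst.
  have H3 : (fun k => (euler_end v x k, 1 : R^o)) @ \oo --> (flow1 v x, 1 : R^o).
    exact: (cvg_pair H1 H2).
  exact: (continuous_cvg _ hc H3).
have /cvgrPdist_lt /(_ (d / (L + 1)) ltac:(by rewrite divr_gt0)) [k0 _ Hk] := @mesh_cvg0 R.
have bnd k : (k0 <= k)%N -> `|h (euler_end v x k, 1 : R^o)| <= e.
  move=> /Hk; rewrite /= sub0r normrN gtr0_norm ?mesh_gt0 // => mk.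
  have := @discrete_gronwall R (fun j => `|h (euler v k j x, j%:R * mesh k : R^o)|) k (2 ^ k) M 0 (e / expR M).
  rewrite mesh_steps add0r [expR M * _]mulrC divfK ?gt_eqF ?expR_gt0 //; apply => //.
  - by rewrite divr_ge0 ?expR_ge0 // ltW.
  - by rewrite mul0r h0 normr0.
  move=> j jk.
  set y := euler v k j x; set s := j%:R * mesh k.
  have Ky : K y by apply: cf => //; exact: ltnW.
  have s01 : 0 <= s <= 1 by rewrite mulr_ge0 ?(ltW (mesh_gt0 _)) //= mesh_step_le // ltnW.
  have vL : `|(v y, 1 : R^o)| <= L + 1.
    by rewrite prod_normE /= ge_max normr1 lerDr (ltW L0) andbT (le_trans (bv _ Ky)) // lerDl.
  have hs : `|mesh k *: (v y, 1 : R^o)| < d.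
    rewrite normrZ gtr0_norm ?mesh_gt0 //.
    apply: le_lt_trans (_ : mesh k * (L + 1) < d); last by rewrite -ltr_pdivlMr.
    by rewrite ler_wpM2l ?(ltW (mesh_gt0 _)).
  have := Hd (y, s : R^o) (conj Ky _) _ hs.
  rewrite /= in_itv /= => /(_ s01).
  have -> : (y, s : R^o) + mesh k *: (v y, 1 : R^o) = (euler v k j.+1 x, j.+1%:R * mesh k : R^o).
    congr (_, _); rewrite /s -natr1 mulrDl mul1r; congr (_ + _); exact: mulr1.
  move=> H.
  have dl := dh y s Ky s01.
  set h1 := h (euler _ _ _ _, _) in H *; set h2 := h (y, _) in H dl *.
  have -> : h1 = h2 + (h1 - h2 - 'd h (y, s : R^o) (mesh k *: (v y, 1 : R^o)) + 'd h (y, s : R^o) (mesh k *: (v y, 1 : R^o))).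
    by rewrite subrK addrC subrK.
  have Er c : (1 + mesh k * M) * `|h2| + mesh k * c = `|h2| + (mesh k * c + mesh k * M * `|h2|) by ring.
  apply: le_trans (ler_normD _ _) _; rewrite Er lerD2l.
  apply: le_trans (ler_normD _ _) _; rewrite [leLHS]addrC [leRHS]addrC lerD //.
    rewrite linearZ normrZ gtr0_norm ?mesh_gt0 // -mulrA ler_wpM2l ?(ltW (mesh_gt0 _)) //.
  apply: le_trans H _; rewrite normrZ gtr0_norm ?mesh_gt0 // mulrCA ler_wpM2l ?(ltW (mesh_gt0 _)) //.
  rewrite invfM mulrA; apply: le_trans (ler_wpM2l _ vL) _; last by rewrite mulfVK ?gt_eqF.
  by rewrite !mulr_ge0 ?invr_ge0 ?expR_ge0 // ltW.
have := @cvg_norm_le _ _ (fun k => h (euler_end v x (k + k0)%N, 1 : R^o)) _ (fun _ => e) e _ (cvg_cst _).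
apply => [|k]; last by apply: bnd; rewrite leq_addl.
by move: ec; rewrite -(cvg_shiftn k0).
Qed.

End FlowSmooth.

(** * Local flows *)

Section FlowExists.
Context {R : realType}.
Implicit Types (V W Z : normedModType R).

Lemma CkB k V W (A : set V) (f g : V -> W) : open A ->
  Ck k A f -> Ck k A g -> Ck k A (fun x => f x - g x).
Proof.
move=> oA Cf Cg; have C1 := CkZ oA (@Ck_cst R k V R^o A (-1) oA) Cg.
by apply: (Ck_ext oA _ (CkD oA Cf C1)) => x _; rewrite scaleN1r.
Qed.

Lemma Ck_id k V (A : set V) : Ck k A (fun x : V => x).
Proof. by apply: (@Ck_lin R k V V A idfun) => x; exact: cvg_id. Qed.

Lemma Ck_comp_fst k V W Z (A : set V) (f : V -> W * Z) : open A ->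
  Ck k A f -> Ck k A (fun x => (f x).1).
Proof.
move=> oA Cf; apply: (@Ck_comp R k _ _ _ A setT f fst) => //; first exact: openT.
by apply: Ck_lin; exact: fst_continuous.
Qed.

Lemma Ck_comp_snd k V W Z (A : set V) (f : V -> W * Z) : open A ->
  Ck k A f -> Ck k A (fun x => (f x).2).
Proof.
move=> oA Cf; apply: (@Ck_comp R k _ _ _ A setT f snd) => //; first exact: openT.
by apply: Ck_lin; exact: snd_continuous.
Qed.

(** A linear map that kills the values of v is constant along polygons. *)
Lemma flow1_invariant V W (v : V -> V) (O N K : set V) (f : {linear V -> W}) x :
  tame v O N K -> continuous f -> (forall y, K y -> f (v y) = 0) -> N x ->
  f (flow1 v x) = f x.
Proof.
move=> tv cf fv Nx; case: (tv) => _ [_ cfd] _ _.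
have E k j : (j <= 2 ^ k)%N -> f (euler v k j x) = f x.
  elim: j => // j IH jk; rewrite eulerS linearD linearZ /= fv ?scaler0 ?addr0 ?IH //.
    exact: ltnW.
  by apply: cfd => //; exact: ltnW.
have H := continuous_cvg _ (cf (flow1 v x)) (euler_end_cvg tv Nx).
have H2 : (fun k => f (euler_end v x k)) @ \oo --> f x.
  suff -> : (fun k => f (euler_end v x k)) = (fun _ => f x) by exact: cvg_cst.
  by apply/funext => k; exact: E.
exact: (cvg_unique (@norm_hausdorff _ W) (H _) H2).
Qed.

Lemma flow1_tlift_fst V (v : V -> V) (O N K : set V) x h :
  tame v O N K -> N x -> (flow1 (tlift v) (x, h)).1 = flow1 v x.
Proof.
move=> tv Nx; have [rho _ tT] := tame_tlift tv (`|h| + 1).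
have Nh : [set p : V * V | N p.1 /\ `|p.2| < `|h| + 1] (x, h) by split => //=; rewrite ltrDl.
have H := continuous_cvg _ (@fst_continuous R V V _) (euler_end_cvg tT Nh).
have H2 : (fun k => (euler_end (tlift v) (x, h) k).1) @ \oo --> flow1 v x.
  suff -> : (fun k => (euler_end (tlift v) (x, h) k).1) = euler_end v x by exact: (euler_end_cvg tv Nx).
  by apply/funext => k; exact: euler_tlift_fst.
exact: (cvg_unique (@norm_hausdorff _ V) (H _) H2).
Qed.

(** The time s as a frozen coordinate: the first component of the time-one map
    at (x, s) is the flow of v at time s. For s = 0 every point is an
    equilibrium. *)
Definition scaled_field V (v : V -> V) (p : V * R^o) : V * R^o := (p.2 *: v p.1, 0).

Lemma Cinf_scaled_field V (v : V -> V) (O : set V) : open O -> Cinf O v ->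
  Cinf [set p : V * R^o | O p.1] (scaled_field v).
Proof.
move=> oO Cv k; have oO' := @open_fst R V R^o _ oO.
apply: Ck_pair => //; last exact: Ck_cst.
apply: CkZ => //; last exact: Ck_fst.
by apply: Ck_lin; exact: snd_continuous.
Qed.

Lemma is_diff_fst V W (p : V * W) : is_diff p fst fst.
Proof. by apply: is_diff_lin; exact: fst_continuous. Qed.

Lemma is_diff_snd V W (p : V * W) : is_diff p snd snd.
Proof. by apply: is_diff_lin; exact: snd_continuous. Qed.

Lemma is_diff_compose V W Z (f df : V -> W) (g dg : W -> Z) x :
  is_diff x f df -> is_diff (f x) g dg -> is_diff x (fun y => g (f y)) (fun h => dg (df h)).
Proof. by move=> fdf gdg; exact: is_diff_comp. Qed.

Lemma is_diff_sub V W (f df g dg : V -> W) x :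
  is_diff x f df -> is_diff x g dg ->
  is_diff x (fun y => f y - g y) (fun h => df h - dg h).
Proof. by move=> ? ?; exact: is_diffB. Qed.

Lemma is_diff_scaled_field V (v : V -> V) p : differentiable v p.1 ->
  is_diff p (scaled_field v) (fun h => (p.2 *: 'd v (p.1) h.1 + h.2 *: v p.1, 0)).
Proof.
move=> /differentiableP dv.
have H1 := is_diff_scale (is_diff_snd p) (is_diff_compose (is_diff_fst p) dv).
exact: (is_diff_pair H1 (is_diff_cst (0 : R^o) p)).
Qed.

(** The local flow near c comes from the equilibrium (c, 0) of the scaled
    field. The last clause transports linear conditions on tangent vectors: if
    the derivative of E along the tangent lift of v is bounded by E, a vector
    with E = 0 keeps this property under the derivative of the flow. *)
Theorem flow_exists V (v : V -> V) (O : set V) (c : V) : proper_space V ->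
  open O -> Cinf O v -> O c ->
  exists (phi : V * R^o -> V) (N : set (V * R^o)),
    [/\ open N, N (c, 0), Cinf N phi & forall p, N p -> O (phi p)] /\
    [/\ forall x, phi (x, 0) = x,
        forall p, N p -> 'd phi p (0, 1) = v (phi p) &
        forall W (E : V * V -> W) (M : R), 0 <= M ->
          Ck 1 [set p | O p.1] E ->
          (forall x w, O x -> `|'d E (x, w) (v x, 'd v x w)| <= M * `|E (x, w)|) ->
          forall x s w, N (x, s) -> E (x, w) = 0 ->
          E (phi (x, s), 'd phi (x, s) (w, 0)) = 0].
Proof.
move=> pV oO Cv Oc.
pose F := scaled_field v.
have oO' := @open_fst R V R^o _ oO.
have CF := Cinf_scaled_field oO Cv.
have pVR := proper_prod pV (@proper_real R).
have Fc : F (c, 0) = 0 by rewrite /F /scaled_field /= scale0r.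
have [N [K [Nc tF]]] := @equilibrium_tame R (V * R^o)%type F _ (c, 0) pVR oO' CF Oc Fc.
case: (tF) => _ [oN cf] [cK _] [_ KO _].
have CP : Cinf N (flow1 F) by move=> k; exact: (flow1_Ck k (tame_flowable tF)).
have dF p : K p -> forall h, 'd F p h = (p.2 *: 'd v (p.1) h.1 + h.2 *: v p.1, 0).
  move=> Kp; apply: is_diffE1; apply: is_diff_scaled_field.
  by apply: (Cinf_diff Cv); exact: KO.
pose phi p := (flow1 F p).1.
have dphi p : N p -> is_diff p phi (fun h => ('d (flow1 F) p h).1).
  move=> Np; apply: is_diff_compose; last exact: is_diff_fst.
  by apply: differentiableP; exact: (Cinf_diff CP Np).
have dflow p h : N p -> 'd (flow1 F) p h = (flow1 (tlift F) (p, h)).2.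
  by move=> Np; have H := flow1_is_diff tF Np; exact: (is_diffE1 H h).
have [L [L0 dL _ _]] := tame_bounds tF.
have flow_fst p h (Np : N p) := flow1_tlift_fst h tF Np.
exists phi, N; split; split => //.
- move=> k; apply: (@Ck_comp _ k _ _ _ N setT (flow1 F) fst) => //; first exact: openT.
  by apply: Ck_lin; exact: fst_continuous.
- by move=> p Np; have Kf := flow1_in tF Np; exact: (KO _ Kf).
- by move=> x; rewrite /phi flow1_fixed //= /F /scaled_field /= scale0r.
- move=> p Np; rewrite (is_diffE1 (dphi p Np)) /= dflow //.
  have [rho _ tT] := tame_tlift tF (`|((0, 1) : V * R^o)| + 1).
  set N' := [set p | _ /\ _] in tT; set K' := [set p | _ /\ _] in tT.
  have N'p : N' (p, (0, 1)) by split => //=; rewrite ltrDl.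
  (* Lifting the direction (0, 1), the derivative in s at clock t is t v. *)
  pose h (q : ((V * R^o) * (V * R^o)) * R^o) : V := q.1.2.1 - (q.2 *: q.1.2.2) *: v q.1.1.1.
  pose Q := [set q : ((V * R^o) * (V * R^o)) * R^o | O q.1.1.1].
  have oQ : open Q by exact: (@open_fst R ((V * R^o) * (V * R^o))%type R^o _ (@open_fst R (V * R^o)%type (V * R^o)%type _ oO')).
  have hd q : Q q -> is_diff q h (fun k => k.1.2.1 -
      ((q.2 *: q.1.2.2) *: 'd v (q.1.1.1) k.1.1.1 + (q.2 *: k.1.2.2 + k.2 *: q.1.2.2) *: v q.1.1.1)).
    move=> Qq; have dv := differentiableP (Cinf_diff Cv Qq).
    have d1 := is_diff_fst q; have d2 := is_diff_snd q.
    have d11 := is_diff_compose d1 (is_diff_fst q.1); have d12 := is_diff_compose d1 (is_diff_snd q.1).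
    have d111 := is_diff_compose d11 (is_diff_fst q.1.1).
    have d121 := is_diff_compose d12 (is_diff_fst q.1.2); have d122 := is_diff_compose d12 (is_diff_snd q.1.2).
    exact: (is_diff_sub d121 (is_diff_scale (is_diff_scale d2 d122) (is_diff_compose d111 dv))).
  have Ch : Ck 1 Q h.
    have Ci : Ck 1 Q id by exact: Ck_id.
    have C1 := Ck_comp_fst oQ Ci; have C2 := Ck_comp_snd oQ Ci.
    have C11 := Ck_comp_fst oQ C1; have C12 := Ck_comp_snd oQ C1.
    have C111 := Ck_comp_fst oQ C11; have C121 := Ck_comp_fst oQ C12; have C122 := Ck_comp_snd oQ C12.
    have Cvx : Ck 1 Q (fun q => v q.1.1.1) by exact: (Ck_comp oQ oO _ C111 (Cv 1)).
    exact: (CkB oQ C121 (CkZ oQ (CkZ oQ C2 C122) Cvx)).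
  have KF P : K' P -> ('d F (P.1) P.2).2 = 0 by move=> [KP _]; rewrite dF.
  have H : h (flow1 (tlift F) (p, (0, 1)), 1) = 0.
    apply: (gronwall_flow (M := L) tT oQ _ Ch) => //; first by move=> q s [/KO KP _] _.
    - exact: ltW.
    - move=> P t KP t01; have [KP1 _] := KP; have Oq : Q (P, t) by exact: KO.
      rewrite (is_diffE1 (hd _ Oq)) /h /=.
      set k := P.2.1 - _.
      have -> : L * `|k| = L * `|((k, 0) : V * R^o)|.
        by rewrite prod_normE /= normr0 max_l.
      apply: le_trans (dL _ KP1 (k, 0)).
      rewrite !dF //= !scaler0 !scale0r !addr0 scale1r add0r prod_normE /= normr0 max_l //.
      rewrite /k linearB scalerBr.
      have -> : 'd v (P.1.1) ((t *: P.2.2) *: v P.1.1) = (t *: P.2.2) *: 'd v (P.1.1) (v P.1.1) by rewrite linearZ.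
      have -> : 'd v (P.1.1) (P.1.2 *: v P.1.1) = P.1.2 *: 'd v (P.1.1) (v P.1.1) by rewrite linearZ.
      by rewrite opprD addrACA subrr addr0 !scalerA [P.1.2 * _]mulrC.
    - by rewrite /h /= scale0r scale0r subrr.
  move: H; rewrite /h /= scale1r flow_fst //.
  have -> : (flow1 (tlift F) (p, (0, 1))).2.2 = 1 :> R^o.
    have cl : continuous (snd \o snd : (V * R^o) * (V * R^o) -> R^o).
      by move=> z; exact: (continuous_comp (@snd_continuous _ _ _ _) (@snd_continuous _ _ _ _)).
    by rewrite -[LHS]/((snd \o snd) _) (flow1_invariant (f := snd \o snd) tT cl).
  by rewrite scale1r => /eqP; rewrite subr_eq0 => /eqP.
- move=> W E M M0 CE dE x s w Nxs Exw.
  pose p : V * R^o := (x, s); pose P0 := (p, (w, 0) : V * R^o).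
  have [rho _ tT] := tame_tlift tF (`|((w, 0) : V * R^o)| + 1).
  set N' := [set p | _ /\ _] in tT; set K' := [set p | _ /\ _] in tT.
  have N'p : N' P0 by split => //=; rewrite ltrDl.
  pose Q := [set q : ((V * R^o) * (V * R^o)) * R^o | O q.1.1.1].
  have oQ : open Q by exact: (@open_fst R ((V * R^o) * (V * R^o))%type R^o _ (@open_fst R (V * R^o)%type (V * R^o)%type _ oO')).
  pose E0 (P : (V * R^o) * (V * R^o)) : W := E (P.1.1, P.2.1).
  pose QQ := [set P : (V * R^o) * (V * R^o) | O P.1.1].
  have oQQ : open QQ by exact: (@open_fst R (V * R^o)%type (V * R^o)%type _ oO').
  (* The time component of the direction enters the derivative of E0; it is
     added to h, and stays 0 along the lifted flow. *)
  pose h (q : ((V * R^o) * (V * R^o)) * R^o) : W * R^o := (E0 q.1, q.1.2.2).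
  have CE0 : Ck 1 QQ E0.
    have Ci : Ck 1 QQ id by exact: Ck_id.
    have C1 := Ck_comp_fst oQQ (Ck_comp_fst oQQ Ci); have C2 := Ck_comp_fst oQQ (Ck_comp_snd oQQ Ci).
    exact: (Ck_comp oQQ (@open_fst R V V _ oO) _ (Ck_pair oQQ C1 C2) CE).
  have Ch : Ck 1 Q h.
    have Ci : Ck 1 Q id by exact: Ck_id.
    have C1 := Ck_comp_fst oQ Ci; have C122 := Ck_comp_snd oQ (Ck_comp_snd oQ C1).
    by apply: Ck_pair => //; exact: (Ck_comp oQ oQQ _ C1 CE0).
  have dE0 P : QQ P -> is_diff P E0 (fun k => 'd E (P.1.1, P.2.1) (k.1.1, k.2.1)).
    move=> QP; have dEP := differentiableP (Ck_diff (x := (P.1.1, P.2.1)) CE QP).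
    have d1 := is_diff_compose (is_diff_fst P) (is_diff_fst P.1).
    have d2 := is_diff_compose (is_diff_snd P) (is_diff_fst P.2).
    exact: (is_diff_compose (is_diff_pair d1 d2) dEP).
  have hd q : Q q -> is_diff q h (fun k => ('d E (q.1.1.1, q.1.2.1) (k.1.1.1, k.1.2.1), k.1.2.2)).
    move=> Qq; have d1 := is_diff_fst q.
    have d12 := is_diff_compose d1 (is_diff_snd q.1); have d122 := is_diff_compose d12 (is_diff_snd q.1.2).
    exact: (is_diff_pair (is_diff_compose d1 (dE0 _ Qq)) d122).
  case: (tT) => _ _ [cK' _] [_ K'O _].
  have [L' L'0 dL'] := C1_bounded CE0 cK' (K'O : K' `<=` QQ).
  have [S S0 HS] : exists2 S : R, 0 < S & forall y, K y -> `|y| <= S.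
    apply: (compact_uniform cK (P := fun M y => `|y| <= M)) => y _.
    exists 1, (`|y| + 1); split => // z yz m; apply: le_trans.
    rewrite -[z](subrK y) addrC; apply: le_trans (ler_normD _ _) _.
    by rewrite lerD2l distrC ltW.
  have H : h (flow1 (tlift F) P0, 1) = 0.
    apply: (gronwall_flow (M := S * M + L' * L) tT oQ _ Ch) => //; first by move=> q t [/KO KP _] _.
    - by rewrite addr_ge0 // mulr_ge0 // ltW.
    - move=> P t KP t01; have [KP1 _] := KP; have Oq : Q (P, t) by exact: KO.
      rewrite (is_diffE1 (hd _ Oq)) /h /= !dF //=.
      set x' := P.1.1; set s' := P.1.2; set w' := P.2.1; set sg := P.2.2.
      have Ox' : O x' by exact: KO.
      have s'S : `|s'| <= S by apply: le_trans (HS _ KP1); rewrite [leRHS]prod_normE /= le_max lexx orbT.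
      have -> : (s' *: v x', s' *: 'd v x' w' + sg *: v x') = s' *: (v x', 'd v x' w') + (0, sg *: v x').
        by congr (_, _); rewrite /= addr0.
      have nv : `|sg *: v x'| <= L * `|sg|.
        have := dL _ KP1 (0, sg); rewrite dF //= linear0 scaler0 add0r !prod_normE /= !normr0.
        by rewrite max_l // max_r.
      have nE : `|'d E (x', w') (0, sg *: v x')| <= L' * L * `|sg|.
        have := dL' P KP ((0, 0), (sg *: v x', 0)); rewrite (is_diffE1 (dE0 P _)) //= => H.
        apply: le_trans H _; rewrite -mulrA ler_wpM2l ?(ltW L'0) //.
        by rewrite !prod_normE /= !normr0 maxxx (max_l (normr_ge0 _)) max_r.
      rewrite prod_normE /= normr0 max_l // prod_normE /=.
      rewrite linearD linearZ /=; apply: le_trans (ler_normD _ _) _.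
      rewrite normrZ mulrDl; apply: lerD.
        rewrite -mulrA; apply: ler_pM => //.
        apply: le_trans (dE x' w' Ox') _; rewrite ler_wpM2l // le_max /E0 lexx //.
      apply: le_trans nE _; rewrite ler_wpM2l ?mulr_ge0 ?(ltW L0) ?(ltW L'0) //.
      by rewrite le_max lexx orbT.
    - by rewrite /h /E0 /= Exw.
  move: H; rewrite /h /E0 /= flow_fst // => -[+ _].
  by rewrite (is_diffE1 (dphi p Nxs)) dflow.
Qed.

End FlowExists.

(** * The inverse function theorem *)

Section InverseFunction.
Context {R : realType}.
Implicit Types (V W Z : normedModType R).

Lemma Ck_comp_diff k V W Z (A : set V) (O : set W) (f : V -> W) (g : V -> W) (F : W -> Z) :
  open A -> open O -> Ck k.+1 O F -> Ck k A f -> Ck k A g -> (forall x, A x -> O (f x)) ->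
  Ck k A (fun x => 'd F (f x) (g x)).
Proof.
move=> oA oO [_ CF] Cf Cg AO.
exact: (@Ck_comp _ k _ _ _ A [set p : W * W | O p.1] (fun x => (f x, g x)) _ oA (open_fst oO) AO (Ck_pair oA Cf Cg) CF).
Qed.

(** Here A(x, w) is a preimage of w under dF_x. Along a solution of
    x' = A(x, w), F moves with constant velocity w; starting at x0 with
    w = y - F(x0), it reaches y at time 1. The parameter w is a frozen
    coordinate of the field, whose equilibrium is (x0, 0). *)
Lemma right_inverse V (F : V -> V) (A : V * V -> V) (O : set V) (x0 : V) :
  proper_space V -> open O -> Cinf O F -> Cinf [set p | O p.1] A -> O x0 ->
  A (x0, 0) = 0 -> (forall x y, O x -> 'd F x (A (x, y)) = y) ->
  exists (psi : V -> V) (B : set V), [/\ open B, B (F x0), Cinf B psi, psi (F x0) = x0 &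
    forall y, B y -> O (psi y) /\ F (psi y) = y].
Proof.
move=> pV oO CF CA Ox0 A0 HA.
pose G (p : V * V) : V * V := (A p, 0).
have oO' := @open_fst R V V _ oO.
have CG : Cinf [set p | O p.1] G by move=> k; apply: Ck_pair => //; exact: Ck_cst.
have G0 : G (x0, 0) = 0 by rewrite /G A0.
have [N [K [N0 tG]]] := @equilibrium_tame R (V * V)%type G _ (x0, 0) (proper_prod pV pV) oO' CG Ox0 G0.
case: (tG) => _ [oN _] _ [_ KO _].
pose B := [set y | N (x0, y - F x0)].
have Cy k : Ck k setT (fun y : V => (x0, y - F x0)).
  apply: Ck_pair; [exact: openT|apply: Ck_cst; exact: openT|].
  by apply: CkB; [exact: openT|exact: Ck_id|apply: Ck_cst; exact: openT].
have oB : open B.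
  apply: (@open_comp _ _ (fun y : V => (x0, y - F x0))) => // y _.
  exact: (Cy 0%N y).
exists (fun y => (flow1 G (x0, y - F x0)).1), B; split => //.
- by rewrite /B /= subrr.
- move=> k; apply: Ck_comp_fst => //.
  exact: (Ck_comp oB oN _ (Ck_sub (@subsetT _ B) (Cy k)) (flow1_Ck k (tame_flowable tG))).
- by rewrite subrr flow1_fixed.
move=> y By; have Kf := flow1_in tG By; split; first exact: KO.
(* At clock t, F has moved by t w. *)
pose h (q : (V * V) * R^o) : V := F q.1.1 - F x0 - q.2 *: q.1.2.
pose Q := [set q : (V * V) * R^o | O q.1.1].
have oQ : open Q by exact: (@open_fst R (V * V)%type R^o _ oO').
have Ch : Ck 1 Q h.
  have Ci : Ck 1 Q id by exact: Ck_id.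
  have C1 := Ck_comp_fst oQ Ci; have C2 := Ck_comp_snd oQ Ci.
  have C11 := Ck_comp_fst oQ C1; have C12 := Ck_comp_snd oQ C1.
  have CF1 : Ck 1 Q (fun q => F q.1.1) by exact: (Ck_comp oQ oO _ C11 (CF 1)).
  exact: (CkB oQ (CkB oQ CF1 (Ck_cst 1 (F x0) oQ)) (CkZ oQ C2 C12)).
have hd q : Q q -> is_diff q h (fun k => 'd F (q.1.1) k.1.1 - 0 - (q.2 *: k.1.2 + k.2 *: q.1.2)).
  move=> Qq; have dF := differentiableP (Cinf_diff CF Qq).
  have d1 := is_diff_fst q; have d2 := is_diff_snd q.
  have d11 := is_diff_compose d1 (is_diff_fst q.1); have d12 := is_diff_compose d1 (is_diff_snd q.1).
  exact: (is_diff_sub (is_diff_sub (is_diff_compose d11 dF) (is_diff_cst (F x0) q)) (is_diff_scale d2 d12)).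
have H : h (flow1 G (x0, y - F x0), 1) = 0.
  apply: (gronwall_flow (M := 0) tG oQ _ Ch) => //; first by move=> q t /KO.
  - move=> p t /KO Op t01; rewrite (is_diffE1 (hd (p, t) Op)) /=.
    have -> : A p = A (p.1, p.2) by case: (p).
    by rewrite HA // subr0 scaler0 add0r scale1r subrr normr0 mul0r.
  - by rewrite /h /= scale0r subr0 subrr.
have E : (flow1 G (x0, y - F x0)).2 = y - F x0.
  have cl : continuous (snd : V * V -> V) by exact: snd_continuous.
  by rewrite (flow1_invariant (f := snd) tG cl).
by move: H; rewrite /h /= E scale1r opprB addrA subrK => /eqP; rewrite subr_eq0 => /eqP.
Qed.

Lemma Ck_prod k V (A : set V) (I : Type) (r : seq I) (P : pred I) (f : I -> V -> R^o) : open A ->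
  (forall i, Ck k A (f i)) -> Ck k A (fun x => \prod_(i <- r | P i) f i x : R^o).
Proof.
move=> oA Cf; elim: r => [|i r IH].
  apply: (Ck_ext oA _ (@Ck_cst _ k V R^o A 1 oA)) => x _.
  by rewrite big_nil.
case: (boolP (P i)) => Pi.
  apply: (Ck_ext oA _ (CkZ oA (Cf i) IH)) => x _.
  by rewrite big_cons Pi.
by apply: (Ck_ext oA _ IH) => x _; rewrite big_cons (negbTE Pi).
Qed.

Lemma Ck_det k V n (A : set V) (M : V -> 'M[R]_n) : open A ->
  (forall i j, Ck k A (fun x => M x i j : R^o)) -> Ck k A (fun x => \det (M x) : R^o).
Proof.
move=> oA CM; apply: Ck_sum => // s _.
by apply: CkZ => //; [exact: Ck_cst|exact: Ck_prod].
Qed.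

Lemma Ck_mulmx k V m n p (A : set V) (M : V -> 'M[R]_(m, n)) (N : V -> 'M[R]_(n, p)) : open A ->
  Ck k A M -> Ck k A N -> Ck k A (fun x => M x *m N x).
Proof.
move=> oA CM CN; apply: Ck_mx => // i j.
have : Ck k A (fun x => \sum_l (M x i l : R^o) *: (N x l j : R^o)).
  by apply: Ck_sum => // l _; apply: CkZ => //; exact: Ck_coord.
by apply: Ck_ext => // x _; rewrite mxE.
Qed.

(** By the adjugate formula. *)
Lemma Ck_invmx k V n (A : set V) (M : V -> 'M[R]_n) : open A ->
  (forall x, A x -> M x \in unitmx) -> Ck k A M -> Ck k A (fun x => invmx (M x)).
Proof.
move=> oA uM CM; have Cij i j := Ck_coord i j oA CM.
have Cd := Ck_det oA Cij.
have : Ck k A (fun x => ((\det (M x))^-1 : R^o) *: \adj (M x)).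
  apply: CkZ => //; first by apply: Ck_inv => // x /uM; rewrite unitmxE unitfE.
  apply: Ck_mx => // i j.
  have : Ck k A (fun x => ((-1) ^+ (j + i) : R^o) *: (\det (row' j (col' i (M x))) : R^o)).
    apply: CkZ => //; first exact: Ck_cst.
    apply: Ck_det => // a b.
    by apply: (Ck_ext oA _ (Cij (lift j a) (lift i b))) => x _; rewrite !mxE.
  by apply: Ck_ext => // x _; rewrite mxE.
by apply: Ck_ext => // x /uM u; rewrite /invmx u.
Qed.

End InverseFunction.

Section InverseRow.
Context {R : realType} {n : nat}.
Implicit Types (F : 'rV[R]_n -> 'rV[R]_n).

Lemma open_preimage (T U : topologicalType) (B : set T) (A : set U) (f : T -> U) :
  open B -> open A -> (forall y, B y -> {for y, continuous f}) ->
  open [set y | B y /\ A (f y)].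
Proof.
move=> oB oA cf; rewrite openE => y [By Afy]; rewrite /interior /=.
have nB := open_nbhs_nbhs (conj oB By).
have nA : nbhs y (f @^-1` A) by apply: (cf y By); exact: open_nbhs_nbhs.
by apply: filterS2 nB nA.
Qed.

Lemma proper_rV : proper_space 'rV[R]_n.
Proof.
apply: bounded_closed_compact.
  by exists 1; split => // M M1 h /= /le_trans; apply; exact: ltW.
apply: (@closed_comp _ _ (fun h : 'rV[R]_n => `|h|) [set t | t <= 1]); last exact: closed_le.
by move=> h _; exact: norm_continuous.
Qed.

Definition jac F x : 'M[R]_n := \matrix_i 'd F x (delta_mx 0 i).

Lemma jacE F x v : 'd F x v = v *m jac F x.
Proof.
rewrite (diff_coord_sum F x v) mulmx_sum_row; apply: eq_bigr => i _.
by rewrite rowK.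
Qed.

Lemma Ck_jac k F (O : set 'rV[R]_n) : open O -> Cinf O F -> Ck k O (jac F).
Proof.
move=> oO CF; apply: Ck_mx => // i j.
have : Ck k O (fun x => ('d F x (delta_mx 0 i)) 0 j : R^o) by apply: Ck_coord => //; exact: Cinf_dir.
by apply: Ck_ext => // x _; rewrite mxE.
Qed.

(** The preimage of w under dF_x is w times the inverse of the Jacobian matrix,
    which is smooth in x where the determinant is nonzero. *)
Lemma local_right_inverse F (O : set 'rV[R]_n) x0 : open O -> Cinf O F -> O x0 ->
  (forall v, 'd F x0 v = 0 -> v = 0) ->
  exists (psi : 'rV[R]_n -> 'rV[R]_n) (B : set 'rV[R]_n),
    [/\ open B, B (F x0), Cinf B psi, psi (F x0) = x0 &
    forall y, B y -> O (psi y) /\ F (psi y) = y].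
Proof.
move=> oO CF Ox0 inj.
have CJ k := Ck_jac k oO CF.
pose O' := [set x | O x /\ \det (jac F x) != 0].
have oO' : open O'.
  apply: (open_preimage (A := [set t : R^o | t != 0]) (f := fun x => \det (jac F x) : R^o) oO).
    exact: open_neq.
  by apply: (@Ck_det _ 0) => // i j; apply: Ck_coord.
have uJ x : O' x -> jac F x \in unitmx by move=> [_]; rewrite unitmxE unitfE.
have O'x0 : O' x0.
  split => //; rewrite -unitfE -unitmxE -row_free_unit; apply: inj_row_free => v.
  by rewrite -jacE; exact: inj.
have O'O : O' `<=` O by move=> x [].
pose A (p : 'rV[R]_n * 'rV[R]_n) := p.2 *m invmx (jac F p.1).
have oT := @open_fst R _ 'rV[R]_n _ oO'.
have CA : Cinf [set p | O' p.1] A.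
  move=> k; have C1 : Ck k O' (jac F) by exact: (Ck_sub O'O (CJ k)).
  have C2 := Ck_fst 'rV[R]_n oO' (Ck_invmx oO' uJ C1).
  have C3 : Ck k [set p : 'rV[R]_n * 'rV[R]_n | O' p.1] snd by apply: Ck_lin; exact: snd_continuous.
  exact: (Ck_mulmx oT C3 C2).
have [||psi [B [oB By0 Cpsi psi0 HB]]] :=
    @right_inverse R _ F A O' x0 proper_rV oO' (fun k => Ck_sub O'O (CF k)) CA O'x0.
- by rewrite /A mul0mx.
- by move=> x y O'x; rewrite jacE /A mulmxKV // uJ.
by exists psi, B; split => // y /HB [/O'O].
Qed.

(** A right inverse psi of F has itself an injective derivative, hence a right
    inverse chi. From F o psi = id and psi o chi = id one gets chi = F near x0,
    so psi is also a left inverse there. *)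
Theorem inverse_function F (O : set 'rV[R]_n) x0 : open O -> Cinf O F -> O x0 ->
  (forall v, 'd F x0 v = 0 -> v = 0) ->
  exists (A : set 'rV[R]_n) (G : 'rV[R]_n -> 'rV[R]_n),
    [/\ open A, A x0, A `<=` O, open (F @` A) & Cinf (F @` A) G /\
     forall x, A x -> G (F x) = x].
Proof.
move=> oO CF Ox0 inj.
have [psi [B [oB By0 Cpsi psi0 HB]]] := local_right_inverse oO CF Ox0 inj.
have dpsi w : 'd psi (F x0) w = 0 -> w = 0.
  have dF := differentiableP (Cinf_diff CF Ox0); rewrite -psi0 in dF.
  have H := is_diff_compose (differentiableP (Cinf_diff Cpsi By0)) dF.
  have Hid : is_diff (F x0) (fun y => F (psi y)) id.
    apply: (near_eq_is_diff _ (is_diff_id (F x0))).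
    by apply: filterS (open_nbhs_nbhs (conj oB By0)) => y /HB[].
  have E : 'd F (psi (F x0)) ('d psi (F x0) w) = w := etrans (esym (is_diffE1 H w)) (is_diffE1 Hid w).
  move=> dw; apply: etrans (esym E) _; apply: etrans (linear0 ('d F (psi (F x0)))).
  exact: (congr1 ('d F (psi (F x0))) dw).
have [chi [A [oA Ax0 Cchi chi0 HA]]] := local_right_inverse oB Cpsi By0 dpsi.
rewrite psi0 in Ax0.
(* On A, chi coincides with F. *)
have key x : A x -> [/\ O x, B (F x) & psi (F x) = x].
  move=> /HA [Bc pc]; have [Op Fp] := HB _ Bc; rewrite pc in Op Fp.
  by split => //; rewrite Fp.
have FA : F @` A = [set y | B y /\ A (psi y)].
  apply/seteqP; split=> [_ [x Ax <-]|y [By Ay]].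
    by have [_ Bx px] := key x Ax; split => //; rewrite px.
  by exists (psi y) => //; have [] := HB y By.
exists A, psi; split => //.
- by move=> x /key[].
- rewrite FA; apply: open_preimage => // y By.
  by apply: differentiable_continuous; exact: (Cinf_diff Cpsi By).
split; last by move=> x /key[].
by move=> k; apply: Ck_sub (Cpsi k); rewrite FA => y [].
Qed.

End InverseRow.

(** * Forms and fields on the jet space *)

Section ContactCalculus.
Context {R : realType}.
Notation V := (jet R).
Implicit Types (A : set V) (X Y : vfield R) (w : oneform R) (m : V).

Lemma sum5 (F : 'I_5 -> R) : \sum_i F i = F ix + F iy + F iz + F ip + F iq.
Proof.
rewrite !big_ord_recl big_ord0 addr0 !addrA.
by congr (F _ + F _ + F _ + F _ + F _); exact: val_inj.
Qed.

Lemma pairingE (w v : 'rV[R]_5) : pairing w v = \sum_i v 0 i * w 0 i.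
Proof. by rewrite /pairing mxE; apply: eq_bigr => i _; rewrite mxE. Qed.

Lemma pairingC (w v : 'rV[R]_5) : pairing w v = pairing v w.
Proof. by rewrite !pairingE; apply: eq_bigr => i _; rewrite mulrC. Qed.

Lemma pairingDr (w u v : 'rV[R]_5) : pairing w (u + v) = pairing w u + pairing w v.
Proof. by rewrite /pairing mulmxDl mxE. Qed.
Lemma pairingZr (w v : 'rV[R]_5) a : pairing w (a *: v) = a * pairing w v.
Proof. by rewrite /pairing -scalemxAl mxE. Qed.
Lemma pairingDl (w u v : 'rV[R]_5) : pairing (u + v) w = pairing u w + pairing v w.
Proof. by rewrite !(pairingC _ w) pairingDr. Qed.
Lemma pairingZl (w v : 'rV[R]_5) a : pairing (a *: v) w = a * pairing v w.
Proof. by rewrite !(pairingC _ w) pairingZr. Qed.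
Lemma pairingNr (w v : 'rV[R]_5) : pairing w (- v) = - pairing w v.
Proof. by rewrite -scaleN1r pairingZr mulN1r. Qed.
Lemma pairingNl (w v : 'rV[R]_5) : pairing (- v) w = - pairing v w.
Proof. by rewrite !(pairingC _ w) pairingNr. Qed.
Lemma pairing0r (w : 'rV[R]_5) : pairing w 0 = 0.
Proof. by rewrite /pairing mul0mx mxE. Qed.
Lemma pairing0l (w : 'rV[R]_5) : pairing 0 w = 0.
Proof. by rewrite pairingC pairing0r. Qed.

Lemma pairing_unitv (w : 'rV[R]_5) i : pairing w (unitv R i) = w 0 i.
Proof.
rewrite pairingE (bigD1 i) //= big1 => [|j ji]; rewrite !mxE.
  by rewrite !eqxx mul1r addr0.
by rewrite (negbTE ji) mul0r.
Qed.

Lemma pairing_row (f : 'I_5 -> R) v : pairing (\row_j f j) v = \sum_j v 0 j * f j.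
Proof. by rewrite pairingE; apply: eq_bigr => j _; rewrite mxE. Qed.

Lemma Ck_pairing k (W : normedModType R) (S : set W) (f g : W -> 'rV[R]_5) : open S ->
  Ck k S f -> Ck k S g -> Ck k S (fun y => pairing (f y) (g y) : R^o).
Proof.
move=> oS Cf Cg.
have : Ck k S (fun y => \sum_i (g y 0 i : R^o) *: (f y 0 i : R^o)).
  by apply: Ck_sum => // i _; apply: CkZ => //; exact: Ck_coord.
by apply: Ck_ext => // y _; rewrite pairingE.
Qed.

Lemma is_diff_sum (W W' : normedModType R) (I : Type) (r : seq I) (f df : I -> W -> W') x :
  (forall i, is_diff x (f i) (df i)) ->
  is_diff x (fun y => \sum_(i <- r) f i y) (fun h => \sum_(i <- r) df i h).
Proof.
move=> H; elim: r => [|i r IH].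
  have -> : (fun y => \sum_(i <- [::]) f i y) = fun _ => 0 by apply/funext => y; rewrite big_nil.
  have -> : (fun y => \sum_(i <- [::]) df i y) = fun _ => 0 by apply/funext => y; rewrite big_nil.
  exact: is_diff_cst.
have -> : (fun y => \sum_(j <- i :: r) f j y) = fun y => f i y + \sum_(j <- r) f j y.
  by apply/funext => y; rewrite big_cons.
have -> : (fun y => \sum_(j <- i :: r) df j y) = fun y => df i y + \sum_(j <- r) df j y.
  by apply/funext => y; rewrite big_cons.
exact: is_diff_add.
Qed.

Lemma is_diff_coord (W : normedModType R) p q (f df : W -> 'M[R]_(p, q)) x i j :
  is_diff x f df -> is_diff x (fun y => f y i j : R^o) (fun h => df h i j : R^o).
Proof.
move=> H; apply: (is_diff_compose (g := mxcoord i j) (dg := mxcoord i j) H).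
by apply: is_diff_lin; exact: mxcoord_continuous.
Qed.

Lemma is_diff_pairing (W : normedModType R) (f df g dg : W -> 'rV[R]_5) x :
  is_diff x f df -> is_diff x g dg ->
  is_diff x (fun y => pairing (f y) (g y) : R^o) (fun h => pairing (df h) (g x) + pairing (f x) (dg h) : R^o).
Proof.
move=> Hf Hg.
have -> : (fun y => pairing (f y) (g y) : R^o) = fun y => \sum_i (g y 0 i : R^o) *: (f y 0 i : R^o).
  by apply/funext => y; rewrite pairingE.
have -> : (fun h => pairing (df h) (g x) + pairing (f x) (dg h) : R^o) =
    fun h => \sum_i ((g x 0 i : R^o) *: (df h 0 i : R^o) + (dg h 0 i : R^o) *: (f x 0 i : R^o)).
  by apply/funext => h; rewrite big_split /= !pairingE.
by apply: is_diff_sum => i; exact: (is_diff_scale (is_diff_coord 0 i Hg) (is_diff_coord 0 i Hf)).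
Qed.

Section Smooth.
Variables (A : set V) (oA : open A).

Lemma derive_diff (W : normedModType R) (f : V -> W) m v : Cinf A f -> A m -> 'D_v f m = 'd f m v.
Proof. by move=> Cf Am; apply: deriveE; exact: (Cinf_diff Cf Am). Qed.

Lemma lie_pairing X w m v : Cinf A X -> Cinf A w -> A m ->
  pairing (lie X w m) v = pairing ('d w m (X m)) v + pairing (w m) ('d X m v).
Proof.
move=> CX Cw Am; rewrite /lie (derive_diff _ Cw Am) pairingDl; congr (_ + _).
rewrite pairing_row.
have -> : 'd X m v = \sum_i v 0 i *: 'd X m (unitv R i) by exact: diff_coord_sum.
have -> : pairing (w m) (\sum_i v 0 i *: 'd X m (unitv R i)) = \sum_i pairing (w m) (v 0 i *: 'd X m (unitv R i)).
  elim/big_rec2 : _ => [|i y1 y2 _ <-]; first exact: pairing0r.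
  by rewrite pairingDr.
apply: eq_bigr => i _; rewrite pairingZr; congr (_ * pairing _ _).
exact: (derive_diff _ CX Am).
Qed.

Lemma Cinf_lie X w : Cinf A X -> Cinf A w -> Cinf A (lie X w).
Proof.
move=> CX Cw k; apply: Ck_mx => // i j.
have C1 : Ck k A (fun m => 'd w m (X m)).
  by apply: (Ck_comp_diff (f := idfun) oA oA (Cw k.+1)) => //; exact: Ck_id.
have C2 : Ck k A (fun m => 'd X m (unitv R j)) by exact: (Cinf_dir _ oA CX).
have := CkD oA (Ck_pairing oA C1 (Ck_cst k (unitv R j) oA)) (Ck_pairing oA (Cw k) C2).
apply: Ck_ext => // m Am.
by rewrite (ord1 i) -pairing_unitv lie_pairing.
Qed.

Lemma bracketE X Y m : Cinf A X -> Cinf A Y -> A m ->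
  bracket X Y m = 'd Y m (X m) - 'd X m (Y m).
Proof.
by move=> CX CY Am; rewrite /bracket (derive_diff _ CX Am) (derive_diff _ CY Am).
Qed.

Lemma Cinf_bracket X Y : Cinf A X -> Cinf A Y -> Cinf A (bracket X Y).
Proof.
move=> CX CY k.
have C1 : Ck k A (fun m => 'd Y m (X m)).
  by apply: (Ck_comp_diff (f := idfun) oA oA (CY k.+1)) => //; exact: Ck_id.
have C2 : Ck k A (fun m => 'd X m (Y m)).
  by apply: (Ck_comp_diff (f := idfun) oA oA (CX k.+1)) => //; exact: Ck_id.
by apply: (Ck_ext oA _ (CkB oA C1 C2)) => m Am; rewrite bracketE.
Qed.

(** The Leibniz rule for the pairing; the derivative of X in the direction Y
    enters the Lie derivative and the bracket with opposite signs. *)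
Lemma cartan X Y w m : Cinf A X -> Cinf A Y -> Cinf A w -> A m ->
  'd (fun m => pairing (w m) (Y m) : R^o) m (X m) =
  pairing (lie X w m) (Y m) + pairing (w m) (bracket X Y m).
Proof.
move=> CX CY Cw Am.
have dw := differentiableP (Cinf_diff Cw Am); have dY := differentiableP (Cinf_diff CY Am).
rewrite (lie_pairing _ CX Cw Am) (bracketE CX CY Am) pairingDr pairingNr.
apply: etrans (is_diffE1 (is_diff_pairing dw dY) _) _.
by rewrite -addrA; congr (_ + _); rewrite addrCA subrr addr0.
Qed.

Lemma diff0_near (W : normedModType R) (f : V -> W) m v : A m -> (forall m, A m -> f m = 0) -> 'd f m v = 0.
Proof.
move=> Am f0; have H := is_diff_cst (0 : W) m.
have H1 : is_diff m f (fun _ => 0).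
  apply: (near_eq_is_diff _ H); move: (open_nbhs_nbhs (conj oA Am)).
  by apply: filterS => y /f0.
exact: (is_diffE1 H1).
Qed.

End Smooth.

Lemma Cinf_U A : open A -> Cinf A (@U R).
Proof.
move=> oA k; have Cc i : Ck k A (fun m : V => m 0 i : R^o) by apply: Ck_coord => //; exact: Ck_id.
have Cu i : Ck k A (fun m : V => (m 0 i : R^o) *: unitv R i) by apply: CkZ => //; exact: Ck_cst.
have C1 := CkB oA (Ck_cst k (unitv R iz) oA) (CkZ oA (Cc ip) (Ck_cst k (unitv R ix) oA)).
exact: (CkB oA C1 (CkZ oA (Cc iq) (Ck_cst k (unitv R iy) oA))).
Qed.

Lemma annihilatorP (w v : 'rV[R]_5) : (v <= annihilator w)%MS <-> pairing w v = 0.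
Proof.
rewrite /annihilator sub_kermx /pairing; split=> [/eqP ->|H]; first by rewrite mxE.
by apply/eqP/matrixP => i j; rewrite !ord1 H mxE.
Qed.

Lemma contactP m (v : 'rV[R]_5) : (v <= contact m)%MS <-> pairing (U m) v = 0.
Proof. exact: annihilatorP. Qed.

Lemma pairing_U m (v : 'rV[R]_5) : pairing (U m) v = v 0 iz - m 0 ip * v 0 ix - m 0 iq * v 0 iy.
Proof.
rewrite pairingE sum5 /U /unitv !mxE /=; ring.
Qed.

(** The coordinates of v are its values under dU on d/dp, d/dq and on the
    horizontal lifts of d/dx and d/dy, which all lie in the contact plane. *)
Lemma extd_nondegenerate m (v : 'rV[R]_5) : pairing (U m) v = 0 ->
  (forall u, pairing (U m) u = 0 -> extd (@U R) m v u = 0) -> v = 0.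
Proof.
rewrite pairing_U => Uv H.
have Hp := H (unitv R ip); have Hq := H (unitv R iq).
have Hx := H (unitv R ix + m 0 ip *: unitv R iz); have Hy := H (unitv R iy + m 0 iq *: unitv R iz).
move: Hp Hq Hx Hy; rewrite !pairing_U !extd_U /unitv !mxE /= => Hp Hq Hx Hy.
have vx : v 0 ix = 0 by rewrite -[RHS]Hp; ring.
have vy : v 0 iy = 0 by rewrite -[RHS]Hq; ring.
have vp : v 0 ip = 0 by apply/eqP; rewrite -oppr_eq0; apply/eqP; rewrite -[RHS]Hx; ring.
have vq : v 0 iq = 0 by apply/eqP; rewrite -oppr_eq0; apply/eqP; rewrite -[RHS]Hy; ring.
have vz : v 0 iz = 0 by rewrite -[RHS]Uv vx vy; ring.
by apply/rowP => j; rewrite mxE; apply: (@Defs.ord5P (fun j => v 0 j = 0)).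
Qed.

End ContactCalculus.

Section Gram.
Context {R : realType}.

(** If v (B B^T) = 0, the real vector v B is orthogonal to itself. *)
Lemma gram_unit r n (B : 'M[R]_(r, n)) : row_free B -> B *m B^T \in unitmx.
Proof.
move=> fB; rewrite -row_free_unit; apply: inj_row_free => v H.
have : (v *m B) *m (v *m B)^T = 0 by rewrite trmx_mul mulmxA -[v *m B *m _]mulmxA H mul0mx.
suff U0 (u : 'rV[R]_n) : u *m u^T = 0 -> u = 0.
  by move/U0 => vB; apply: (row_free_inj fB); rewrite vB mul0mx.
move=> /matrixP /(_ 0 0); rewrite !mxE => /eqP.
rewrite psumr_eq0 => [/allP H0|i _]; last by rewrite mxE -expr2 sqr_ge0.
apply/rowP => j; have := H0 j; rewrite mem_index_enum => /(_ isT) /=.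
by rewrite mxE -expr2 sqrf_eq0 => /eqP ->; rewrite mxE.
Qed.

(** The coefficients of x on the rows of B, written as a smooth function of x
    and B. *)
Lemma gram_coords r n (B : 'M[R]_(r, n)) (x : 'rV[R]_n) : row_free B -> (x <= B)%MS ->
  x = x *m B^T *m invmx (B *m B^T) *m B.
Proof.
by move=> /gram_unit uB /submxP [c ->]; rewrite -(mulmxA c B) mulmxK.
Qed.

Lemma Ck_col_mx k (V : normedModType R) p q n (A : set V) (M : V -> 'M[R]_(p, n)) (N : V -> 'M[R]_(q, n)) :
  open A -> Ck k A M -> Ck k A N -> Ck k A (fun x => col_mx (M x) (N x)).
Proof.
move=> oA CM CN; apply: Ck_mx => // i j.
have C : Ck k A (fun x => match fintype.split i with inl a => M x a j : R^o | inr b => N x b j : R^o end).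
  by case: (fintype.split i) => a; exact: Ck_coord.
by apply: (Ck_ext oA _ C) => x _; rewrite mxE.
Qed.

End Gram.

Section Differentials.
Context {R : realType}.
Notation V := (jet R).
Variables (A : set V) (oA : open A).
Implicit Types (f g : func R) (X : vfield R).

Lemma differentialE f m v : Cinf A f -> A m -> pairing (differential f m) v = 'd f m v.
Proof.
move=> Cf Am; rewrite /differential pairing_row; apply: etrans _ (esym (diff_coord_sum f m v)).
by apply: eq_bigr => j _; congr (_ * _); exact: (derive_diff _ Cf Am).
Qed.

Lemma Cinf_differential f : Cinf A f -> Cinf A (differential f).
Proof.
move=> Cf k; apply: Ck_mx => // i j.
apply: (Ck_ext oA _ (Cinf_dir (unitv R j) oA Cf k)) => m Am.
by rewrite mxE; exact: esym (derive_diff _ Cf Am).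
Qed.

Lemma diff_differential f m u v : Cinf A f -> A m ->
  'd (fun x => 'd f x v : R^o) m u = pairing ('d (differential f) m u) v.
Proof.
move=> Cf Am.
have dF := differentiableP (Cinf_diff (Cinf_differential Cf) Am).
have H := is_diff_pairing dF (is_diff_cst v m).
have H1 : is_diff m (fun x => 'd f x v : R^o) (fun h => pairing ('d (differential f) m h) v + pairing (differential f m) 0 : R^o).
  apply: (near_eq_is_diff _ H); move: (open_nbhs_nbhs (conj oA Am)).
  by apply: filterS => y Ay; exact: differentialE.
by apply: etrans (is_diffE1 H1 u) _; rewrite pairing0r addr0.
Qed.

Lemma hessian_sym f m u v : Cinf A f -> A m ->
  pairing ('d (differential f) m u) v = pairing ('d (differential f) m v) u.
Proof.
move=> Cf Am; rewrite -!diff_differential //.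
apply: (symmetric_derivatives oA) => //.
- by move=> y; exact: Cinf_diff.
- by exact: (Cinf_diff (Cinf_dir v oA Cf) Am).
- by exact: (Cinf_diff (Cinf_dir u oA Cf) Am).
Qed.

Lemma pairing_ext (w w' : 'rV[R]_5) : (forall v, pairing w v = pairing w' v) -> w = w'.
Proof. by move=> H; apply/rowP => i; rewrite -!pairing_unitv. Qed.

Lemma pairing_comb (w : 'rV[R]_5) (a b : func R) (Y Z : vfield R) m :
  pairing w (a m *: Y m + b m *: Z m) = a m * pairing w (Y m) + b m * pairing w (Z m).
Proof. by rewrite pairingDr !pairingZr. Qed.

(** X(df) = d(X f), by symmetry of the second derivatives of f. *)
Lemma lie_differential X f m : Cinf A X -> Cinf A f -> A m ->
  (forall m, A m -> pairing (differential f m) (X m) = 0) -> lie X (differential f) m = 0.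
Proof.
move=> CX Cf Am Xf; apply: pairing_ext => v; rewrite pairing0l.
have CD := Cinf_differential Cf.
rewrite (lie_pairing _ CX CD Am) hessian_sym //.
(* After symmetrization, this is the derivative of the function X f. *)
have H := is_diff_pairing (differentiableP (Cinf_diff CD Am)) (differentiableP (Cinf_diff CX Am)).
rewrite -[LHS]/((fun h => pairing ('d (differential f) m h) (X m) + pairing (differential f m) ('d X m h)) v).
apply: etrans (esym (is_diffE1 H v)) _.
exact: (diff0_near oA _ Am Xf).
Qed.

Lemma lie_ext X (w w' : oneform R) m : A m -> (forall m, A m -> w m = w' m) -> lie X w m = lie X w' m.
Proof.
move=> Am E; rewrite /lie (E _ Am); congr (_ + _); apply: near_eq_derive.
by move: (open_nbhs_nbhs (conj oA Am)); apply: filterS => y /E.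
Qed.

Lemma lieD X (w w' : oneform R) m : Cinf A X -> Cinf A w -> Cinf A w' -> A m ->
  lie X (fun m => w m + w' m) m = lie X w m + lie X w' m.
Proof.
move=> CX Cw Cw' Am; apply: pairing_ext => v.
have CS : Cinf A (fun m => w m + w' m) by move=> k; exact: CkD.
have H := is_diff_add (differentiableP (Cinf_diff Cw Am)) (differentiableP (Cinf_diff Cw' Am)).
have E := etrans (lie_pairing v CX CS Am)
  (congr1 (fun z => pairing z v + pairing (w m + w' m) ('d X m v)) (is_diffE1 H (X m))).
rewrite E [RHS]pairingDl (lie_pairing v CX Cw Am) (lie_pairing v CX Cw' Am).
by rewrite !pairingDl addrACA.
Qed.

Lemma lieZ X (w : oneform R) (a : func R) m : Cinf A X -> Cinf A w -> Cinf A a -> A m ->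
  lie X (fun m => a m *: w m) m = a m *: lie X w m + pairing (differential a m) (X m) *: w m.
Proof.
move=> CX Cw Ca Am; apply: pairing_ext => v.
have CS : Cinf A (fun m => a m *: w m) by move=> k; exact: CkZ.
have H := is_diff_scale (differentiableP (Cinf_diff Ca Am)) (differentiableP (Cinf_diff Cw Am)).
have E := etrans (lie_pairing v CX CS Am)
  (congr1 (fun z => pairing z v + pairing (a m *: w m) ('d X m v)) (is_diffE1 H (X m))).
rewrite E [RHS]pairingDl !pairingZl (lie_pairing v CX Cw Am).
by rewrite (differentialE _ Ca Am) pairingDl !pairingZl mulrDr addrAC.
Qed.

Lemma charField_contact f m : pairing (U m) (charField f m) = 0.
Proof.
have := (charFieldP f m (charField f m)).2; rewrite charFieldE => /(_ erefl) [/contactP].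
by [].
Qed.

(** The multiplier of U in the definition of X_f is minus the derivative of f
    along d/dz, since dU does not involve dz. *)
Lemma extd_charField f m v :
  extd (@U R) m (charField f m) v =
  pairing (differential f m) v - pairing (differential f m) (unitv R iz) * pairing (U m) v.
Proof.
have := (charFieldP f m (charField f m)).2; rewrite {1}charFieldE => /(_ erefl) [_ [l E]].
have Ev u : extd (@U R) m (charField f m) u = pairing (differential f m) u + l * pairing (U m) u.
  rewrite -pairingZl -pairingDl -E.
  rewrite /contract_extd pairing_row !extd_U sum5 !extd_U /unitv !mxE /=; ring.
have := Ev (unitv R iz); rewrite extd_U pairing_U => Ez.
rewrite Ev; congr (_ + _); rewrite -mulNr; congr (_ * _).
move: Ez; set a := pairing _ _; rewrite /unitv !mxE /= => Ez.
by apply/eqP; rewrite -addr_eq0 addrC; apply/eqP; move: Ez; rewrite !mulr0 !subr0 mulr1 !addr0 => <-.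
Qed.

Lemma extd_anti m u v : extd (@U R) m u v = - extd (@U R) m v u.
Proof. by rewrite !extd_U; ring. Qed.

Lemma pairing_charField_sym f g m :
  pairing (differential f m) (charField g m) = - pairing (differential g m) (charField f m).
Proof.
have := extd_charField f m (charField g m); have := extd_charField g m (charField f m).
rewrite !charField_contact !mulr0 !subr0 => <- <-; exact: extd_anti.
Qed.

Lemma pairing_charField_self f m : pairing (differential f m) (charField f m) = 0.
Proof. by have := pairing_charField_sym f f m; lra. Qed.

Lemma first_integralP X f : Cinf A f ->
  first_integral A X f <-> forall m, A m -> pairing (differential f m) (X m) = 0.
Proof.
move=> Cf; split=> H m Am; have E := etrans (differentialE (X m) Cf Am) (esym (derive_diff (X m) Cf Am)).
  by rewrite E; exact: H.
by rewrite -E; exact: H.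
Qed.

Lemma Cinf_charField f : Cinf A f -> Cinf A (charField f).
Proof.
move=> Cf; rewrite charFieldE => k.
have Cd i : Ck k A (fun m => 'D_(unitv R i) f m : R^o).
  apply: (Ck_ext oA _ (Cinf_dir (unitv R i) oA Cf k)) => m Am; exact: esym (derive_diff _ Cf Am).
have Cc i : Ck k A (fun m : V => m 0 i : R^o) by apply: Ck_coord => //; exact: Ck_id.
have Cu i : Ck k A (fun m : V => unitv R i) by exact: Ck_cst.
have D1 := CkZ oA (Cd ip) (CkD oA (Cu ix) (CkZ oA (Cc ip) (Cu iz))).
have D2 := CkZ oA (Cd iq) (CkD oA (Cu iy) (CkZ oA (Cc iq) (Cu iz))).
have D3 := CkZ oA (CkD oA (Cd ix) (CkZ oA (Cc ip) (Cd iz))) (Cu ip).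
have D4 := CkZ oA (CkD oA (Cd iy) (CkZ oA (Cc iq) (Cd iz))) (Cu iq).
exact: (CkB oA (CkB oA (CkD oA D1 D2) D3) D4).
Qed.

End Differentials.

(** * The type of a contact field *)

Section TypeOfField.
Context {R : realType}.
Notation V := (jet R).

Definition iterated_lie (X : vfield R) (k : nat) : oneform R := iter k (lie X) (@U R).

Definition type_matrix (X : vfield R) (m : V) : 'M[R]_(4, 5) := \matrix_(i < 4) iterated_lie X i m.

Section Field.
Variables (A : set V) (oA : open A) (X : vfield R).
Hypotheses (CX : Cinf A X) (contX : forall m, A m -> pairing (U m) (X m) = 0).

Lemma Cinf_iterated_lie k : Cinf A (iterated_lie X k).
Proof. by elim: k => [|k IH]; [exact: Cinf_U|exact: Cinf_lie]. Qed.

(** Cartan's magic formula, in which d(U(X)) vanishes. *)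
Lemma lie_U m v : A m -> pairing (lie X (@U R) m) v = extd (@U R) m (X m) v.
Proof.
move=> Am; have CU := Cinf_U oA.
have H := is_diff_pairing (differentiableP (Cinf_diff CU Am)) (differentiableP (Cinf_diff CX Am)).
have E : pairing ('d (@U R) m v) (X m) + pairing (U m) ('d X m v) = 0.
  exact: etrans (esym (is_diffE1 H v)) (diff0_near oA v Am contX).
apply: etrans (lie_pairing v CX CU Am) _.
have -> : pairing (U m) ('d X m v) = - pairing ('d (@U R) m v) (X m) by apply/eqP; rewrite -addr_eq0 addrC; apply/eqP.
by rewrite /extd (derive_diff (X m) CU Am) (derive_diff v CU Am).
Qed.

(** A relation between U and X(U) would put X in the radical of dU on the
    contact plane. *)
Lemma U_lieU_free m (a b : R) : A m -> X m != 0 ->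
  a *: U m + b *: lie X (@U R) m = 0 -> a = 0 /\ b = 0.
Proof.
move=> Am X0 E.
have Ev v : a * pairing (U m) v + b * extd (@U R) m (X m) v = 0.
  by rewrite -lie_U // -!pairingZl -pairingDl E pairing0l.
have b0 : b = 0.
  apply/eqP; apply: contraNT X0 => b0; apply/eqP.
  apply: (extd_nondegenerate (contX Am)) => u Uu.
  have := Ev u; rewrite Uu mulr0 add0r => /eqP; rewrite mulf_eq0 (negbTE b0) /=; exact/eqP.
split => //; have := Ev (unitv R iz); rewrite b0 mul0r addr0 pairing_U /unitv !mxE /=.
by rewrite !mulr0 !subr0 mulr1.
Qed.

Lemma row_type_matrix (i : 'I_4) m : row i (type_matrix X m) = iterated_lie X i m.
Proof. by rewrite rowK. Qed.

Lemma U_lieU_row_free m : A m -> X m != 0 -> row_free (col_mx (U m) (lie X (@U R) m)).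
Proof.
move=> Am X0; apply: inj_row_free => v; rewrite -[v]hsubmxK mul_row_col.
rewrite (mx11_scalar (lsubmx v)) (mx11_scalar (rsubmx v)) !mul_scalar_mx => /(U_lieU_free Am X0)[-> ->].
by rewrite !raddf0 row_mx0.
Qed.

Lemma type_ge2 m : A m -> X m != 0 -> (2 <= \rank (type_matrix X m))%N.
Proof.
move=> Am X0; pose B := col_mx (U m) (lie X (@U R) m).
have fB : row_free B by exact: U_lieU_row_free.
have rB : \rank B = 2%N by exact/eqP.
rewrite -[X in (X <= _)%N]rB.
apply: mxrankS; rewrite col_mx_sub.
have H0 := row_sub (0 : 'I_4) (type_matrix X m); have H1 := row_sub (1 : 'I_4) (type_matrix X m).
by rewrite !row_type_matrix in H0 H1; rewrite H0 H1.
Qed.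

Lemma annihilated_rank m d (P : 'M[R]_(d, 5)) : \rank P = 2%N ->
  (forall k v, (v <= P)%MS -> pairing (iterated_lie X k m) v = 0) ->
  (\rank (type_matrix X m) <= 3)%N.
Proof.
move=> rP H.
have : P *m (type_matrix X m)^T = 0.
  apply/matrixP => i j; rewrite mxE.
  have := H j (row i P) (row_sub i P); rewrite pairingE => E.
  rewrite [RHS]mxE -[RHS]E; apply: eq_bigr => l _; by rewrite !mxE.
move=> /mulmx0_rank_max; rewrite rP mxrank_tr => H3.
by rewrite -(leq_add2l 2).
Qed.

End Field.

Lemma has_type_from_rank (Om : set V) X k m0 : open Om -> Cinf Om X -> (forall m, Om m -> pairing (U m) (X m) = 0) ->
  Om m0 -> X m0 != 0 -> has_type Om X k -> (\rank (type_matrix X m0) <= 3)%N ->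
  has_type Om X 2 \/ has_type Om X 3.
Proof.
move=> oO CX cX Om0 X0 hk.
have r2 := type_ge2 oO CX cX Om0 X0.
have := hk m0 Om0; rewrite -/(iterated_lie X _) => E.
have Ek : \rank (type_matrix X m0) = k by exact: E.
rewrite Ek in r2 *; case: k r2 hk {E Ek} => [|[|[|[|k]]]] // _ hk _; [by left|by right].
Qed.

End TypeOfField.

Section TowardsType.
Context {R : realType}.
Notation V := (jet R).

Lemma pairing_rows (w : 'rV[R]_5) d (M : 'M[R]_(d, 5)) v :
  (forall i, pairing w (row i M) = 0) -> (v <= M)%MS -> pairing w v = 0.
Proof.
move=> H /submxP [c ->]; rewrite /pairing -mulmxA.
rewrite (_ : M *m w^T = 0) ?mulmx0 ?mxE //; apply/row_matrixP => i.
by rewrite row_mul row0; apply/rowP => j; rewrite ord1 -[LHS]/(pairing _ _) H mxE.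
Qed.

(** If U_k annihilates D, then so does U_(k+1): for a section Y of D, both
    X(U_k(Y)) and U_k([X, Y]) vanish. *)
Lemma distribution_rank (W : set V) (P : plane_field R) (X : vfield R) m0 :
  open W -> W m0 -> smooth_distribution 2 W P ->
  (forall m, W m -> (P m <= contact m)%MS) -> involutive_field W P -> is_section W P X ->
  (\rank (type_matrix X m0) <= 3)%N.
Proof.
move=> oW Wm0 sP Pc iP [sX XP].
have [N [Y [oN Nm0 NW sY PY]]] := sP m0 Wm0.
have CX : Cinf N X by move=> k; exact: Ck_sub NW (smooth_Cinf oW sX k).
have CY i : Cinf N (Y i) by exact: smooth_Cinf.
have secX : is_section N P X by split; [exact: Cinf_smooth|move=> m /NW; exact: XP].
have YP m i : N m -> (Y i m <= P m)%MS.
  move=> /PY [/eqmxP E _]; rewrite E.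
  by have := row_sub i (\matrix_i Y i m); rewrite rowK.
have secY i : is_section N P (Y i) by split => // m; exact: YP.
apply: (annihilated_rank (m := m0) (P := P m0)); first by have [] := PY m0 Nm0.
suff H k m : N m -> forall v, (v <= P m)%MS -> pairing (iterated_lie X k m) v = 0 by move=> k; exact: H.
elim: k m => [|k IH] m Nm v vP.
  by apply/contactP; apply: submx_trans vP _; apply: Pc; exact: NW.
have [/eqmxP E _] := PY m Nm; rewrite E in vP; apply: pairing_rows vP => i; rewrite rowK.
have CL := Cinf_iterated_lie oN CX k.
have brP : (bracket X (Y i) m <= P m)%MS by have [_] := iP N X (Y i) oN NW secX (secY i); apply.
have := cartan CX (CY i) CL Nm; rewrite (IH m Nm _ brP) addr0 => <-.
by apply: (diff0_near oN) => // y Ny; apply: IH => //; exact: YP.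
Qed.

(** The smooth span of U, df and dg contains U_1 and is stable under the Lie
    derivative along X, because X(df) = X(dg) = 0. *)
Lemma span_rank (W : set V) (f g a b : func R) (X : vfield R) m0 :
  open W -> W m0 -> Cinf W X -> (forall m, W m -> pairing (U m) (X m) = 0) ->
  Cinf W f -> Cinf W g -> Cinf W a -> Cinf W b -> in_involution W f g ->
  (forall m, W m -> X m = a m *: charField f m + b m *: charField g m) ->
  (\rank (type_matrix X m0) <= 3)%N.
Proof.
move=> oW Wm0 CX cX Cf Cg Ca Cb inv EX.
have gXf := (first_integralP (charField f) Cg).1 inv.
have fXg m : W m -> pairing (differential f m) (charField g m) = 0.
  by move=> Wm; rewrite pairing_charField_sym (gXf m Wm) oppr0.
have Xf m : W m -> pairing (differential f m) (X m) = 0.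
  by move=> Wm; rewrite (EX m Wm) pairing_comb (pairing_charField_self f m) (fXg m Wm) !mulr0 addr0.
have Xg m : W m -> pairing (differential g m) (X m) = 0.
  by move=> Wm; rewrite (EX m Wm) pairing_comb (pairing_charField_self g m) (gXf m Wm) !mulr0 addr0.
pose span (w : oneform R) := exists al be ga : func R, [/\ Cinf W al, Cinf W be, Cinf W ga &
  forall m, W m -> w m = al m *: U m + be m *: differential f m + ga m *: differential g m].
have CU := Cinf_U oW; have Cdf := Cinf_differential oW Cf; have Cdg := Cinf_differential oW Cg.
(* The coefficient of U in U_1; those of df and dg are a and b. *)
pose la : func R := fun m => - (a m * pairing (differential f m) (unitv R iz) + b m * pairing (differential g m) (unitv R iz)).
have Cla : Cinf W la.
  move=> k; have Ce := Ck_cst k (unitv R iz) oW.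
  have C1 := CkZ oW (Ca k) (Ck_pairing oW (Cdf k) Ce).
  have C2 := CkZ oW (Cb k) (Ck_pairing oW (Cdg k) Ce).
  have C3 := CkB oW (@Ck_cst R k V R^o W 0 oW) (CkD oW C1 C2).
  by apply: (Ck_ext oW _ C3) => m _; rewrite /la sub0r.
have LU m : W m -> lie X (@U R) m = la m *: U m + a m *: differential f m + b m *: differential g m.
  move=> Wm; apply: pairing_ext => v; rewrite (lie_U oW CX cX v Wm) !pairingDl !pairingZl (EX m Wm).
  have Ex u w c d : extd (@U R) m (c *: u + d *: w) v = c * extd (@U R) m u v + d * extd (@U R) m w v.
    by rewrite !extd_U !mxE; ring.
  rewrite Ex (extd_charField f m v) (extd_charField g m v) /la.
  move: (pairing (differential f m) v) (pairing (differential g m) v) (pairing (U m) v) => A1 A2 A3.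
  move: (pairing (differential f m) _) (pairing (differential g m) _) => A4 A5; ring.
have spanL k : span (iterated_lie X k).
  elim: k => [|k [al [be [ga [Cal Cbe Cga E]]]]].
    exists (fun _ => 1), (fun _ => 0), (fun _ => 0); split; try by move=> k; exact: Ck_cst.
    by move=> m _; rewrite scale1r !scale0r !addr0.
  pose d (h : func R) : func R := fun m => pairing (differential h m) (X m).
  have Cd h : Cinf W h -> Cinf W (d h).
    by move=> Ch k'; exact: (Ck_pairing oW (Cinf_differential oW Ch k') (CX k')).
  exists (fun m => d al m + al m * la m), (fun m => d be m + al m * a m), (fun m => d ga m + al m * b m).
  split.
  - by move=> k'; exact: (CkD oW (Cd _ Cal k') (CkZ oW (Cal k') (Cla k'))).
  - by move=> k'; exact: (CkD oW (Cd _ Cbe k') (CkZ oW (Cal k') (Ca k'))).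
  - by move=> k'; exact: (CkD oW (Cd _ Cga k') (CkZ oW (Cal k') (Cb k'))).
  move=> m Wm; rewrite -[LHS]/(lie X (iterated_lie X k) m).
  rewrite (lie_ext oW X Wm E).
  have C1 : Cinf W (fun m => al m *: U m) by move=> k'; exact: (CkZ oW (Cal k') (CU k')).
  have C2 : Cinf W (fun m => be m *: differential f m) by move=> k'; exact: (CkZ oW (Cbe k') (Cdf k')).
  have C3 : Cinf W (fun m => ga m *: differential g m) by move=> k'; exact: (CkZ oW (Cga k') (Cdg k')).
  have C12 : Cinf W (fun m => al m *: U m + be m *: differential f m) by move=> k'; exact: (CkD oW (C1 k') (C2 k')).
  rewrite (lieD oW CX C12 C3 Wm) (lieD oW CX C1 C2 Wm).
  rewrite (lieZ oW CX CU Cal Wm) (lieZ oW CX Cdf Cbe Wm) (lieZ oW CX Cdg Cga Wm).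
  rewrite (lie_differential oW CX Cf Wm Xf) (lie_differential oW CX Cg Wm Xg) (LU m Wm) !scaler0 !add0r.
  rewrite -/(d al m) -/(d be m) -/(d ga m).
  move: (U m) (differential f m) (differential g m) (d al m) (d be m) (d ga m) (al m) (la m) (a m) (b m) => u1 u2 u3 a1 a2 a3 a4 a5 a6 a7.
  by apply/rowP => j; rewrite !mxE; ring.
pose B := col_mx (col_mx (U m0) (differential f m0)) (differential g m0).
apply: leq_trans (rank_leq_row B); apply: mxrankS; apply/row_subP => i.
have [al [be [ga [_ _ _ E]]]] := spanL i.
rewrite row_type_matrix E //.
have sB : (col_mx (U m0) (differential f m0) <= B)%MS by have := submx_refl B; rewrite {1}/B col_mx_sub => /andP[].
have Bg : (differential g m0 <= B)%MS by have := submx_refl B; rewrite {1}/B col_mx_sub => /andP[].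
move: (sB); rewrite col_mx_sub => /andP[BU Bf].
by rewrite !addmx_sub // scalemx_sub.
Qed.

(** The common kernel of df, dg and U is a plane. It contains X by hypothesis
    and X_f, X_g by involution; these two are independent because contraction
    with dU turns a relation between them into one between df, dg and U. The
    Gram formula makes the coefficients smooth. *)
Lemma first_integrals_decomposition (W : set V) (f g : func R) (X : vfield R) :
  open W -> Cinf W X -> (forall m, W m -> pairing (U m) (X m) = 0) ->
  Cinf W f -> Cinf W g -> first_integral W X f -> first_integral W X g ->
  independent_functions W f g -> in_involution W f g ->
  exists a b : func R, [/\ Cinf W a, Cinf W b &
    forall m, W m -> X m = a m *: charField f m + b m *: charField g m].
Proof.
move=> oW CX cX Cf Cg /(first_integralP X Cf) Xf /(first_integralP X Cg) Xg ind inv.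
pose M m := col_mx (charField f m) (charField g m).
have gXf := (first_integralP (charField f) Cg).1 inv.
have fXg m : W m -> pairing (differential f m) (charField g m) = 0.
  by move=> Wm; rewrite pairing_charField_sym (gXf m Wm) oppr0.
have CM : Cinf W M.
  by move=> k; exact: (Ck_col_mx oW (Cinf_charField oW Cf k) (Cinf_charField oW Cg k)).
pose D m := col_mx (col_mx (differential f m) (differential g m)) (U m).
have fM m : W m -> row_free (M m).
  move=> Wm; apply: inj_row_free => v; rewrite -[v]hsubmxK mul_row_col.
  rewrite (mx11_scalar (lsubmx v)) (mx11_scalar (rsubmx v)) !mul_scalar_mx.
  set al := lsubmx v 0 0; set be := rsubmx v 0 0 => H.
  (* The multiplier of U produced by the contraction with dU. *)
  pose mu := - (al * pairing (differential f m) (unitv R iz) + be * pairing (differential g m) (unitv R iz)).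
  have : row_mx (row_mx al%:M be%:M) mu%:M *m D m = 0.
    rewrite /D !mul_row_col !mul_scalar_mx; apply: pairing_ext => u.
    rewrite pairing0l !pairingDl !pairingZl.
    have Ex v1 v2 c d : extd (@U R) m (c *: v1 + d *: v2) u = c * extd (@U R) m v1 u + d * extd (@U R) m v2 u.
      by rewrite !extd_U !mxE; ring.
    have := Ex (charField f m) (charField g m) al be.
    rewrite H !extd_charField extd_U !mxE => E.
    rewrite !mul0r subrr addr0 in E; rewrite [RHS]E /mu; clear.
    move: (pairing (differential f m) u) (pairing (differential g m) u) (pairing (U m) u) => A1 A2 A3.
    move: (pairing (differential f m) _) (pairing (differential g m) _) => A4 A5; ring.
  move=> HD; have := ind m Wm; rewrite -/(D m) => /row_free_inj HI.
  have : row_mx (row_mx al%:M be%:M) mu%:M = 0 :> 'rV[R]_(1 + 1 + 1) by apply: HI; rewrite HD mul0mx.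
  move=> /eqP; rewrite -row_mx0 => /eqP /eq_row_mx [/eqP + _]; rewrite -row_mx0 => /eqP /eq_row_mx [-> ->].
  by rewrite row_mx0.
have pm (w v : 'rV[R]_5) : pairing w v = 0 -> v *m w^T = 0.
  by move=> H; apply/matrixP => i j; rewrite !ord1 [RHS]mxE.
have kerD m v : pairing (differential f m) v = 0 -> pairing (differential g m) v = 0 ->
    pairing (U m) v = 0 -> (v <= kermx (D m)^T)%MS.
  move=> /pm E1 /pm E2 /pm E3.
  by rewrite sub_kermx /D !tr_col_mx !mul_mx_row E1 E2 E3 !row_mx0.
have XM m : W m -> (X m <= M m)%MS.
  move=> Wm.
  have MK : (M m <= kermx (D m)^T)%MS.
    rewrite col_mx_sub; apply/andP; split; apply: kerD.
    - exact: (pairing_charField_self f m).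
    - exact: (gXf m Wm).
    - exact: (charField_contact f m).
    - exact: (fXg m Wm).
    - exact: (pairing_charField_self g m).
    - exact: (charField_contact g m).
  have XK := kerD m _ (Xf m Wm) (Xg m Wm) (cX m Wm).
  have rK : \rank (kermx (D m)^T) = 2%N.
    rewrite mxrank_ker mxrank_tr; have := ind m Wm; rewrite -/(D m) /row_free => /eqP ->.
    by [].
  have rM : \rank (M m) = 2%N by exact/eqP/fM.
  have [_] := mxrank_leqif_sup MK; rewrite rM rK eqxx => /esym H.
  exact: submx_trans XK H.
pose c m := X m *m (M m)^T *m invmx (M m *m (M m)^T).
have Cc : Cinf W c.
  move=> k; have CMT := Ck_trmx oW (CM k).
  have uM m : W m -> M m *m (M m)^T \in unitmx by move=> Wm; apply: gram_unit; exact: fM.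
  exact: (Ck_mulmx oW (Ck_mulmx oW (CX k) CMT) (Ck_invmx oW uM (Ck_mulmx oW (CM k) CMT))).
exists (fun m => c m 0 (lshift 1 0)), (fun m => c m 0 (rshift 1 0)); split.
- by move=> k; exact: (Ck_coord _ _ oW (Cc k)).
- by move=> k; exact: (Ck_coord _ _ oW (Cc k)).
move=> m Wm; rewrite [LHS](gram_coords (fM m Wm) (XM m Wm)) -/(c m).
rewrite -[c m in LHS]hsubmxK /M mul_row_col.
by rewrite (mx11_scalar (lsubmx _)) (mx11_scalar (rsubmx _)) !mul_scalar_mx !mxE.
Qed.

End TowardsType.

Section Rows.
Context {R : realType}.

Lemma is_diff_row (W : normedModType R) n (f df : 'I_n -> W -> R^o) x :
  (forall j, is_diff x (f j) (df j)) ->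
  is_diff x (fun y => \row_j f j y) (fun h => \row_j df j h).
Proof.
move=> H.
have -> : (fun y => \row_j f j y) = fun y => \sum_j (f j y *: (delta_mx 0 j : 'rV[R]_n)).
  by apply/funext => y; rewrite [LHS]row_sum_delta; apply: eq_bigr => j _; rewrite mxE.
have -> : (fun y => \row_j df j y) = fun y => \sum_j (f j x *: 0 + df j y *: (delta_mx 0 j : 'rV[R]_n)).
  apply/funext => y; rewrite [LHS]row_sum_delta; apply: eq_bigr => j _.
  by rewrite mxE scaler0 add0r.
apply: is_diff_sum => j; exact: (is_diff_scale (H j) (is_diff_cst _ x)).
Qed.

Lemma mx_coord_le p q (M : 'M[R]_(p, q)) i j : `|M i j| <= `|M|.
Proof. by rewrite [leRHS]/Num.Def.normr /= mx_normrE; exact: (le_bigmax _ _ (i, j)). Qed.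

Lemma mx_norm_le p q (M : 'M[R]_(p, q)) (c : R) : 0 <= c -> (forall i j, `|M i j| <= c) -> `|M| <= c.
Proof.
by move=> c0 H; rewrite [leLHS]/Num.Def.normr /= mx_normrE bigmax_le // => -[i j] _; exact: H.
Qed.

End Rows.

(** * Fields of constant type at most three *)

Section ConstantType.
Context {R : realType}.
Notation V := (jet R).
Variables (Om : set V) (oOm : open Om) (X : vfield R) (m0 : V).
Hypotheses (CX : Cinf Om X) (contX : forall m, Om m -> pairing (U m) (X m) = 0).
Hypotheses (X0 : forall m, Om m -> X m != 0) (Omm0 : Om m0).
Variable (r : nat) (type_r : forall m, Om m -> \rank (type_matrix X m) = r) (r3 : (r <= 3)%N).

Notation T := (type_matrix X).
Notation L := (iterated_lie X).

Let rk := \rank (T m0).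
(** Among the forms U_0, ..., U_3, a basis of their span at m0. By constancy of
    the rank it remains a basis of the span where its Gram determinant does not
    vanish. *)
Definition selected_rows m : 'M[R]_(rk, 5) := rowsub (maxrankfun (T m0)) (T m).
Notation B := selected_rows.
Definition selected_gram m := B m *m (B m)^T.
Definition gram_domain := [set m | Om m /\ \det (selected_gram m) != 0].
Notation O1 := gram_domain.

Lemma Cinf_type_matrix : Cinf Om T.
Proof.
move=> k; apply: Ck_mx => // i j.
apply: (Ck_ext oOm _ (Ck_coord 0 j oOm (Cinf_iterated_lie oOm CX i k))) => m _.
by rewrite [RHS]mxE.
Qed.

Lemma Cinf_selected_rows : Cinf Om B.
Proof.
move=> k; apply: Ck_mx => // i j.
apply: (Ck_ext oOm _ (Ck_coord (maxrankfun (T m0) i) j oOm (Cinf_type_matrix k))) => m _.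
by rewrite [RHS]mxE.
Qed.

Lemma Cinf_selected_gram : Cinf Om selected_gram.
Proof.
by move=> k; exact: (Ck_mulmx oOm (Cinf_selected_rows k) (Ck_trmx oOm (Cinf_selected_rows k))).
Qed.

Lemma open_gram_domain : open O1.
Proof.
apply: (open_preimage (A := [set t : R^o | t != 0]) (f := fun x => \det (selected_gram x) : R^o) oOm).
  exact: open_neq.
have C0 := Ck_det oOm (fun i j => Ck_coord i j oOm (Cinf_selected_gram 0)).
exact: C0.
Qed.

Lemma gram_domain_sub : O1 `<=` Om.
Proof. by move=> m []. Qed.

Lemma gram_domain_unit m : O1 m -> selected_gram m \in unitmx.
Proof. by move=> [_]; rewrite unitmxE unitfE. Qed.

Lemma gram_domain_m0 : O1 m0.
Proof.
split => //; rewrite -unitfE -unitmxE; apply: gram_unit.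
exact: maxrowsub_free.
Qed.

Lemma selected_rows_span m : O1 m -> (T m <= B m)%MS.
Proof.
move=> O1m; have uG := gram_domain_unit O1m.
have rB : \rank (B m) = rk.
  apply/eqP; rewrite eqn_leq rank_leq_row /=.
  by have := mxrankM_maxl (B m) (B m)^T; rewrite -/(selected_gram m) mxrank_unit.
have BT : (B m <= T m)%MS by exact: rowsub_sub.
have [_ <-] := mxrank_leqif_sup BT; apply/eqP.
exact: (etrans rB (etrans (type_r Omm0) (esym (type_r (gram_domain_sub O1m))))).
Qed.

(** Orthogonal projection onto the common kernel of U_0, ..., U_3: it extends a
    vector of that kernel to a smooth field with values in the kernels. *)
Definition ann_proj (v : 'rV[R]_5) m : 'rV[R]_5 :=
  v - v *m (B m)^T *m invmx (selected_gram m) *m B m.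

Lemma Cinf_ann_proj v : Cinf O1 (ann_proj v).
Proof.
move=> k; have o1 := open_gram_domain.
have CB := Ck_sub gram_domain_sub (Cinf_selected_rows k).
have CG := Ck_invmx o1 gram_domain_unit (Ck_sub gram_domain_sub (Cinf_selected_gram k)).
have Cv := Ck_cst k v o1.
exact: (CkB o1 Cv (Ck_mulmx o1 (Ck_mulmx o1 (Ck_mulmx o1 Cv (Ck_trmx o1 CB)) CG) CB)).
Qed.

Lemma pairing_type_matrix m v : (forall k, (k < 4)%N -> pairing (L k m) v = 0) <-> v *m (T m)^T = 0.
Proof.
split=> [H|H k k4].
  apply/rowP => j; rewrite !mxE; have := H j (ltn_ord j).
  rewrite pairingE => E; rewrite -[RHS]E; apply: eq_bigr => i _.
  by rewrite !mxE.
have := congr1 (fun M : 'rV_4 => M 0 (Ordinal k4)) H; rewrite !mxE => <-.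
by rewrite pairingE; apply: eq_bigr => i _; rewrite !mxE.
Qed.

Lemma ann_proj_ann v m k : O1 m -> (k < 4)%N -> pairing (L k m) (ann_proj v m) = 0.
Proof.
move=> O1m; move: k; apply/pairing_type_matrix.
have /submxP [c ->] := selected_rows_span O1m.
rewrite trmx_mul mulmxA (_ : ann_proj v m *m _ = 0) ?mul0mx //.
rewrite /ann_proj mulmxBl -[_ *m B m *m (B m)^T]mulmxA -/(selected_gram m) mulmxKV ?subrr //.
exact: gram_domain_unit.
Qed.

Lemma ann_proj_id v m : O1 m -> (forall k, (k < 4)%N -> pairing (L k m) v = 0) -> ann_proj v m = v.
Proof.
move=> O1m /pairing_type_matrix H.
have HB : v *m (B m)^T = 0.
  have /submxP [c ->] : (B m <= T m)%MS by exact: rowsub_sub.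
  by rewrite trmx_mul mulmxA H mul0mx.
by rewrite /ann_proj HB !mul0mx subr0.
Qed.

Lemma cartan0 A Y w m : open A -> A `<=` Om -> Cinf A Y -> Cinf A w -> A m ->
  (forall m, A m -> pairing (w m) (Y m) = 0) ->
  pairing (lie X w m) (Y m) = - pairing (w m) (bracket X Y m).
Proof.
move=> oA AO CY Cw Am H.
have CX' : Cinf A X by move=> k; exact: Ck_sub AO (CX k).
have E := etrans (esym (cartan CX' CY Cw Am)) (diff0_near oA (X m) Am H).
by apply/eqP; rewrite -addr_eq0; apply/eqP.
Qed.

(** Extend v to a field Y killed by U_0, ..., U_3, and put Z = [X, Y],
    Z' = [X, Z]. Cartan's formula shows that U_0, U_1, U_2 kill Z, that U_0, U_1
    kill Z', and that U_4(Y) = - U_3(Z) and U_3(Z) = - U_2(Z'). If U_2 is in the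
    span of U_0 and U_1, it kills Z'. Otherwise U_0, U_1, U_2 are independent,
    so by the rank bound U_3 is in their span and kills Z. In both cases
    U_4(Y) = 0. *)
Lemma fourth_derivative_ann m v : O1 m -> (forall k, (k < 4)%N -> pairing (L k m) v = 0) ->
  pairing (L 4 m) v = 0.
Proof.
move=> O1m Hv.
have o1 := open_gram_domain; have O1O := gram_domain_sub.
pose Y := ann_proj v.
have Ym : Y m = v by exact: ann_proj_id.
have CY : Cinf O1 Y by exact: Cinf_ann_proj.
have CX1 : Cinf O1 X by move=> k; exact: Ck_sub O1O (CX k).
have CL k : Cinf O1 (L k) by exact: Cinf_iterated_lie.
pose Z := bracket X Y; pose Z' := bracket X Z.
have CZ : Cinf O1 Z by exact: Cinf_bracket.
have HY k m' : (k < 4)%N -> O1 m' -> pairing (L k m') (Y m') = 0.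
  by move=> k4 O1m'; exact: ann_proj_ann.
have step k m' : (k < 4)%N -> O1 m' -> pairing (L k.+1 m') (Y m') = - pairing (L k m') (Z m').
  move=> k4 O1m'; apply: (cartan0 o1 O1O CY (CL k) O1m') => m2 O1m2; exact: HY.
have HZ k m' : (k < 3)%N -> O1 m' -> pairing (L k m') (Z m') = 0.
  move=> k3 O1m'; apply/eqP; rewrite -oppr_eq0 -step ?HY //; exact: ltnW.
have step' k m' : (k < 3)%N -> O1 m' -> pairing (L k.+1 m') (Z m') = - pairing (L k m') (Z' m').
  move=> k4 O1m'; apply: (cartan0 o1 O1O CZ (CL k) O1m') => m2 O1m2; exact: HZ.
have HZ' k : (k < 2)%N -> pairing (L k m) (Z' m) = 0.
  move=> k2; apply/eqP; rewrite -oppr_eq0 -step' ?HZ //; exact: ltnW.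
have E : pairing (L 4 m) v = - pairing (L 3 m) (Z m) by rewrite -{1}Ym; exact: step.
rewrite E; apply/eqP; rewrite oppr_eq0; apply/eqP.
pose B2 := col_mx (L 0 m) (L 1 m).
have TL k (k4 : (k < 4)%N) : (L k m <= T m)%MS.
  by have := row_sub (Ordinal k4) (T m); rewrite row_type_matrix.
(* Even in type 3, U_2 may depend on U_0 and U_1 at some points, so the cases
   are separated at m. *)
have [L2|L2] := boolP (L 2 m <= B2)%MS.
  have H2 : pairing (L 2 m) (Z' m) = 0.
    rewrite pairingC; apply: (pairing_rows (M := B2)) L2 => i.
    by case: (split_ordP i) => j ->; rewrite ?rowKu ?rowKd row_id pairingC HZ'.
  exact: (etrans (step' 2%N m isT O1m) (etrans (congr1 (fun z : R => - z) H2) (oppr0 R))).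
pose B3 := col_mx B2 (L 2 m).
have rB2 : (2 <= \rank B2)%N.
  suff /eqP -> : row_free B2 by [].
  have Om_m := O1O m O1m.
  exact: (U_lieU_row_free oOm CX contX Om_m (X0 Om_m)).
(* Here U_0, U_1, U_2 already have rank 3, hence span all of T. *)
have lt23 : (B2 < B3)%MS.
  rewrite ltmxE; apply/andP; split.
    by have := submx_refl B3; rewrite {1}/B3 col_mx_sub => /andP[].
  by apply: contra L2 => H; move: H; rewrite col_mx_sub => /andP[].
have r23 : (\rank B2 < \rank B3)%N by move: lt23; rewrite ltmxErank => /andP[].
have B3T : (B3 <= T m)%MS by rewrite !col_mx_sub !TL.
have TB3 : (T m <= B3)%MS.
  have [rle] := mxrank_leqif_sup B3T; move=> <-.
  rewrite eqn_leq rle /= type_r; last exact: O1O.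
  apply: leq_trans r3 _; exact: leq_ltn_trans rB2 r23.
rewrite pairingC; apply: (pairing_rows (M := B3)); last exact: (submx_trans (TL 3%N isT) TB3).
move=> i; case: (split_ordP i) => j ->; rewrite ?rowKu ?rowKd.
  by case: (split_ordP j) => j' ->; rewrite ?rowKu ?rowKd row_id pairingC HZ.
by rewrite row_id pairingC HZ.
Qed.

(** Its vanishing is the condition on tangent vectors that the flow of X
    transports. *)
Definition type_values m (w : 'rV[R]_5) : 'rV[R]_4 := \row_(k < 4) pairing (L k m) w.

(** A form that vanishes on the common kernel of others is in their span. *)
Lemma fourth_derivative_span m : O1 m -> (L 4 m <= B m)%MS.
Proof.
move=> O1m; rewrite submxE; apply/eqP/rowP => j; rewrite [RHS]mxE.
have H : pairing (L 4 m) (row j (cokermx (B m))^T) = 0.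
  apply: fourth_derivative_ann => //; apply/pairing_type_matrix.
  have /submxP [c ->] := selected_rows_span O1m.
  have E : (cokermx (B m))^T *m (B m)^T = 0 by rewrite -trmx_mul mulmx_coker trmx0.
  by rewrite [(c *m _)^T]trmx_mul mulmxA -row_mul E row0 mul0mx.
by rewrite -[RHS]H pairingE mxE; apply: eq_bigr => i _; rewrite !mxE mulrC.
Qed.

(** U_4 is a combination of the selected rows with continuous, hence locally
    bounded, coefficients. *)
Lemma fourth_derivative_bound : exists (O2 : set V) (M : R),
  [/\ open O2, O2 m0, O2 `<=` O1, 0 <= M &
    forall m w, O2 m -> `|pairing (L 4 m) w| <= M * `|type_values m w|].
Proof.
have o1 := open_gram_domain; have O1O := gram_domain_sub.
pose c m := L 4 m *m (B m)^T *m invmx (selected_gram m).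
have CB := Ck_sub O1O (Cinf_selected_rows 0).
have CG := Ck_invmx o1 gram_domain_unit (Ck_sub O1O (Cinf_selected_gram 0)).
have CL := Ck_sub O1O (Cinf_iterated_lie oOm CX 4 0).
have Cc := Ck_mulmx o1 (Ck_mulmx o1 CL (Ck_trmx o1 CB)) CG.
have O1m0 := gram_domain_m0.
have cc : {for m0, continuous c} by exact: Cc.
have /cvgrPdist_lt /(_ 1 ltr01) nc := cc.
(* Near m0 the coefficients of U_4 are bounded by |c(m0)| + 1. *)
have /nbhs_ballP [d /= d0 Hd] : nbhs m0 [set m | O1 m /\ `|c m0 - c m| < 1].
  by apply: filterI => //; exact: open_nbhs_nbhs.
exists (ball m0 d), (rk%:R * (`|c m0| + 1)); split.
- exact: ball_open.
- exact: ballxx.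
- by move=> m /Hd[].
- by rewrite mulr_ge0 // addr_ge0.
move=> m w /Hd [om1 cm].
have Ec : L 4 m = c m *m B m.
  have /submxP [e E] := fourth_derivative_span om1.
  by rewrite /c E -[e *m _ *m _]mulmxA -/(selected_gram m) mulmxK // gram_domain_unit.
have cn : `|c m| <= `|c m0| + 1.
  rewrite -[c m](subrK (c m0)) addrC; apply: le_trans (ler_normD _ _) _.
  by rewrite lerD2l distrC ltW.
have -> : pairing (L 4 m) w = \sum_i c m 0 i * pairing (row i (B m)) w.
  rewrite Ec mulmx_sum_row.
  elim/big_rec2 : _ => [|i y1 y2 _ <-]; first exact: pairing0l.
  by rewrite pairingDl pairingZl.
apply: le_trans (ler_norm_sum _ _ _) _.
have -> : rk%:R * (`|c m0| + 1) * `|type_values m w| = \sum_(i < rk) (`|c m0| + 1) * `|type_values m w|.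
  by rewrite sumr_const card_ord -[RHS]mulr_natl -mulrA.
apply: ler_sum => i _; rewrite normrM; apply: ler_pM => //.
  by apply: le_trans (mx_coord_le _ _ _) cn.
have -> : pairing (row i (B m)) w = type_values m w 0 (maxrankfun (T m0) i).
  by rewrite mxE; congr (pairing _ _); apply/rowP => j; rewrite !mxE.
exact: mx_coord_le.
Qed.

(** The common kernel of U_0, ..., U_3 has dimension at least 2, so it is not
    contained in the line of X. *)
Lemma ann_complement : exists v, (forall k, (k < 4)%N -> pairing (L k m0) v = 0) /\
  row_free (col_mx (X m0) v).
Proof.
have rX : \rank (X m0) = 1%N.
  by apply/eqP; rewrite eqn_leq rank_leq_row lt0n mxrank_eq0; exact: X0.
have : ~~ (kermx (T m0)^T <= X m0)%MS.
  apply/negP => /mxrankS; rewrite rX mxrank_ker mxrank_tr type_r //.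
  by case: (r) r3 => [|[|[|[|]]]].
move=> /row_subPn [i]; set v := row i _ => vX; exists v; split.
  apply/pairing_type_matrix.
  by apply/eqP; rewrite -sub_kermx; exact: row_sub.
rewrite /row_free; have lt : (X m0 < col_mx (X m0) v)%MS.
  rewrite ltmxE; apply/andP; split.
    by have := submx_refl (col_mx (X m0) v); rewrite col_mx_sub => /andP[].
  by apply: contra vX; rewrite col_mx_sub => /andP[].
by move: lt; rewrite ltmxErank rX eqn_leq rank_leq_row => /andP[_ ->].
Qed.

End ConstantType.

Section Integrals.
Context {R : realType}.
Notation V := (jet R).
Variables (Om : set V) (oOm : open Om) (X : vfield R) (m0 : V).
Hypotheses (CX : Cinf Om X) (contX : forall m, Om m -> pairing (U m) (X m) = 0).
Notation L := (iterated_lie X).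
Notation E := (fun p : V * V => type_values X p.1 p.2).

Lemma Ck_type_values k (A : set V) : open A -> A `<=` Om -> Ck k [set p : V * V | A p.1] E.
Proof.
move=> oA AO; have oA' := @open_fst R V V _ oA.
apply: Ck_mx => // i j.
have CL := Ck_fst V oA (Ck_sub AO (Cinf_iterated_lie oOm CX j k)).
have Cs : Ck k [set p : V * V | A p.1] snd by apply: Ck_lin; exact: snd_continuous.
by apply: (Ck_ext oA' _ (Ck_pairing oA' CL Cs)) => p _; rewrite [RHS]mxE.
Qed.

(** Along the tangent lift of X the derivative of U_k is U_(k+1): this is the
    meaning of the Lie derivative. *)
Lemma diff_type_values x w : Om x ->
  'd E (x, w) (X x, 'd X x w) = \row_(k < 4) pairing (L k.+1 x) w.
Proof.
move=> Ox.
have H : is_diff (x, w) E (fun h => \row_(k < 4) (pairing ('d (L k) x h.1) w + pairing (L k x) h.2 : R^o)).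
  apply: is_diff_row => k.
  have dL := differentiableP (Cinf_diff (Cinf_iterated_lie oOm CX k) Ox).
  exact: (is_diff_pairing (is_diff_compose (is_diff_fst (x, w)) dL) (is_diff_snd (x, w))).
apply: etrans (is_diffE1 H _) _; apply/rowP => k; rewrite !mxE.
exact: esym (lie_pairing w CX (Cinf_iterated_lie oOm CX k) Ox).
Qed.

(** The derivatives of U_0, U_1, U_2 are among the values themselves, and that
    of U_3 is U_4, which is bounded by them. *)
Lemma type_values_growth (O2 : set V) (M : R) : O2 `<=` Om -> 0 <= M ->
  (forall m w, O2 m -> `|pairing (L 4 m) w| <= M * `|type_values X m w|) ->
  forall x w, O2 x -> `|'d E (x, w) (X x, 'd X x w)| <= (1 + M) * `|type_values X x w|.
Proof.
move=> O2O M0 HM x w O2x; rewrite (diff_type_values w (O2O _ O2x)).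
apply: mx_norm_le => [|i j]; first by rewrite mulr_ge0 // addr_ge0.
rewrite mxE mulrDl mul1r; have [j3|j3] := ltnP j 3.
  have -> : pairing (L j.+1 x) w = type_values X x w 0 (Ordinal (j3 : (j.+1 < 4)%N)) by rewrite mxE.
  by apply: le_trans (mx_coord_le _ _ _) _; rewrite lerDl mulr_ge0.
have -> : nat_of_ord j = 3%N by apply/eqP; rewrite eqn_leq j3 -ltnS ltn_ord.
by apply: le_trans (HM x w O2x) _; rewrite lerDr.
Qed.

End Integrals.

Section LinearAlgebra.
Context {R : realType}.

Lemma complete_basis (u v : 'rV[R]_5) : row_free (col_mx u v) ->
  exists D : 'M[R]_5, [/\ D \in unitmx, row ix D = u & row iy D = v].
Proof.
move=> fP; pose P := col_mx u v; pose f : 'M[R]_5 := col_mx P (0 : 'M[R]_(3, 5)).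
pose I2 : 'M[R]_(2, 5) := pid_mx 2.
have Ef : I2 *m f = P.
  have -> : I2 = row_mx 1%:M (0 : 'M[R]_(2, 3)) by exact: (@pid_mx_row R 3 2).
  by rewrite /f (mul_row_col 1%:M (0 : 'M[R]_(2, 3)) P (0 : 'M[R]_(3, 5))) mul1mx mulmx0 addr0.
have rP : \rank (I2 *m f) = \rank I2.
  by rewrite Ef [RHS]rank_pid_mx //; apply/eqP; exact: fP.
have [D uD] := complete_unitmx rP; rewrite Ef => ED.
pose i0 : 'I_(1 + 1) := lshift 1 0; pose i1 : 'I_(1 + 1) := rshift 1 0.
have r0 : row i0 I2 = delta_mx 0 ix by apply/rowP; apply: Defs.ord5P; rewrite !mxE.
have r1 : row i1 I2 = delta_mx 0 iy by apply/rowP; apply: Defs.ord5P; rewrite !mxE.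
exists D; split => //.
  by rewrite rowE -r0 -row_mul -ED rowKu row_id.
by rewrite rowE -r1 -row_mul -ED rowKd row_id.
Qed.

Lemma mulmx_rows (v : 'rV[R]_5) (D : 'M[R]_5) :
  v *m D = v 0 ix *: row ix D + v 0 iy *: row iy D + v *m (\matrix_k (if (k < 2)%N then 0 else row k D)).
Proof.
apply/rowP => j; rewrite !mxE !sum5 !mxE /=; ring.
Qed.

End LinearAlgebra.

Section ThreeIntegrals.
Context {R : realType}.
Notation V := (jet R).
Variables (Om : set V) (oOm : open Om) (X Y : vfield R) (m0 : V).
Hypotheses (CX : Cinf Om X) (CY : Cinf Om Y) (contX : forall m, Om m -> pairing (U m) (X m) = 0).
Hypotheses (Omm0 : Om m0) (free0 : row_free (col_mx (X m0) (Y m0))).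
Hypotheses (annY : forall m k, Om m -> (k < 4)%N -> pairing (iterated_lie X k m) (Y m) = 0).
Variable (M : R).
Hypotheses (M0 : 0 <= M)
  (growth : forall m w, Om m -> `|pairing (iterated_lie X 4 m) w| <= M * `|type_values X m w|).
Notation E := (fun p : V * V => type_values X p.1 p.2).

Lemma diff_at_zero_time (phi : V * R^o -> V) (N : set (V * R^o)) m w : open N -> Cinf N phi ->
  (forall x, phi (x, 0) = x) -> N (m, 0) -> 'd phi (m, 0) (w, 0) = w.
Proof.
move=> oN Cphi phi0 Nm.
have d1 := is_diff_pair (is_diff_id m) (is_diff_cst (0 : R^o) m).
have d2 := is_diff_compose d1 (differentiableP (Cinf_diff Cphi Nm)).
have d3 : is_diff m (fun y => phi (y, 0)) id.
  have -> : (fun y => phi (y, 0)) = id by apply/funext => y; exact: phi0.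
  exact: is_diff_id.
exact: etrans (esym (is_diffE1 d2 w)) (is_diffE1 d3 w).
Qed.

Lemma diff_time_split (W W' : normedModType R) (f : W * R^o -> W') p w (t : R^o) :
  'd f p (w, t) = 'd f p (w, 0) + t *: 'd f p (0, 1).
Proof.
have E1 : (w, t) = (w, 0) + t *: ((0, 1) : W * R^o).
  by congr (_, _); rewrite /= ?scaler0 ?addr0 // add0r; exact: esym (mulr1 _).
apply: etrans (congr1 ('d f p) E1) _.
by apply: etrans (linearD _ _ _) _; congr (_ + _); exact: linearZ.
Qed.

(** H(x) follows the flow of Y for a time x_1 and then that of X for a time
    x_0, from m0 + x_2 b_2 + x_3 b_3 + x_4 b_4, where the b_i complete X(m0) and
    Y(m0) to a basis. So the derivative in x_0 is X, and the derivative in x_1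
    is the image of Y under the derivative of the flow of X; U still kills the
    latter, because the vanishing of U_0, ..., U_3 is transported. *)
Lemma adapted_parametrization : exists (H : V -> V) (S : set V),
  [/\ open S, S 0, Cinf S H & H 0 = m0] /\
  [/\ forall x, S x -> Om (H x), forall v, 'd H 0 v = 0 -> v = 0,
      forall x, S x -> 'd H x (unitv R ix) = X (H x) &
      forall x, S x -> pairing (U (H x)) ('d H x (unitv R iy)) = 0].
Proof.
have pV : proper_space V by exact: proper_rV.
have [phi [N [[oN N0 Cphi phiO] [phi0 dphi tphi]]]] := flow_exists pV oOm CX Omm0.
have [psi [K [[oK K0 Cpsi psiO] [psi0 dpsi _]]]] := flow_exists pV oOm CY Omm0.
have [D [uD Dx Dy]] := complete_basis free0.
pose Q : 'M[R]_5 := \matrix_k (if (k < 2)%N then 0 else row k D).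
(* Q discards the coordinates x_0 and x_1, which serve as the times of the
   flows of X and of Y. *)
pose b (x : V) : V * R^o := (m0 + x *m Q, x 0 iy).
pose a x := psi (b x).
pose H x := phi (a x, x 0 ix).
have Cb k : Ck k setT b.
  have oT : open [set: V] by exact: openT.
  have Ci : Ck k setT (fun x : V => x) by exact: Ck_id.
  exact: (Ck_pair oT (CkD oT (Ck_cst k m0 oT) (Ck_mulmx oT Ci (Ck_cst k Q oT))) (Ck_coord 0 iy oT Ci)).
have db x : is_diff x b (fun v => (0 + v *m Q, v 0 iy)).
  have cl : continuous (mulmxr Q : V -> V).
    have Ci : Ck 0 setT (fun x : V => x) by exact: Ck_id.
    by move=> y; exact: (Ck_mulmx openT Ci (Ck_cst 0 Q openT) y I).
  have d1 := is_diff_add (is_diff_cst m0 x) (is_diff_lin x cl).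
  exact: (is_diff_pair d1 (is_diff_coord 0 iy (is_diff_id x))).
pose S1 := [set x : V | K (b x)].
have oS1 : open S1 by apply: (@open_comp _ _ b) => // x _; exact: (Cb 0%N x I).
have Ca k : Ck k S1 a by exact: (Ck_comp oS1 oK (fun x Sx => Sx) (Ck_sub (@subsetT _ S1) (Cb k)) (Cpsi k)).
have Cax k : Ck k S1 (fun x => (a x, x 0 ix : R^o)).
  by exact: (Ck_pair oS1 (Ca k) (Ck_coord 0 ix oS1 (Ck_id k S1))).
pose S := [set x : V | S1 x /\ N (a x, x 0 ix)].
have oS : open S by apply: (open_preimage oS1 oN) => x S1x; exact: (Cax 0%N x S1x).
have b0 : b 0 = (m0, 0) by rewrite /b mul0mx addr0 mxE.
have a0 : a 0 = m0 by rewrite /a b0 psi0.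
have S0 : S 0 by rewrite /S /S1 /= a0 b0 mxE.
have SS1 : S `<=` S1 by move=> x [].
have CH : Cinf S H.
  by move=> k; exact: (Ck_comp oS oN (fun x Sx => Sx.2) (Ck_sub SS1 (Cax k)) (Cphi k)).
have da x : S1 x -> is_diff x a (fun v => 'd psi (b x) (0 + v *m Q, v 0 iy)).
  by move=> S1x; exact: (is_diff_compose (db x) (differentiableP (Cinf_diff Cpsi S1x))).
have dH x : S x -> is_diff x H (fun v => 'd phi (a x, x 0 ix) ('d psi (b x) (0 + v *m Q, v 0 iy), v 0 ix)).
  move=> [S1x Nx].
  have d1 := is_diff_pair (da x S1x) (is_diff_coord 0 ix (is_diff_id x)).
  exact: (is_diff_compose d1 (differentiableP (Cinf_diff Cphi Nx))).
have exQ : unitv R ix *m Q = 0 by rewrite /unitv -rowE rowK.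
have eyQ : unitv R iy *m Q = 0 by rewrite /unitv -rowE rowK.
have uv i j : (unitv R i) 0 j = (j == i)%:R by rewrite mxE.
have dHx x : S x -> 'd H x (unitv R ix) = X (H x).
  move=> Sx; apply: etrans (is_diffE1 (dH x Sx) _) _.
  have e1 : (0 + unitv R ix *m Q, unitv R ix 0 iy : R^o) = 0 by rewrite exQ addr0 uv.
  have e2 : ('d psi (b x) (0 + unitv R ix *m Q, unitv R ix 0 iy), unitv R ix 0 ix : R^o) = (0, 1).
    by congr (_, _); [exact: etrans (congr1 ('d psi (b x)) e1) (linear0 _)|exact: uv].
  exact: etrans (congr1 ('d phi (a x, x 0 ix)) e2) (dphi _ Sx.2).
have dHy x : S x -> 'd H x (unitv R iy) = 'd phi (a x, x 0 ix) (Y (a x), 0).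
  move=> Sx; apply: etrans (is_diffE1 (dH x Sx) _) _.
  have e1 : (0 + unitv R iy *m Q, unitv R iy 0 iy : R^o) = (0, 1) by rewrite eyQ addr0 uv.
  have e2 : ('d psi (b x) (0 + unitv R iy *m Q, unitv R iy 0 iy), unitv R iy 0 ix : R^o) = (Y (a x), 0).
    by congr (_, _); [exact: etrans (congr1 ('d psi (b x)) e1) (dpsi _ (SS1 _ Sx))|exact: uv].
  exact: (congr1 ('d phi (a x, x 0 ix)) e2).
exists H, S; split; split => //.
- by rewrite /H a0 mxE phi0.
- by move=> x [_ Nx]; exact: phiO.
- move=> v Hv; have dH0 : 'd H 0 v = v *m D.
    apply: etrans (is_diffE1 (dH 0 S0) v) _.
    have E1 : 'd psi (b 0) (0 + v *m Q, v 0 iy) = v *m Q + v 0 iy *: Y m0.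
      apply: etrans (diff_time_split _ _ _ _) _; rewrite b0 add0r; congr (_ + _ *: _).
        exact: (diff_at_zero_time _ oK Cpsi psi0 K0).
      exact: etrans (dpsi _ K0) (congr1 Y (psi0 _)).
    have E2 : 'd phi (a 0, (0 : V) 0 ix) ('d psi (b 0) (0 + v *m Q, v 0 iy), v 0 ix) =
        (v *m Q + v 0 iy *: Y m0) + v 0 ix *: X m0.
      apply: etrans (diff_time_split _ _ _ _) _; rewrite a0 mxE; congr (_ + _ *: _).
        apply: etrans (congr1 (fun z => 'd phi (m0, 0) (z, 0)) E1) _.
        exact: (diff_at_zero_time _ oN Cphi phi0 N0).
      exact: etrans (dphi _ N0) (congr1 X (phi0 _)).
    apply: etrans E2 _; rewrite [v *m D]mulmx_rows Dx Dy -/Q.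
    by rewrite addrC [v *m Q + _]addrC addrA.
  have vD : v *m D = 0 by rewrite -dH0.
  by rewrite -(mulmxK uD v) vD mul0mx.
move=> x Sx; rewrite dHy //.
have CE : Ck 1 [set p : V * V | Om p.1] E by exact: (Ck_type_values oOm CX 1 oOm (@subset_refl _ Om)).
have gE := type_values_growth oOm CX (@subset_refl _ Om) M0 growth.
have E0 : E (a x, Y (a x)) = 0.
  apply/rowP => k; rewrite !mxE /=; apply: annY => //; exact: (psiO _ (SS1 _ Sx)).
have M1 : 0 <= 1 + M by rewrite addr_ge0.
have := tphi _ E (1 + M) M1 CE gE (a x) (x 0 ix) (Y (a x)) Sx.2 E0.
move=> /rowP /(_ 0); rewrite !mxE /=.
by [].
Qed.

End ThreeIntegrals.

(** * Contact charts *)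

Section ContactForms.
Context {R : realType}.
Notation V := (jet R).

Definition contact_form (x y z p q : func R) : oneform R := fun m =>
  differential z m - p m *: differential x m - q m *: differential y m.

Lemma pairing_leibniz (A B C D E b : 'rV[R]_5) (p s q t : R^o) :
  pairing (A - (p *: B + s *: C) - (q *: D + t *: E)) b =
  pairing A b - (p * pairing B b + s * pairing C b) - (q * pairing D b + t * pairing E b).
Proof. by rewrite !pairingDl !pairingNl !pairingDl !pairingZl. Qed.

Lemma pairing_combination (A B b : 'rV[R]_5) (p s : R^o) :
  pairing (p *: A + s *: B) b = p * pairing A b + s * pairing B b.
Proof. by rewrite !pairingDl !pairingZl. Qed.

Lemma factor_last (A B G : R) (dx dy dz : 'rV[R]_5) : G != 0 ->
  A *: dx + B *: dy + G *: dz = G *: (dz - (0 - G^-1 * A) *: dx - (0 - G^-1 * B) *: dy).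
Proof. by move=> G0; apply/rowP => j; rewrite !mxE; field. Qed.

Lemma annihilator_scale (w : 'rV[R]_5) (c : R) : c != 0 -> (annihilator (c *: w) == annihilator w)%MS.
Proof.
move=> c0; apply/andP; split; apply/rV_subP => v /annihilatorP H; apply/annihilatorP.
  by move: H; rewrite pairingZl => /eqP; rewrite mulf_eq0 (negbTE c0) => /eqP.
by rewrite pairingZl H mulr0.
Qed.

Section Chart.
Variables (W : set V) (oW : open W) (x y z p q g : func R).
Hypotheses (Cx : Cinf W x) (Cy : Cinf W y) (Cz : Cinf W z) (Cp : Cinf W p) (Cq : Cinf W q) (Cg : Cinf W g).
Notation theta := (contact_form x y z p q).

Lemma Cinf_contact_form : Cinf W theta.
Proof.
move=> k; have D h (Ch : Cinf W h) := Cinf_differential oW Ch k.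
exact: (CkB oW (CkB oW (D _ Cz) (CkZ oW (Cp k) (D _ Cx))) (CkZ oW (Cq k) (D _ Cy))).
Qed.

Lemma pairing_contact_form m v : pairing (theta m) v =
  pairing (differential z m) v - p m * pairing (differential x m) v - q m * pairing (differential y m) v.
Proof. by rewrite /contact_form !pairingDl !pairingNl !pairingZl. Qed.

Lemma ext_contact_form m u v : W m ->
  pairing ('d theta m u) v - pairing ('d theta m v) u =
  pairing (differential p m) v * pairing (differential x m) u - pairing (differential p m) u * pairing (differential x m) v
  + (pairing (differential q m) v * pairing (differential y m) u - pairing (differential q m) u * pairing (differential y m) v).
Proof.
move=> Wm.
have dD h (Ch : Cinf W h) := differentiableP (Cinf_diff (Cinf_differential oW Ch) Wm).
have df (h : func R) (Ch : Cinf W h) := differentiableP (Cinf_diff Ch Wm).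
have H := is_diff_sub (is_diff_sub (dD _ Cz) (is_diff_scale (df _ Cp) (dD _ Cx))) (is_diff_scale (df _ Cq) (dD _ Cy)).
have E a b : pairing ('d theta m a) b =
   pairing ('d (differential z) m a) b
   - (p m * pairing ('d (differential x) m a) b + pairing (differential p m) a * pairing (differential x m) b)
   - (q m * pairing ('d (differential y) m a) b + pairing (differential q m) a * pairing (differential y m) b).
  apply: etrans (congr1 (fun s => pairing s b) (is_diffE1 H a)) _.
  rewrite (differentialE a Cp Wm) (differentialE a Cq Wm).
  exact: pairing_leibniz.
have alg (A A' B B' C C' P Q s X s' X' t Y t' Y' : R) : A = A' -> B = B' -> C = C' ->
   (A - (P * B + s * X) - (Q * C + t * Y)) - (A' - (P * B' + s' * X') - (Q * C' + t' * Y')) =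
   s' * X' - s * X + (t' * Y' - t * Y) by move=> -> -> ->; ring.
apply: etrans (congr2 (fun a b : R => a - b) (E u v) (E v u)) _.
exact: (alg _ _ _ _ _ _ _ _ _ _ _ _ _ _ _ _ (hessian_sym oW u v Cz Wm) (hessian_sym oW u v Cx Wm) (hessian_sym oW u v Cy Wm)).
Qed.

Hypothesis (Ug : forall m, W m -> U m = g m *: theta m).

(** With theta = dz - p dx - q dy, this is
    dU = dg ^ theta + g (dx ^ dp + dy ^ dq). *)
Lemma extd_contact_form m u v : W m -> extd (@U R) m u v =
  pairing (differential g m) u * pairing (theta m) v - pairing (differential g m) v * pairing (theta m) u
  + g m * (pairing (differential p m) v * pairing (differential x m) u - pairing (differential p m) u * pairing (differential x m) v
  + (pairing (differential q m) v * pairing (differential y m) u - pairing (differential q m) u * pairing (differential y m) v)).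
Proof.
move=> Wm; rewrite -(ext_contact_form u v Wm).
have CU := Cinf_U oW.
have H : is_diff m (@U R) (fun s => g m *: 'd theta m s + 'd g m s *: theta m).
  have H1 := is_diff_scale (differentiableP (Cinf_diff Cg Wm)) (differentiableP (Cinf_diff Cinf_contact_form Wm)).
  apply: (near_eq_is_diff _ H1); move: (open_nbhs_nbhs (conj oW Wm)).
  by apply: filterS => s Ws; rewrite Ug.
have E a b : pairing ('D_a (@U R) m) b = g m * pairing ('d theta m a) b + pairing (differential g m) a * pairing (theta m) b.
  apply: etrans (congr1 (fun s => pairing s b) (etrans (derive_diff a CU Wm) (is_diffE1 H a))) _.
  rewrite (differentialE a Cg Wm).
  exact: pairing_combination.
have alg (G A B C D C' D' : R) : (G * A + C * D) - (G * B + C' * D') = C * D - C' * D' + G * (A - B) by ring.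
apply: etrans (congr2 (fun a b : R => a - b) (E u v) (E v u)) _.
exact: alg.
Qed.

End Chart.

(** Put p = - al / ga and q = - be / ga, so that U = ga (dz - p dx - q dy). A
    vector killed by the differentials of the five functions lies in the contact
    plane and in the radical of dU there, so it is zero; the inverse function
    theorem applies. *)
Lemma contact_chart_of_integrals (W : set V) (x y z al be ga : func R) m0 :
  open W -> W m0 -> Cinf W x -> Cinf W y -> Cinf W z -> Cinf W al -> Cinf W be -> Cinf W ga ->
  (forall m, W m -> U m = al m *: differential x m + be m *: differential y m + ga m *: differential z m) ->
  ga m0 != 0 ->
  exists (W' : set V) (phi psi : V -> V), [/\ W' m0, W' `<=` W, contact_chart W' phi psi &
    [/\ Defs.coord phi ix = x, Defs.coord phi iy = y & Defs.coord phi iz = z]].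
Proof.
move=> oW Wm0 Cx Cy Cz Cal Cbe Cga EU ga0.
(* The neighbourhood of m0 where division by the coefficient of dz is possible. *)
pose W1 := [set m | W m /\ ga m != 0].
have oW1 : open W1.
  apply: (open_preimage (A := [set t : R^o | t != 0]) (f := ga) oW); first exact: open_neq.
  by move=> m Wm; exact: (Cga 0%N m Wm).
have W1W : W1 `<=` W by move=> m [].
have sub (h : func R) : Cinf W h -> Cinf W1 h by move=> Ch k; exact: (Ck_sub W1W (Ch k)).
have Ci k := Ck_inv oW1 (fun m (H : W1 m) => H.2) (sub _ Cga k).
pose p : func R := fun m => 0 - (ga m)^-1 * al m; pose q : func R := fun m => 0 - (ga m)^-1 * be m.
have Cp : Cinf W1 p by move=> k; exact: (CkB oW1 (@Ck_cst R k V R^o W1 0 oW1) (CkZ oW1 (Ci k) (sub _ Cal k))).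
have Cq : Cinf W1 q by move=> k; exact: (CkB oW1 (@Ck_cst R k V R^o W1 0 oW1) (CkZ oW1 (Ci k) (sub _ Cbe k))).
have Ug m : W1 m -> U m = ga m *: contact_form x y z p q m.
  by move=> [Wm gm]; exact: (etrans (EU m Wm) (factor_last _ _ _ _ _ gm)).
pose F (i : 'I_5) : func R := fun m => nth 0 [:: x m; y m; z m; p m; q m] i.
have CF i : Cinf W1 (F i).
  have := Defs.ord5P (P := fun i => Cinf W1 (F i)); apply; [exact: sub|exact: sub|exact: sub|exact: Cp|exact: Cq].
pose phi (m : V) : V := \row_i F i m.
have Cphi : Cinf W1 phi.
  move=> k; apply: Ck_mx => // i j.
  by apply: (Ck_ext oW1 _ (CF j k)) => m _; rewrite [RHS]mxE.
have W1m0 : W1 m0 by [].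
have inj v : 'd phi m0 v = 0 -> v = 0.
  move=> dv.
  have dF i : pairing (differential (F i) m0) v = 0.
    have H := is_diff_coord 0 i (differentiableP (Cinf_diff Cphi W1m0)).
    have E : (fun m => phi m 0 i : R^o) = F i by apply/funext => m; rewrite mxE.
    rewrite E in H; apply: etrans (differentialE v (CF i) W1m0) _.
    apply: etrans (is_diffE1 H v) _; apply: etrans (congr1 (fun s : V => s 0 i) dv) _.
    by rewrite mxE.
  have dx := dF ix; have dy := dF iy; have dz := dF iz; have dp := dF ip; have dq := dF iq.
  rewrite -[F ix]/x in dx; rewrite -[F iy]/y in dy; rewrite -[F iz]/z in dz.
  rewrite -[F ip]/p in dp; rewrite -[F iq]/q in dq.
  have tv : pairing (contact_form x y z p q m0) v = 0.
    by rewrite pairing_contact_form dx dy dz !mulr0 !subr0.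
  apply: (extd_nondegenerate (m := m0)) => [|u Uu]; first by rewrite (Ug _ W1m0) pairingZl tv mulr0.
  have tu : pairing (contact_form x y z p q m0) u = 0.
    by move: Uu; rewrite (Ug _ W1m0) pairingZl => /eqP; rewrite mulf_eq0 (negbTE ga0) /= => /eqP.
  have alg (a b G tu' tv' pu pv xu xv qu qv yu yv : R) : tu' = 0 -> tv' = 0 -> xv = 0 -> pv = 0 ->
      yv = 0 -> qv = 0 -> a * tu' - b * tv' + G * (pu * xv - pv * xu + (qu * yv - qv * yu)) = 0.
    by move=> -> -> -> -> -> ->; ring.
  apply: etrans (extd_contact_form oW1 (sub _ Cx) (sub _ Cy) (sub _ Cz) Cp Cq (sub _ Cga) Ug v u W1m0) _.
  exact: alg.
have [A [psi [oA Am0 AW1 oFA [Cpsi psiK]]]] := inverse_function oW1 Cphi W1m0 inj.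
have CphiA : Cinf A phi by move=> k; exact: (Ck_sub AW1 (Cphi k)).
have cE i : Defs.coord phi i = F i by apply/funext => m; rewrite /Defs.coord mxE.
exists A, phi, psi; split => //.
- by move=> m /AW1[].
- split; first by split => //; exact: Cinf_smooth.
  move=> m /AW1 W1m; have E : chart_form phi m = contact_form x y z p q m.
    by rewrite /chart_form !cE.
  by rewrite E /contact (Ug m W1m); apply: annihilator_scale; exact: W1m.2.
Qed.

End ContactForms.

Section ChartFields.
Context {R : realType}.
Notation V := (jet R).
Variables (W : set V) (phi psi : V -> V) (chart : is_chart W phi psi).
Notation x_ k := (Defs.coord phi k).
Notation e_ k := (coord_field phi psi k).

Lemma chart_open : open W. Proof. by case: chart. Qed.
Lemma Cinf_chart : Cinf W phi.
Proof. by case: chart => oW _ sphi _ _; exact: smooth_Cinf. Qed.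
Lemma Cinf_chart_inverse : Cinf (phi @` W) psi.
Proof. by case: chart => _ oW _ spsi _; exact: smooth_Cinf. Qed.
Lemma chart_image m : W m -> (phi @` W) (phi m).
Proof. by move=> Wm; exists m. Qed.

Lemma Cinf_chart_coord k : Cinf W (x_ k).
Proof. by move=> n; exact: (Ck_coord 0 k chart_open (Cinf_chart n)). Qed.

Lemma coord_fieldE k m : W m -> e_ k m = 'd psi (phi m) (unitv R k).
Proof. by move=> Wm; exact: (derive_diff _ Cinf_chart_inverse (chart_image Wm)). Qed.

Lemma Cinf_coord_field k : Cinf W (e_ k).
Proof.
move=> n; have oW := chart_open; have oW' : open (phi @` W) by case: chart.
have C1 := Cinf_dir (unitv R k) oW' Cinf_chart_inverse n.
have C2 := Ck_comp oW oW' chart_image (Cinf_chart n) C1.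
by apply: (Ck_ext oW _ C2) => m Wm; exact: esym (coord_fieldE k Wm).
Qed.

Lemma pairing_chart_coord k m v : W m -> pairing (differential (x_ k) m) v = ('d phi m v) 0 k.
Proof.
move=> Wm; apply: etrans (differentialE v (Cinf_chart_coord k) Wm) _.
exact: (is_diffE1 (is_diff_coord 0 k (differentiableP (Cinf_diff Cinf_chart Wm))) v).
Qed.

Lemma diff_chartK m v : W m -> 'd psi (phi m) ('d phi m v) = v.
Proof.
move=> Wm; have oW := chart_open.
have d1 := is_diff_compose (differentiableP (Cinf_diff Cinf_chart Wm))
  (differentiableP (Cinf_diff Cinf_chart_inverse (chart_image Wm))).
have d2 : is_diff m (fun s => psi (phi s)) id.
  apply: (near_eq_is_diff _ (is_diff_id m)); move: (open_nbhs_nbhs (conj oW Wm)).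
  by apply: filterS => s Ws; case: chart => _ _ _ _ ->.
exact: etrans (esym (is_diffE1 d1 v)) (is_diffE1 d2 v).
Qed.

Lemma diff_chartVK m u : W m -> 'd phi m ('d psi (phi m) u) = u.
Proof.
move=> Wm; have oW' : open (phi @` W) by case: chart.
have pK : psi (phi m) = m by case: chart => _ _ _ _ ->.
have dphi : is_diff (psi (phi m)) phi ('d phi m).
  by rewrite pK; exact: (differentiableP (Cinf_diff Cinf_chart Wm)).
have d1 := is_diff_compose (differentiableP (Cinf_diff Cinf_chart_inverse (chart_image Wm))) dphi.
have d2 : is_diff (phi m) (fun s => phi (psi s)) id.
  apply: (near_eq_is_diff _ (is_diff_id (phi m))); move: (open_nbhs_nbhs (conj oW' (chart_image Wm))).
  by apply: filterS => s [t Wt <-]; case: chart => _ _ _ _ ->.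
exact: etrans (esym (is_diffE1 d1 u)) (is_diffE1 d2 u).
Qed.

Lemma pairing_coord_field k l m : W m -> pairing (differential (x_ k) m) (e_ l m) = (k == l)%:R.
Proof.
move=> Wm; rewrite coord_fieldE // pairing_chart_coord //.
by apply: etrans (congr1 (fun s : V => s 0 k) (diff_chartVK _ Wm)) _; rewrite mxE.
Qed.

Lemma chart_expansion m v : W m ->
  v = \sum_k pairing (differential (x_ k) m) v *: e_ k m.
Proof.
move=> Wm; rewrite -{1}(diff_chartK v Wm).
apply: etrans (diff_coord_sum psi (phi m) _) _; apply: eq_bigr => k _.
by rewrite (pairing_chart_coord k v Wm); congr (_ *: _); exact: esym (coord_fieldE k Wm).
Qed.

Lemma pairing_sum (w : 'rV[R]_5) (c : 'I_5 -> R) (u : 'I_5 -> 'rV[R]_5) :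
  pairing w (\sum_k c k *: u k) = \sum_k c k * pairing w (u k).
Proof.
elim/big_rec2 : _ => [|i y1 y2 _ <-]; first exact: pairing0r.
by rewrite pairingDr pairingZr.
Qed.

Lemma vertical_sum (c : 'I_5 -> R) (u : 'I_5 -> 'rV[R]_5) :
  (forall k, k != ip -> k != iq -> c k = 0) -> \sum_k c k *: u k = c ip *: u ip + c iq *: u iq.
Proof.
move=> c0; rewrite (bigD1 ip) // (bigD1 iq) //= big1 ?addr0 // => k /andP[kp kq].
by rewrite c0 // scale0r.
Qed.

Section Contact.
Hypothesis contact_eq : forall m, W m -> (contact m == annihilator (chart_form phi m))%MS.
Notation theta := (chart_form phi).

(** The factor between U and the contact form of the chart is the value of U on
    d/dz, where the latter is 1. *)
Definition conformal_factor : func R := fun m => pairing (U m) (e_ iz m).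
Notation g := conformal_factor.

Lemma pairing_chart_form m v : pairing (theta m) v = pairing (differential (x_ iz) m) v
  - x_ ip m * pairing (differential (x_ ix) m) v - x_ iq m * pairing (differential (x_ iy) m) v.
Proof. exact: pairing_contact_form. Qed.

Lemma chart_form_ez m : W m -> pairing (theta m) (e_ iz m) = 1.
Proof. by move=> Wm; rewrite pairing_chart_form !pairing_coord_field //= !mulr0 !subr0. Qed.

Lemma contact_chart_form m v : W m -> pairing (U m) v = 0 <-> pairing (theta m) v = 0.
Proof.
move=> Wm; have /eqmxP E := contact_eq Wm.
by split=> H; [apply/annihilatorP; rewrite -E; apply/contactP|apply/contactP; rewrite E; apply/annihilatorP].
Qed.

Lemma U_chart_form m : W m -> U m = g m *: theta m.
Proof.
move=> Wm; apply: pairing_ext => v; rewrite pairingZl mulrC.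
have : pairing (U m) (v - pairing (theta m) v *: e_ iz m) = 0.
  by apply/(contact_chart_form _ Wm); rewrite pairingDr pairingNr pairingZr chart_form_ez // mulr1 subrr.
by rewrite pairingDr pairingNr pairingZr => /eqP; rewrite subr_eq0 => /eqP.
Qed.

Lemma conformal_factor_neq0 m : W m -> g m != 0.
Proof.
move=> Wm; apply/negP => /eqP g0; have := pairing_U m (unitv R iz).
rewrite (U_chart_form Wm) g0 scale0r pairing0l /unitv !mxE /= !mulr0 !subr0 => /eqP.
by rewrite eq_sym oner_eq0.
Qed.

Lemma Cinf_conformal_factor : Cinf W g.
Proof. by move=> n; exact: (Ck_pairing chart_open (Cinf_U chart_open n) (Cinf_coord_field iz n)). Qed.

Lemma extd_vertical m v u : W m ->
  pairing (differential (x_ ix) m) v = 0 -> pairing (differential (x_ iy) m) v = 0 ->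
  pairing (differential (x_ iz) m) v = 0 ->
  extd (@U R) m v u = pairing (differential g m) v * (g m)^-1 * pairing (U m) u
   - g m * (pairing (differential (x_ ip) m) v * pairing (differential (x_ ix) m) u
     + pairing (differential (x_ iq) m) v * pairing (differential (x_ iy) m) u).
Proof.
move=> Wm dx dy dz.
have tv : pairing (theta m) v = 0 by rewrite pairing_chart_form dx dy dz !mulr0 !subr0.
have C k := Cinf_chart_coord k.
apply: etrans (extd_contact_form chart_open (C ix) (C iy) (C iz) (C ip) (C iq) Cinf_conformal_factor U_chart_form v u Wm) _.
have EU : pairing (U m) u = g m * pairing (theta m) u by rewrite -pairingZl -U_chart_form.
rewrite EU.
have alg (a b G tu tv' pu pv xu xv qu qv yu yv : R) : G != 0 -> tv' = 0 -> xv = 0 -> yv = 0 ->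
   a * tu - b * tv' + G * (pu * xv - pv * xu + (qu * yv - qv * yu)) =
   a * G^-1 * (G * tu) - G * (pv * xu + qv * yu) by move=> G0 -> -> ->; field.
exact: (alg _ _ _ _ _ _ _ _ _ _ _ _ _ (conformal_factor_neq0 Wm) tv dx dy).
Qed.

(** A field with no component along d/dx, d/dy, d/dz is recognized as X_f
    from its contraction with dU, by the uniqueness in the definition of X_f. *)
Lemma charField_vertical (f : func R) m v : W m ->
  pairing (differential (x_ ix) m) v = 0 -> pairing (differential (x_ iy) m) v = 0 ->
  pairing (differential (x_ iz) m) v = 0 ->
  (forall u, pairing (differential f m) u = - (g m * (pairing (differential (x_ ip) m) v * pairing (differential (x_ ix) m) u
     + pairing (differential (x_ iq) m) v * pairing (differential (x_ iy) m) u))) ->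
  charField f m = v.
Proof.
move=> Wm dx dy dz Hf; rewrite charFieldE; apply/esym/charFieldP; split.
  by apply/contactP/(contact_chart_form _ Wm); rewrite pairing_chart_form dx dy dz !mulr0 !subr0.
exists (pairing (differential g m) v * (g m)^-1); apply/rowP => j.
rewrite [LHS]mxE (extd_vertical (unitv R j) Wm dx dy dz) -Hf.
by rewrite addrC -pairingZl -pairingDl pairing_unitv.
Qed.

Lemma charField_x m : W m -> charField (x_ ix) m = - (g m)^-1 *: e_ ip m.
Proof.
move=> Wm; have g0 := conformal_factor_neq0 Wm.
apply: (charField_vertical Wm); rewrite ?pairingZr ?(pairing_coord_field _ _ Wm) /= ?mulr0 // => u.
rewrite ?pairingZr ?(pairing_coord_field _ _ Wm) /=.
by move: (pairing _ u) (pairing _ u) => A B; field.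
Qed.

Lemma charField_y m : W m -> charField (x_ iy) m = - (g m)^-1 *: e_ iq m.
Proof.
move=> Wm; have g0 := conformal_factor_neq0 Wm.
apply: (charField_vertical Wm); rewrite ?pairingZr ?(pairing_coord_field _ _ Wm) /= ?mulr0 // => u.
rewrite ?pairingZr ?(pairing_coord_field _ _ Wm) /=.
by move: (pairing _ u) (pairing _ u) => A B; field.
Qed.

Variables (X : vfield R) (a b : func R).
Hypotheses (CX : Cinf W X) (Ca : Cinf W a) (Cb : Cinf W b).
Hypothesis EX : forall m, W m -> X m = a m *: e_ ip m + b m *: e_ iq m.

Lemma vertical_coord m k : W m -> k != ip -> k != iq -> pairing (differential (x_ k) m) (X m) = 0.
Proof.
move=> Wm kp kq; rewrite (EX Wm) pairing_comb.
have E1 := pairing_coord_field k ip Wm; have E2 := pairing_coord_field k iq Wm.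
rewrite (negbTE kp) in E1; rewrite (negbTE kq) in E2.
apply: etrans (congr2 (fun s t : R => a m * s + b m * t) E1 E2) _.
by rewrite /= !mulr0 addr0.
Qed.

Lemma coord_xy_involution : in_involution W (x_ ix) (x_ iy).
Proof.
apply/(first_integralP _ (Cinf_chart_coord iy)) => m Wm.
by rewrite charField_x // pairingZr pairing_coord_field // mulr0.
Qed.

Lemma coord_field_neq0 k m : W m -> e_ k m != 0.
Proof.
move=> Wm; apply/negP => /eqP e0; have := pairing_coord_field k k Wm.
by rewrite e0 pairing0r eqxx => /eqP; rewrite eq_sym oner_eq0.
Qed.

Lemma coord_x_regular : regular_function W (x_ ix).
Proof.
move=> m Wm; rewrite charField_x // scaler_eq0 oppr_eq0 invr_eq0 negb_or.
by rewrite (conformal_factor_neq0 Wm) coord_field_neq0.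
Qed.

Lemma coord_y_regular : regular_function W (x_ iy).
Proof.
move=> m Wm; rewrite charField_y // scaler_eq0 oppr_eq0 invr_eq0 negb_or.
by rewrite (conformal_factor_neq0 Wm) coord_field_neq0.
Qed.

(** The covectors dx, dy, U evaluated on d/dx, d/dy, d/dz form a triangular
    matrix. *)
Lemma coord_xy_independent : independent_functions W (x_ ix) (x_ iy).
Proof.
move=> m Wm; apply: inj_row_free => v.
rewrite -[v]hsubmxK -[lsubmx v]hsubmxK !mul_row_col.
set A := lsubmx (lsubmx v); set B := rsubmx (lsubmx v); set C := rsubmx v.
rewrite (mx11_scalar A) (mx11_scalar B) (mx11_scalar C) !mul_scalar_mx.
move: (A 0 0) (B 0 0) (C 0 0) => al be mu H.
have Hk k : al * (ix == k)%:R + be * (iy == k)%:R + mu * pairing (U m) (e_ k m) = 0.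
  rewrite -(pairing_coord_field ix k Wm) -(pairing_coord_field iy k Wm).
  by rewrite -!pairingZl -!pairingDl H pairing0l.
have mu0 : mu = 0.
  have := Hk iz; rewrite /= !mulr0 !add0r => /eqP; rewrite mulf_eq0.
  by rewrite (negbTE (conformal_factor_neq0 Wm)) orbF => /eqP.
have al0 : al = 0 by have := Hk ix; rewrite mu0 /= mulr1 mulr0 mul0r !addr0.
have be0 : be = 0 by have := Hk iy; rewrite mu0 /= mulr1 mulr0 mul0r addr0 add0r.
by rewrite mu0 al0 be0 !raddf0 !row_mx0.
Qed.

Lemma vertical_charFields : exists a' b' : func R, [/\ Cinf W a', Cinf W b' &
  forall m, W m -> X m = a' m *: charField (x_ ix) m + b' m *: charField (x_ iy) m].
Proof.
have C0 n := @Ck_cst R n V R^o W 0 chart_open.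
exists (fun m => 0 - g m * a m), (fun m => 0 - g m * b m); split.
- by move=> n; exact: (CkB chart_open (C0 n) (CkZ chart_open (Cinf_conformal_factor n) (Ca n))).
- by move=> n; exact: (CkB chart_open (C0 n) (CkZ chart_open (Cinf_conformal_factor n) (Cb n))).
move=> m Wm; rewrite (EX Wm) (charField_x Wm) (charField_y Wm).
have g0 := conformal_factor_neq0 Wm.
move: (e_ ip m) (e_ iq m) (a m) (b m) (g m) g0 => u v A B G G0.
by apply/rowP => j; rewrite !mxE; field.
Qed.

(** The generated space is a canonical square matrix with these rows as span. *)
Definition vertical_plane : plane_field R := fun m =>
  <<col_mx (e_ ip m) (e_ iq m)>>%MS.
Notation P := vertical_plane.

Lemma vertical_planeP m v : W m -> (v <= P m)%MS <->
  (forall k, k != ip -> k != iq -> pairing (differential (x_ k) m) v = 0).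
Proof.
move=> Wm; rewrite /vertical_plane genmxE; split=> [/submxP [c ->] k kp kq|H].
  rewrite -[c]hsubmxK mul_row_col (mx11_scalar (lsubmx c)) (mx11_scalar (rsubmx c)) !mul_scalar_mx.
  have E1 := pairing_coord_field k ip Wm; have E2 := pairing_coord_field k iq Wm.
  rewrite (negbTE kp) in E1; rewrite (negbTE kq) in E2.
  move: (lsubmx c 0 0) (rsubmx c 0 0) E1 E2; clear.
  move: (differential _ m) (e_ ip m) (e_ iq m) => w u u' al be E1 E2.
  by rewrite pairingDr !pairingZr E1 E2 !mulr0 addr0.
rewrite (chart_expansion v Wm); apply: summx_sub => k _.
have := submx_refl (col_mx (e_ ip m) (e_ iq m)); rewrite {1}col_mx_sub => /andP[Hp Hq].
have [->|kp] := eqVneq k ip; first exact: scalemx_sub.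
have [->|kq] := eqVneq k iq; first exact: scalemx_sub.
by rewrite H // scale0r sub0mx.
Qed.

Lemma vertical_smooth : smooth_distribution 2 W P.
Proof.
move=> m Wm; exists W, (fun i : 'I_2 => if i == 0 then e_ ip else e_ iq); split => //.
- exact: chart_open.
- by move=> i; case: ifP => _; apply: (Cinf_smooth chart_open); exact: Cinf_coord_field.
move=> m' Wm'.
have E : \matrix_(i < 2) (if i == 0 then e_ ip else e_ iq) m' = col_mx (e_ ip m') (e_ iq m').
  apply/matrixP => i j; rewrite [RHS]mxE [LHS]mxE.
  by case: (@splitP 1 1 i) => l El; have -> : (i == 0) = (i == 0%N :> nat) by []; rewrite El (ord1 l).
rewrite E /vertical_plane; split; first by apply/eqmxP; exact: genmxE.
rewrite genmxE; apply/eqP; apply: inj_row_free => v.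
rewrite -[v]hsubmxK mul_row_col (mx11_scalar (lsubmx v)) (mx11_scalar (rsubmx v)) !mul_scalar_mx.
move: (lsubmx v 0 0) (rsubmx v 0 0) => al be H.
have Hk k : al * (k == ip)%:R + be * (k == iq)%:R = 0.
  by rewrite -(pairing_coord_field k ip Wm') -(pairing_coord_field k iq Wm') -!pairingZr -pairingDr H pairing0r.
have := Hk ip; have := Hk iq; rewrite /= !mulr1 !mulr0 addr0 add0r => -> ->.
by rewrite !raddf0 row_mx0.
Qed.

Lemma vertical_contact m : W m -> (P m <= contact m)%MS.
Proof.
move=> Wm; apply/rV_subP => v /(vertical_planeP _ Wm) H.
by apply/contactP/(contact_chart_form _ Wm); rewrite pairing_chart_form !H // !mulr0 !subr0.
Qed.

(** The plane is the common kernel of dx, dy and dz, and fields that kill a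
    function have a bracket that kills it. *)
Lemma vertical_involutive : involutive_field W P.
Proof.
move=> N Y Z oN NW [sY YP] [sZ ZP].
have CY := smooth_Cinf oN sY; have CZ := smooth_Cinf oN sZ.
split; first exact: (Cinf_smooth oN (Cinf_bracket oN CY CZ)).
move=> m Nm; apply/(vertical_planeP _ (NW _ Nm)) => k kp kq.
have Ck k' : Cinf N (x_ k') by move=> n; exact: (Ck_sub NW (Cinf_chart_coord k' n)).
have CD := Cinf_differential oN (Ck k).
have Yk m' : N m' -> pairing (differential (x_ k) m') (Y m') = 0.
  by move=> Nm'; have /(vertical_planeP _ (NW _ Nm')) := YP m' Nm'; apply.
have Zk m' : N m' -> pairing (differential (x_ k) m') (Z m') = 0.
  by move=> Nm'; have /(vertical_planeP _ (NW _ Nm')) := ZP m' Nm'; apply.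
have E := etrans (esym (cartan CY CZ CD Nm)) (diff0_near oN (Y m) Nm Zk).
by move: E; rewrite (lie_differential oN CY (Ck k) Nm Yk) pairing0l add0r.
Qed.

Lemma vertical_section : is_section W P X.
Proof.
split; first exact: (Cinf_smooth chart_open).
by move=> m Wm; apply/(vertical_planeP _ Wm) => k; exact: vertical_coord.
Qed.

End Contact.

Lemma chart_vertical (X : vfield R) : Cinf W X ->
  (forall k m, W m -> k != ip -> k != iq -> pairing (differential (x_ k) m) (X m) = 0) ->
  exists a b : func R, [/\ Cinf W a, Cinf W b &
    forall m, W m -> X m = a m *: e_ ip m + b m *: e_ iq m].
Proof.
move=> CX X0; have C k n := Ck_pairing chart_open (Cinf_differential chart_open (Cinf_chart_coord k) n) (CX n).
exists (fun m => pairing (differential (x_ ip) m) (X m)), (fun m => pairing (differential (x_ iq) m) (X m)).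
split; [exact: C|exact: C|move=> m Wm].
apply: etrans (chart_expansion (X m) Wm) _.
by apply: (vertical_sum _ (c := fun k => pairing (differential (x_ k) m) (X m))) => k; exact: X0.
Qed.

End ChartFields.

Section ContactChartOfType.
Context {R : realType}.
Notation V := (jet R).

Lemma U_neq0 (m : V) : U m != 0.
Proof.
apply/negP => /eqP U0; have := pairing_U m (unitv R iz).
by rewrite U0 pairing0l /unitv !mxE /= !mulr0 !subr0 => /eqP; rewrite eq_sym oner_eq0.
Qed.

(** In the coordinates given by the inverse of H, X is the first coordinate
    field, so the other coordinates are integrals of X; U vanishes on the first
    two coordinate fields, so only the last three differentials occur in U. *)
Lemma three_integrals (Om : set V) (X : vfield R) (m0 : V) (H : V -> V) (S : set V) :
  open S -> S 0 -> Cinf S H -> H 0 = m0 -> (forall x, S x -> Om (H x)) ->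
  (forall v, 'd H 0 v = 0 -> v = 0) ->
  (forall m, Om m -> pairing (U m) (X m) = 0) ->
  (forall x, S x -> 'd H x (unitv R ix) = X (H x)) ->
  (forall x, S x -> pairing (U (H x)) ('d H x (unitv R iy)) = 0) ->
  exists (W : set V) (h c : 'I_5 -> func R),
    [/\ open W, W m0, W `<=` Om, forall k, Cinf W (h k) & forall k, Cinf W (c k)] /\
    (forall m k, W m -> k != ix -> pairing (differential (h k) m) (X m) = 0) /\
    (forall m, W m -> U m = c iz m *: differential (h iz) m
       + c ip m *: differential (h ip) m + c iq m *: differential (h iq) m).
Proof.
move=> oS S0 CH H0 SO inj cX dHx dHy.
have [A [G [oA A0 AS oW [CG GK]]]] := inverse_function oS CH S0 inj.
pose W := H @` A.
have CHA : Cinf A H by move=> n; exact: (Ck_sub AS (CH n)).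
have Gid x : A x -> G (H x) = x by exact: GK.
have HG m : W m -> H (G m) = m by move=> [x Ax <-]; rewrite Gid.
have GA m : W m -> A (G m) by move=> [x Ax <-]; rewrite Gid.
have chart : is_chart W G H.
  have EA : G @` W = A.
    apply/seteqP; split=> [_ [m Wm <-]|x Ax]; first exact: GA.
    by exists (H x); [exists x|exact: Gid].
  split => //; rewrite ?EA //; first exact: Cinf_smooth.
  exact: Cinf_smooth.
pose h k := Defs.coord G k; pose e k := coord_field G H k.
have CU := Cinf_U oW.
have Ce k : Cinf W (e k) by exact: (Cinf_coord_field chart k).
have eE k m : W m -> e k m = 'd H (G m) (unitv R k) by move=> Wm; exact: (coord_fieldE chart k Wm).
have ex m : W m -> e ix m = X m.
  by move=> Wm; apply: etrans (eE ix m Wm) _; apply: etrans (dHx _ (AS _ (GA _ Wm))) _; rewrite HG.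
have ey m : W m -> pairing (U m) (e iy m) = 0.
  move=> Wm; have := dHy _ (AS _ (GA _ Wm)); rewrite HG // => E.
  by apply: etrans (congr1 (pairing (U m)) (eE iy m Wm)) E.
have WOm : W `<=` Om by move=> m Wm; rewrite -(HG m Wm); exact: SO _ (AS _ (GA _ Wm)).
exists W, h, (fun k m => pairing (U m) (e k m)); split; [split => //|split].
- by exists 0.
- by move=> k; exact: (Cinf_chart_coord chart k).
- by move=> k n; exact: (Ck_pairing oW (CU n) (Ce k n)).
- move=> m k Wm kx; rewrite -(ex m Wm).
  by apply: etrans (pairing_coord_field chart k ix Wm) _; rewrite (negbTE kx).
move=> m Wm; apply: pairing_ext => v.
have E1 : v = \sum_k pairing (differential (h k) m) v *: e k m := chart_expansion chart v Wm.
have E2 : pairing (U m) v = \sum_k pairing (differential (h k) m) v * pairing (U m) (e k m).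
  by rewrite {1}E1; exact: pairing_sum.
have E3 : pairing (U m) (e ix m) = 0 by rewrite ex //; exact: cX _ (WOm _ Wm).
have alg (a0 a1 b0 b1 b2 b3 b4 : R) (w2 w3 w4 : 'rV[R]_5) : b0 = 0 -> b1 = 0 ->
    a0 * b0 + a1 * b1 + pairing w2 v * b2 + pairing w3 v * b3 + pairing w4 v * b4 =
    pairing (b2 *: w2 + b3 *: w3 + b4 *: w4) v.
  by move=> -> ->; rewrite !pairingDl !pairingZl; ring.
exact: (etrans E2 (etrans (sum5 _) (alg _ _ _ _ _ _ _ _ _ _ E3 (ey m Wm)))).
Qed.

(** One of the three coefficients is nonzero at m0, because U is; its integral
    takes the part of z. *)
Lemma contact_chart_exists (W : set V) (h c : 'I_5 -> func R) (X : vfield R) m0 :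
  open W -> W m0 -> (forall k, Cinf W (h k)) -> (forall k, Cinf W (c k)) ->
  (forall m k, W m -> k != ix -> pairing (differential (h k) m) (X m) = 0) ->
  (forall m, W m -> U m = c iz m *: differential (h iz) m
       + c ip m *: differential (h ip) m + c iq m *: differential (h iq) m) ->
  exists (W' : set V) (phi psi : V -> V), [/\ W' m0, W' `<=` W, contact_chart W' phi psi &
    forall k m, W' m -> k != ip -> k != iq -> pairing (differential (Defs.coord phi k) m) (X m) = 0].
Proof.
move=> oW Wm0 Ch Cc Xh EU.
have main (i j k : 'I_5) : i != ix -> j != ix -> k != ix -> c k m0 != 0 ->
    (forall m, W m -> U m = c i m *: differential (h i) m + c j m *: differential (h j) m + c k m *: differential (h k) m) ->
    exists (W' : set V) (phi psi : V -> V), [/\ W' m0, W' `<=` W, contact_chart W' phi psi &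
    forall k m, W' m -> k != ip -> k != iq -> pairing (differential (Defs.coord phi k) m) (X m) = 0].
  move=> ni nj nk ck E.
  have [W' [phi [psi [W'm0 W'W cc [ex ey ez]]]]] :=
    contact_chart_of_integrals oW Wm0 (Ch i) (Ch j) (Ch k) (Cc i) (Cc j) (Cc k) E ck.
  exists W', phi, psi; split => // l m W'm.
  move: l; apply: Defs.ord5P => // _ _; rewrite ?ex ?ey ?ez; apply: Xh => //; exact: W'W.
have [z0|z0] := eqVneq (c iz m0) 0; last first.
  apply: (main ip iq iz) => // m Wm; rewrite (EU m Wm).
  by rewrite -addrA addrC.
have [p0|p0] := eqVneq (c ip m0) 0; last first.
  apply: (main iz iq ip) => // m Wm; rewrite (EU m Wm).
  by rewrite addrAC.
have [q0|q0] := eqVneq (c iq m0) 0; last by exact: (main iz ip iq).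
exfalso; have := U_neq0 m0; rewrite (EU m0 Wm0) z0 p0 q0.
by rewrite !scale0r !addr0 eqxx.
Qed.

Lemma type_contact_chart (Om : set V) (X : vfield R) (m0 : V) (r : nat) :
  open Om -> Om m0 -> Cinf Om X -> (forall m, Om m -> pairing (U m) (X m) = 0) ->
  (forall m, Om m -> X m != 0) -> (forall m, Om m -> \rank (type_matrix X m) = r) -> (r <= 3)%N ->
  exists (W : set V) (phi psi : V -> V), [/\ W m0, W `<=` Om, contact_chart W phi psi &
    forall k m, W m -> k != ip -> k != iq -> pairing (differential (Defs.coord phi k) m) (X m) = 0].
Proof.
move=> oOm Omm0 CX cX X0 typ r3.
have [ O2 [M [oO2 O2m0 O21 M0 bnd]]] := fourth_derivative_bound oOm CX cX X0 Omm0 typ r3.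
have [v [annv fv]] := ann_complement X0 Omm0 typ r3.
have O2O : O2 `<=` Om by move=> m /O21; exact: gram_domain_sub.
pose Y := ann_proj X m0 v.
have CX2 : Cinf O2 X by move=> n; exact: (Ck_sub O2O (CX n)).
have CY2 : Cinf O2 Y by move=> n; exact: (Ck_sub O21 (Cinf_ann_proj oOm m0 CX v n)).
have Ym0 : Y m0 = v by apply: ann_proj_id; [exact: gram_domain_m0|exact: annv].
have annY m k : O2 m -> (k < 4)%N -> pairing (iterated_lie X k m) (Y m) = 0.
  by move=> O2m; apply: (ann_proj_ann Omm0 typ v (O21 _ O2m)).
rewrite -Ym0 in fv.
have cX2 m : O2 m -> pairing (U m) (X m) = 0 by move=> /O2O; exact: cX.
have [H [S [[oS S0 CH H0] [SO inj dHx dHy]]]] := adapted_parametrization oO2 CX2 CY2 O2m0 fv annY M0 bnd.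
have [W [h [c [[oW Wm0 WO2 Ch Cc] [Xh EU]]]]] := three_integrals oS S0 CH H0 SO inj cX2 dHx dHy.
have [W' [phi [psi [W'm0 W'W cc Hk]]]] := contact_chart_exists oW Wm0 Ch Cc Xh EU.
exists W', phi, psi; split => //.
by move=> m /W'W/WO2/O2O.
Qed.

End ContactChartOfType.

(** * The equivalence *)

Theorem theorem3p15 (R : realType) (Omega : set (jet R)) (X : vfield R)
    (m0 : jet R) :
  open Omega -> Omega m0 ->
  is_section Omega (@contact R) X ->
  (forall m, Omega m -> X m != 0) ->
  (exists k : nat, has_type Omega X k) ->
  [<-> (* 1 *)
       has_type Omega X 2 \/ has_type Omega X 3;
       (* 2 *)
       exists (W : set (jet R)) (f g a b : func R),
         [/\ open W, W m0 & W `<=` Omega] /\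
         [/\ smooth W f, smooth W g, smooth W a & smooth W b] /\
         [/\ regular_function W f, regular_function W g, in_involution W f g &
             forall m, W m ->
               X m = a m *: charField f m + b m *: charField g m];
       (* 3 *)
       exists (W : set (jet R)) (phi psi : jet R -> jet R) (a b : func R),
         [/\ W m0, W `<=` Omega & contact_chart W phi psi] /\
         [/\ smooth W a, smooth W b &
             forall m, W m ->
               X m = a m *: coord_field phi psi ip m
                     + b m *: coord_field phi psi iq m];
       (* 4 *)
       exists (W : set (jet R)) (f g : func R),
         [/\ open W, W m0 & W `<=` Omega] /\
         [/\ smooth W f, smooth W g, regular_function W f & regular_function W g] /\
         [/\ first_integral W X f, first_integral W X g,
             independent_functions W f g & in_involution W f g];
       (* 5 *)
       exists (W : set (jet R)) (P : plane_field R),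
         [/\ open W, W m0 & W `<=` Omega] /\
         [/\ smooth_distribution 2 W P,
             forall m, W m -> (P m <= contact m)%MS,
             involutive_field W P & is_section W P X]].
Proof.
move=> oOm Omm0 [sX XC] X0 [k hk].
have CX := smooth_Cinf oOm sX.
have cX m : Omega m -> pairing (U m) (X m) = 0 by move=> /XC/contactP.
have sub (W : set (jet R)) : W `<=` Omega -> Cinf W X by move=> WO n; exact: (Ck_sub WO (CX n)).
pose s1 := has_type Omega X 2 \/ has_type Omega X 3.
(* Every implication towards condition 1 goes through the rank at m0. *)
have from_rank : (\rank (type_matrix X m0) <= 3)%N -> s1.
  by move=> r3; exact: (has_type_from_rank oOm CX cX Omm0 (X0 m0 Omm0) hk r3).
have to_chart : s1 -> exists (W : set (jet R)) (phi psi : jet R -> jet R) (a b : func R),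
  [/\ W m0, W `<=` Omega & contact_chart W phi psi] /\
  [/\ Cinf W a, Cinf W b & forall m, W m -> X m = a m *: coord_field phi psi ip m + b m *: coord_field phi psi iq m].
  move=> t23.
  have [r [typ r3]] : exists r, (forall m, Omega m -> \rank (type_matrix X m) = r) /\ (r <= 3)%N.
    by case: t23 => ht; [exists 2%N|exists 3%N].
  have [W [phi [psi [Wm0 WO cc Xk]]]] := type_contact_chart oOm Omm0 CX cX X0 typ r3.
  have [a [b [Ca Cb E]]] := chart_vertical cc.1 (sub W WO) (fun k m Wm => Xk k m Wm).
  by exists W, phi, psi, a, b.
have step21 : (exists (W : set (jet R)) (f g a b : func R),
         [/\ open W, W m0 & W `<=` Omega] /\
         [/\ smooth W f, smooth W g, smooth W a & smooth W b] /\
         [/\ regular_function W f, regular_function W g, in_involution W f g &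
             forall m, W m ->
               X m = a m *: charField f m + b m *: charField g m]) -> s1.
  move=> [W [f [g [a [b [[oW Wm0 WO] [[sf sg sa sb] [_ _ inv E]]]]]]]].
  apply: from_rank; apply: (span_rank oW Wm0 (sub W WO) (fun m Wm => cX m (WO m Wm))
    (smooth_Cinf oW sf) (smooth_Cinf oW sg) (smooth_Cinf oW sa) (smooth_Cinf oW sb) inv E).
have step23 : s1 -> exists (W : set (jet R)) (phi psi : jet R -> jet R) (a b : func R),
         [/\ W m0, W `<=` Omega & contact_chart W phi psi] /\
         [/\ smooth W a, smooth W b &
             forall m, W m ->
               X m = a m *: coord_field phi psi ip m
                     + b m *: coord_field phi psi iq m].
  move=> /to_chart [W [phi [psi [a [b [[Wm0 WO cc] [Ca Cb E]]]]]]].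
  have oW := chart_open cc.1.
  by exists W, phi, psi, a, b; split; split => //; exact: Cinf_smooth.
have step41 : (exists (W : set (jet R)) (f g : func R),
         [/\ open W, W m0 & W `<=` Omega] /\
         [/\ smooth W f, smooth W g, regular_function W f & regular_function W g] /\
         [/\ first_integral W X f, first_integral W X g,
             independent_functions W f g & in_involution W f g]) -> s1.
  move=> [W [f [g [[oW Wm0 WO] [[sf sg rf rg] [Xf Xg ind inv]]]]]].
  have Cf := smooth_Cinf oW sf; have Cg := smooth_Cinf oW sg.
  have cXW m (Wm : W m) := cX m (WO m Wm).
  have [a [b [Ca Cb E]]] := first_integrals_decomposition oW (sub W WO) cXW Cf Cg Xf Xg ind inv.
  exact: from_rank (span_rank oW Wm0 (sub W WO) cXW Cf Cg Ca Cb inv E).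
split; last split; last split; last split.
- move=> /to_chart [W [phi [psi [a [b [[Wm0 WO cc] [Ca Cb E]]]]]]].
  have oW := chart_open cc.1.
  have [a' [b' [Ca' Cb' E']]] := vertical_charFields cc.1 cc.2 Ca Cb E.
  exists W, (Defs.coord phi ix), (Defs.coord phi iy), a', b'; split; first by [].
  split; first by split; apply: (Cinf_smooth oW) => //; exact: (Cinf_chart_coord cc.1).
  split => //; [exact: (coord_x_regular cc.1 cc.2)|exact: (coord_y_regular cc.1 cc.2)|exact: (coord_xy_involution cc.1 cc.2)].
- by move=> /step21/step23.
- move=> [W [phi [psi [a [b [[Wm0 WO cc] [sa sb E]]]]]]].
  have oW := chart_open cc.1.
  exists W, (Defs.coord phi ix), (Defs.coord phi iy); split; first by [].
  split.
    split; [apply: (Cinf_smooth oW); exact: (Cinf_chart_coord cc.1)|apply: (Cinf_smooth oW); exact: (Cinf_chart_coord cc.1)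
      |exact: (coord_x_regular cc.1 cc.2)|exact: (coord_y_regular cc.1 cc.2)].
  split.
  - apply/(first_integralP X (Cinf_chart_coord cc.1 ix)) => m Wm; exact: (vertical_coord cc.1 E Wm).
  - apply/(first_integralP X (Cinf_chart_coord cc.1 iy)) => m Wm; exact: (vertical_coord cc.1 E Wm).
  - exact: (coord_xy_independent cc.1 cc.2).
  - exact: (coord_xy_involution cc.1 cc.2).
- move=> /step41 /to_chart [W [phi [psi [a [b [[Wm0 WO cc] [Ca Cb E]]]]]]].
  have oW := chart_open cc.1.
  exists W, (vertical_plane phi psi); split; first by [].
  split; [exact: (vertical_smooth cc.1)|exact: (vertical_contact cc.1 cc.2)|exact: (vertical_involutive cc.1)|].
  exact: (vertical_section cc.1 (sub W WO) E).
- move=> [W [P [[oW Wm0 WO] [sP Pc iP secX]]]].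
  exact: from_rank (distribution_rank oW Wm0 sP Pc iP secX).
Qed.
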